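(* Let $\mathcal{M}\subset\mathbb{R}^n$ be a locally symmetric $C^2$ submanifold of dimension $d$ such that there exist $y\in\mathcal{M}$ and $\rho>0$ for which every point of $\mathcal{M}\cap B(y,\rho)$ has pairwise distinct coordinates (i.e. the characteristic permutation of $\mathcal{M}$ is the identity). Let $\bar x\in\mathcal{M}\cap\mathbb{R}^n_{\ge}\cap\Delta(\sigma)$ for some $\sigma\in\Sigma^n$. Then $\lambda_\sigma^{-1}(\mathcal{M})=\{X_\sigma\in\mathbf{S}^n_\sigma:\lambda_\sigma(X_\sigma)\in\mathcal{M}\}$ is a $C^2$ submanifold of $\mathbf{S}^n_\sigma$ around any $\bar X_\sigma$ with $\lambda_\sigma(\bar X_\sigma)=\bar x$, and its codimension in $\mathbf{S}^n_\sigma$ is $n-d$.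
   Context: $\Sigma^n$ permutations of $\mathbb{N}_n$ acting by $(\sigma x)_i=x_{\sigma^{-1}(i)}$; $P(\sigma)$ partition into orbits of $\sigma$; $P(x)$ partition by equal coordinates; $\Delta(\sigma)=\{x:P(x)=P(\sigma)\}$; $\mathbb{R}^n_{\ge}=\{x:x_1\ge\cdots\ge x_n\}$; $B(x,\delta)$ open ball. A set $S$ is locally symmetric if $S\cap\mathbb{R}^n_\ge\neq\emptyset$ and for every $x\in S$ there is $\delta>0$ with $\sigma(S\cap B(x,\delta))=S\cap B(x,\delta)$ for all $y\in S\cap B(x,\delta)$, all $\sigma$ with $\sigma y=y$; a locally symmetric $C^2$ submanifold is a connected $C^2$ submanifold without boundary that is locally symmetric. Since $\bar x\in\mathbb{R}^n_\ge$, the sets of $P(\sigma)=P(\bar x)$ are intervals of consecutive integers; list them as $I_1,\dots,I_m$ in increasing order. $\mathbf{S}^k$ denotes real symmetric $k\times k$ matrices, $\lambda(Y)$ the nonincreasingly ordered eigenvalue vector. $\mathbf{S}^n_\sigma=\mathbf{S}^{|I_1|}\times\cdots\times\mathbf{S}^{|I_m|}$ and for $X_\sigma=(X_1,\dots,X_m)$, $\lambda_\sigma(X_\sigma)=(\lambda(X_1),\dots,\lambda(X_m))\in\mathbb{R}^n$ (concatenation). *)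

(* Defs.v *)
From HB Require Import structures.
From mathcomp Require Import all_boot all_order all_algebra all_fingroup.
From mathcomp Require Import all_classical all_reals all_analysis.
Set Implicit Arguments. Unset Strict Implicit. Unset Printing Implicit Defensive.
Import Order.TTheory GRing.Theory Num.Theory.
Import numFieldNormedType.Exports.
Local Open Scope classical_set_scope.
Local Open Scope ring_scope.

Section Defs.
Variable R : realType.

Definition C2_on (E F : normedModType R) (U : set E) (f : E -> F) : Prop :=
  forall v w : E,
    (forall x, U x -> differentiable f x /\ differentiable ('D_v f) x) /\
    (forall x, U x -> {for x, continuous ('D_w ('D_v f))}).

(* M is a C^2 submanifold of codimension k of the linear subspace V of E
   around x : locally around x, M is cut out inside V by k equations
   F = 0 with F of class C^2 whose derivative at x maps V onto R^k. *)
Definition C2_submanifold_around (E : normedModType R) (V M : set E)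
    (k : nat) (x : E) : Prop :=
  M x /\
  exists (U : set E) (F : E -> 'rV[R]_k),
    [/\ open U, U x, C2_on U F,
        (forall z : 'rV[R]_k, exists h, V h /\ 'd F x h = z) &
        (forall y, U y -> V y -> (M y <-> F y = 0))].

Definition eball (n : nat) (x : 'rV[R]_n) (delta : R) : set 'rV[R]_n :=
  [set y | \sum_(i < n) (x 0 i - y 0 i) ^+ 2 < delta ^+ 2].

Definition perm_act (n : nat) (s : 'S_n) (x : 'rV[R]_n) : 'rV[R]_n :=
  \row_i x 0 (s^-1 i)%g.

Definition nonincr (n : nat) (x : 'rV[R]_n) : Prop :=
  forall i j : 'I_n, (i <= j)%N -> x 0 j <= x 0 i.

Definition Ppart (n : nat) (x : 'rV[R]_n) : {set {set 'I_n}} :=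
  ((fun i : 'I_n => finset (fun j : 'I_n => x 0 j == x 0 i)) @: [set: 'I_n])%SET.

Definition Delta (n : nat) (s : 'S_n) : set 'rV[R]_n :=
  [set x | Ppart x = porbits s].

Definition locally_symmetric (n : nat) (S : set 'rV[R]_n) : Prop :=
  (exists x, S x /\ nonincr x) /\
  forall x, S x -> exists2 delta : R, 0 < delta &
    forall y, S y -> eball x delta y ->
    forall s : 'S_n, perm_act s y = y ->
      perm_act s @` (S `&` eball x delta) = S `&` eball x delta.

Definition loc_sym_C2_submanifold (n d : nat) (M : set 'rV[R]_n) : Prop :=
  [/\ (d <= n)%N, connected M,
      (forall x, M x -> C2_submanifold_around setT M (n - d) x) &
      locally_symmetric M].

Definition eigs (m : nat) (Y : 'M[R]_m) : seq R :=
  xget [::] [set s : seq R | sorted (fun a b : R => b <= a) s /\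
                             char_poly Y = \prod_(a <- s) ('X - a%:P)].

(* S^n_sigma, realized as the block-diagonal symmetric n x n matrices whose
   diagonal blocks are indexed by the orbits of sigma (entries between
   different orbits vanish); this is linearly isomorphic to
   S^{|I_1|} x ... x S^{|I_m|}. *)
Definition Ssigma (n : nat) (s : 'S_n) : set 'M[R]_n :=
  [set X | X^T = X /\ forall i j : 'I_n, j \notin porbit s i -> X i j = 0].

Definition blocksub (n : nat) (X : 'M[R]_n) (B : {set 'I_n}) : 'M[R]_(#|B|) :=
  \matrix_(a < #|B|, b < #|B|) X (enum_val a) (enum_val b).

(* lambda_sigma(X): concatenation of lambda(X_1), ..., lambda(X_m): the
   coordinate i in block B = porbit sigma i is the k-th largest eigenvalue
   of the block, k = number of indices of B before i. *)
Definition lambda_sigma (n : nat) (s : 'S_n) (X : 'M[R]_n) : 'rV[R]_n :=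
  \row_i nth 0 (eigs (blocksub X (porbit s i)))
               #|[set j in porbit s i | (j < i)%N]%SET|.

Definition lambda_preimage (n : nat) (s : 'S_n) (M : set 'rV[R]_n)
  : set 'M[R]_n :=
  [set X | Ssigma s X /\ M (lambda_sigma s X)].

End Defs.

(* Main.v *)
Require Import Defs.
From HB Require Import structures.
From mathcomp Require Import all_boot all_order all_algebra all_fingroup.
From mathcomp Require Import all_classical all_reals all_analysis.
From mathcomp Require Import ring lra.
Import Order.TTheory GRing.Theory Num.Theory.
Import numFieldNormedType.Exports.
Local Open Scope classical_set_scope.
Local Open Scope ring_scope.
Set Implicit Arguments. Unset Strict Implicit. Unset Printing Implicit Defensive.

(** Let F be a chart equation of M at [xbar].  If two coordinates i, j of [xbar]
agree, then e_i - e_j is tangent to M at [xbar]: otherwise local symmetry forces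
x_i = x_j on M near [xbar], and the set of points of M around which x_i = x_j on M
is open and closed in M, hence all of M, against the existence of a point with
distinct coordinates.  Hence averaging F over the permutations that preserve the
blocks keeps its derivative at [xbar], and a Newton argument shows that the average
still cuts out M.  The average is block-symmetric, and it remains to see that f o
lambda_sigma is C^2 for every block-symmetric C^2 function f.

For the latter, the block traces tr h(X_l) are polynomial in X, and products of
two of them realize by Hermite interpolation any block-symmetric second-order jet at
x0 = lambda_sigma(X0).  Subtracting them, one may assume that f has zero 2-jet at x0;
then the formulas for the first two derivatives of f o lambda_sigma show that they are
small near X0, because the divided differences of the gradient of f over coinciding
coordinates are bounded by second derivatives of f, by symmetry. *)

(** * Eigenvalues of symmetric matrices *)

(** The obstacle is that [lambda_sigma] is merely Lipschitz at repeated eigenvalues and that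
    eigenvectors cannot be chosen continuously there, so no chain rule applies. [spectral_model]
    isolates what can be computed: the derivatives of block traces, written with the matrix of a
    direction in some eigenbasis. It has two instances, R^n with the identity and matrices with the
    eigenvalue map. A single computation for [jetfun] thus fits its 2-jet to f on R^n and gives its
    derivatives on matrices. The fit is redone at every point X: the error f - q composed with the
    eigenvalue map is o(|Y - X|) by the Lipschitz bound alone, and the same comparison of first
    derivatives asks of the eigenbasis only bounded entries. Continuity of second derivatives then
    comes from an estimate and not from a formula. The charts of M have to be averaged because the
    symmetry belongs to M and not to its equations. Derivatives are taken in the space of all n x n
    matrices, from which [symblock] projects onto S^n_sigma. *)

Section Spectral.
Variable R : realType.

Lemma dotE m (u v : 'rV[R]_m) : (u *m v^T) 0 0 = \sum_i u 0 i * v 0 i.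
Proof. by rewrite mxE; apply: eq_bigr => i _; rewrite !mxE. Qed.

Lemma dot_ge0 m (u : 'rV[R]_m) : 0 <= (u *m u^T) 0 0.
Proof. by rewrite dotE; apply: sumr_ge0 => i _; rewrite -expr2 sqr_ge0. Qed.

Lemma dot_eq0 m (u : 'rV[R]_m) : ((u *m u^T) 0 0 == 0) = (u == 0).
Proof.
apply/idP/eqP => [|->]; last by rewrite mul0mx mxE.
rewrite dotE psumr_eq0 => [/allP u0|i _]; last by rewrite -expr2 sqr_ge0.
apply/rowP => i; have := u0 i (mem_index_enum i).
by rewrite mulf_eq0 orbb mxE => /eqP.
Qed.

Lemma mx_entry_le_norm m n (A : 'M[R]_(m, n)) i j : `|A i j| <= `|A|.
Proof.
rewrite [leRHS]/Num.Def.normr/= mx_normrE.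
exact: (le_bigmax _ (fun ij : 'I_m * 'I_n => `|A ij.1 ij.2|) (i, j)).
Qed.

Lemma mx_norm_le_entries m n (A : 'M[R]_(m, n)) e :
  0 <= e -> (forall i j, `|A i j| <= e) -> `|A| <= e.
Proof.
move=> e0 Ae; rewrite [leLHS]/Num.Def.normr/= mx_normrE.
by apply: bigmax_le => // -[i j] _; exact: Ae.
Qed.

Lemma continuous_coord m n i j : continuous (fun A : 'M[R]_(m, n) => A i j).
Proof. by move=> A; exact: coord_continuous. Qed.

Lemma cvg_sumr (T I : Type) (F : set_system T) (FF : Filter F) (r : seq I)
    (P : pred I) (f : I -> T -> R) (l : I -> R) :
  (forall i, P i -> f i x @[x --> F] --> l i) ->
  (\sum_(i <- r | P i) f i x) @[x --> F] --> \sum_(i <- r | P i) l i.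
Proof. by apply: cvg_big; exact: add_continuous. Qed.

Lemma continuous_quadratic_form m (A : 'M[R]_m) :
  continuous (fun u : 'rV[R]_m => (u *m A *m u^T) 0 0).
Proof.
have -> : (fun u : 'rV[R]_m => (u *m A *m u^T) 0 0) =
    (fun u => \sum_i (\sum_j u 0 j * A j i) * u 0 i).
  by apply/funext => u; rewrite mxE; apply: eq_bigr => i _; rewrite !mxE.
move=> u; apply: (cvg_sumr (nbhs_filter u)) => i _; apply: cvgM; last exact: continuous_coord.
apply: (cvg_sumr (nbhs_filter u)) => j _; apply: cvgM; first exact: continuous_coord.
exact: cvg_cst.
Qed.

(** The quadratic form of [A] attains its maximum on the compact unit sphere; a maximizer is an
    eigenvector and the maximum is its eigenvalue. Vectors are rows and matrices act on the
    right. *)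
Lemma symmetric_eigenvector m (A : 'M[R]_m.+1) : A^T = A ->
  exists (a : R) (u : 'rV[R]_m.+1), u *m u^T = 1%:M /\ u *m A = a *: u.
Proof.
move=> symA.
pose S := [set u : 'rV[R]_m.+1 | (u *m u^T) 0 0 = 1].
have S0 : S !=set0.
  exists (delta_mx 0 0); rewrite /S/= trmx_delta mul_delta_mx.
  by rewrite mxE !eqxx.
have cS : closed S.
  have -> : S = (fun u : 'rV[R]_m.+1 => (u *m 1%:M *m u^T) 0 0) @^-1` [set 1].
    by apply/seteqP; split => u; rewrite /S/= mulmx1.
  apply: closed_comp; last exact: closed_eq.
  by move=> u _; exact: continuous_quadratic_form.
have bS : bounded_set S.
  exists 1; split; first exact: num_real.
  move=> M M1 u Su; apply: le_trans (ltW M1).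
  apply: mx_norm_le_entries => // i j; rewrite (ord1 i).
  rewrite -[leLHS]ger0_norm // -[1](@ger0_norm R) // -ler_sqr ?nnegrE //.
  rewrite !normr_id [in leRHS]normr1 expr1n -normrX ger0_norm ?sqr_ge0 //.
  move: Su; rewrite /S /= dotE => <-; rewrite (bigD1 j) //= -expr2 lerDl.
  by apply: sumr_ge0 => k _; rewrite -expr2 sqr_ge0.
have [u /set_mem Su umax] := EVT_max_rV S0 (bounded_closed_compact bS cS)
  (@continuous_subspaceT _ _ S _ (@continuous_quadratic_form _ A)).
pose a := (u *m A *m u^T) 0 0.
have uu : u *m u^T = 1%:M by apply/matrixP => i j; rewrite !ord1 Su mxE eqxx.
exists a, u; split=> //.
have le_a (v : 'rV[R]_m.+1) : (v *m A *m v^T) 0 0 <= a * (v *m v^T) 0 0.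
  have [->|v0] := eqVneq v 0; first by rewrite !mul0mx mxE mulr0.
  have dv : 0 < (v *m v^T) 0 0 by rewrite lt0r dot_eq0 v0 dot_ge0.
  pose c := Num.sqrt ((v *m v^T) 0 0).
  have c2 : c ^+ 2 = (v *m v^T) 0 0 by rewrite sqr_sqrtr ?ltW.
  have c0 : c != 0 by rewrite gt_eqF ?sqrtr_gt0.
  have Sv : S (c^-1 *: v).
    rewrite /S/= linearZ/= -scalemxAl -scalemxAr scalerA mxE -c2.
    by rewrite expr2 -invfM mulVf ?mulf_neq0.
  have := umax _ (mem_set Sv); rewrite -/a linearZ/= -!scalemxAl -scalemxAr scalerA.
  by rewrite mxE -invfM -expr2 c2 mulrC ler_pdivrMr.
have [w wE] : exists w, w = u *m A - a *: u by exists (u *m A - a *: u).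
apply/eqP; rewrite -subr_eq0 -wE -dot_eq0.
have dw := dot_ge0 w; set W := (w *m w^T) 0 0 in dw *.
pose K := a * W - (w *m A *m w^T) 0 0.
have K0 : 0 <= K by rewrite subr_ge0; exact: le_a.
have addE (X Y : 'M[R]_1) : (X + Y) 0 0 = X 0 0 + Y 0 0 by rewrite mxE.
have oppE (X : 'M[R]_1) : (- X) 0 0 = - X 0 0 by rewrite mxE.
have scaleE c (X : 'M[R]_1) : (c *: X) 0 0 = c * X 0 0 by rewrite mxE.
(* first-order optimality of [u] along [u + t w] *)
have quad t : 2 * t * W <= t ^+ 2 * K.
  have := le_a (u + t *: w).
  rewrite linearD/= linearZ/= !mulmxDl !mulmxDr -!scalemxAr -!scalemxAl.
  have sym1 : u *m A *m w^T = w *m A *m u^T.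
    by rewrite -[LHS]trmxK [in LHS]trmx_mul trmxK [(u *m A)^T]trmx_mul symA mulmxA;
      apply/matrixP => i j; rewrite !ord1 mxE.
  have sym2 : u *m w^T = w *m u^T.
    by rewrite -[LHS]trmxK [in LHS]trmx_mul trmxK;
      apply/matrixP => i j; rewrite !ord1 mxE.
  rewrite sym1 sym2 uu.
  have -> : W = (w *m A *m u^T) 0 0 - a * (w *m u^T) 0 0.
    rewrite /W -sym1 -sym2 {1}wE.
    by rewrite mulmxDl mulNmx -scalemxAl addE oppE scaleE.
  by rewrite !addE !scaleE -/a [1%:M 0 0]mxE eqxx mulr1n /K /W; lra.
have [//|W0] := eqVneq W 0.
have Wp : 0 < W by rewrite lt0r W0.
(* This value of [t] turns the inequality into 2 <= K / (K + 1), up to the positive factor W^2 / (K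
   + 1). Dividing by [K + 1] instead of [K] covers K = 0. *)
have := quad (W / (K + 1)).
have K1 : 0 < K + 1 by rewrite ltr_wpDl.
rewrite expr_div_n -mulrA mulrAC -expr2 => h; exfalso.
have : 2 * (W ^+ 2 / (K + 1)) <= W ^+ 2 / (K + 1) * (K / (K + 1)).
  have <- : W ^+ 2 / (K + 1) ^+ 2 * K = W ^+ 2 / (K + 1) * (K / (K + 1)).
    by field; rewrite gt_eqF.
  exact: h.
apply/negP; rewrite -ltNge mulrC ltr_pM2r ?divr_gt0 ?exprn_gt0 //.
by rewrite ltr_pdivrMr //; lra.
Qed.


(** The reflection in the hyperplane orthogonal to w = u - e exchanges the unit vectors u and e. For
    u = e there is no such hyperplane and the identity serves. *)
Lemma householder m (u : 'rV[R]_m.+1) : u *m u^T = 1%:M ->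
  exists P : 'M[R]_m.+1, [/\ P^T = P, P *m P = 1%:M & u *m P = delta_mx 0 0].
Proof.
move=> uu; pose e : 'rV[R]_m.+1 := delta_mx 0 0.
have [w wE0] : exists w, w = u - e by exists (u - e).
have [w0|w0] := eqVneq w 0.
  exists 1%:M; rewrite trmx1 !mulmx1; split=> //.
  by apply/eqP; rewrite -subr_eq0 -/e -wE0 w0.
have ee : e *m e^T = 1%:M.
  by rewrite trmx_delta mul_delta_mx; apply/matrixP => i j; rewrite !ord1 !mxE !eqxx.
have ue : e *m u^T = u *m e^T.
  by rewrite -[LHS]trmxK trmx_mul trmxK; apply/matrixP => i j; rewrite !ord1 [LHS]mxE.
pose d := (w *m w^T) 0 0.
have d0 : d != 0 by rewrite dot_eq0.
have wE : w *m w^T = d%:M by apply/matrixP => i j; rewrite !ord1 [RHS]mxE mulr1n.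
have uwE : u *m w^T = (d / 2)%:M.
  have -> : d = 2 * (u *m w^T) 0 0.
    rewrite /d wE0 linearB/= !mulmxBl !mulmxBr uu ee ue.
    by rewrite !mxE eqxx mulr1n; ring.
  by apply/matrixP => i j; rewrite !ord1 [RHS]mxE mulr1n mulrAC divff ?mul1r // pnatr_eq0.
exists (1%:M - (2 / d) *: (w^T *m w)); split.
- by rewrite linearB/= trmx1 linearZ/= trmx_mul trmxK.
- rewrite mulmxBl mul1mx mulmxBr [_ *m 1%:M]mulmx1 -scalemxAl -scalemxAr scalerA.
  rewrite mulmxA -[_ *m w^T]mulmxA wE mul_mx_scalar -scalemxAl scalerA.
  have -> : 2 / d * (2 / d) * d = 2 / d + 2 / d by field.
  by rewrite scalerDl opprB addrK subrK.
- rewrite mulmxBr mulmx1 -scalemxAr mulmxA uwE mul_scalar_mx scalerA.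
  have -> : 2 / d * (d / 2) = 1 by field; rewrite d0.
  by rewrite scale1r wE0 opprB addrC subrK.
Qed.

(** Deflation: after conjugation by a reflection that moves an eigenvector to the first basis
    vector, the first row is [a] times that vector, by symmetry so is the first column, and the
    induction hypothesis treats the remaining block. *)
Lemma symmetric_diagonalization m (A : 'M[R]_m) : A^T = A ->
  exists (U : 'M[R]_m) (a : 'rV[R]_m),
    U *m U^T = 1%:M /\ A = U *m diag_mx a *m U^T.
Proof.
elim: m A => [|m IH] A symA.
  by exists 1%:M, 0; split; apply/matrixP => -[].
have [a [u [uu uA]]] := symmetric_eigenvector symA.
have [P [symP PP uP]] := householder uu.
have eP : delta_mx 0 0 *m P = u by rewrite -uP -mulmxA PP mulmx1.
pose B : 'M[R]_(1 + m) := P *m A *m P.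
have symB : B^T = B by rewrite !trmx_mul symP symA mulmxA.
have B0 : row 0 B = a *: delta_mx 0 0.
  by rewrite rowE /B !mulmxA eP uA -scalemxAl uP.
have AB : A = P *m B *m P by rewrite /B !mulmxA PP mul1mx -mulmxA PP mulmx1.
clearbody B.
have Bu : ursubmx B = 0.
  apply/matrixP => i j; transitivity (row 0 B 0 (rshift 1 j)).
    by rewrite !ord1 !mxE; congr (B _ _); exact/val_inj.
  by rewrite B0 !mxE /= mulr0.
have Bl : dlsubmx B = 0.
  by rewrite -[dlsubmx B]trmxK trmx_dlsub symB Bu trmx0.
have Ba : ulsubmx B = a%:M.
  apply/matrixP => i j; transitivity (row 0 B 0 (lshift m 0)).
    by rewrite !ord1 !mxE; congr (B _ _); exact/val_inj.
  by rewrite B0 !ord1 !mxE /= mulr1.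
have [|V [b [VV BV]]] := IH (drsubmx B).
  by rewrite trmx_drsub symB.
have BE : B = block_mx 1%:M 0 0 V *m diag_mx (row_mx a%:M b) *m
              (block_mx 1%:M 0 0 V)^T.
  rewrite -[LHS]submxK Bu Bl Ba BV diag_mx_row tr_block_mx !trmx0 trmx1.
  rewrite !mulmx_block !(mulmx0, mul0mx, mulmx1, mul1mx, addr0, add0r).
  congr block_mx; apply/matrixP => i j; rewrite !ord1 !mxE.
  by rewrite eqxx !mulr1n.
have [Q [QQ {}BE]] : exists Q : 'M[R]_(1 + m), Q *m Q^T = 1%:M /\
    B = Q *m diag_mx (row_mx a%:M b) *m Q^T.
  exists (block_mx 1%:M 0 0 V); split=> //.
  rewrite tr_block_mx !trmx0 trmx1 mulmx_block.
  rewrite !(mulmx0, mul0mx, mulmx1, mul1mx, addr0, add0r) VV.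
  by rewrite -scalar_mx_block.
exists (P *m Q), (row_mx a%:M b); split; rewrite trmx_mul symP.
  by rewrite mulmxA -[P *m Q *m _]mulmxA QQ mulmx1 PP.
by rewrite AB [in LHS]BE !mulmxA.
Qed.

Lemma char_poly_orthogonal_conj m (U D : 'M[R]_m) : U *m U^T = 1%:M ->
  char_poly (U *m D *m U^T) = char_poly D.
Proof.
move=> UU; rewrite /char_poly /char_poly_mx.
pose V : 'M[{poly R}]_m := map_mx polyC U.
have VV : V *m V^T = 1%:M by rewrite /V map_trmx -map_mxM UU map_mx1.
have -> : 'X%:M - map_mx polyC (U *m D *m U^T) = V *m ('X%:M - map_mx polyC D) *m V^T.
  by rewrite mulmxBr mulmxBl !map_mxM -map_trmx mul_mx_scalar -scalemxAl VV scalemx1.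
by rewrite !det_mulmx mulrAC -det_mulmx VV det1 mul1r.
Qed.

Lemma char_poly_diag m (a : 'rV[R]_m) :
  char_poly (diag_mx a) = \prod_(i < m) ('X - (a 0 i)%:P).
Proof.
rewrite char_poly_trig ?diag_mx_is_trig //.
by apply: eq_bigr => i _; rewrite mxE eqxx mulr1n.
Qed.

Definition rev_ler : rel R := fun a b => b <= a.

Lemma rev_ler_trans : transitive rev_ler.
Proof. by move=> y x z; rewrite /rev_ler => h1 h2; exact: le_trans h2 h1. Qed.

Lemma rev_ler_total : total rev_ler.
Proof. by move=> x y; exact: le_total. Qed.

(** Diagonalization provides a sorted list of roots, so the default value in the definition of
    [eigs] is never taken on symmetric matrices. *)
Lemma eigs_spec m (A : 'M[R]_m) : A^T = A ->
  sorted rev_ler (eigs A) /\ char_poly A = \prod_(a <- eigs A) ('X - a%:P).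
Proof.
move=> symA; rewrite /eigs; case: xgetP => [s _ [] //|].
have [U [a [UU ->]]] := symmetric_diagonalization symA.
move=> /(_ (sort rev_ler [seq a 0 i | i <- enum 'I_m])) []; split.
  exact: sort_sorted rev_ler_total _.
rewrite char_poly_orthogonal_conj // char_poly_diag.
rewrite (perm_big _ (permEl (perm_sort rev_ler _))) big_map.
by rewrite big_enum.
Qed.

Lemma size_eigs m (A : 'M[R]_m) : A^T = A -> size (eigs A) = m.
Proof.
move=> /eigs_spec [_ /(congr1 (fun p : {poly R} => size p))].
by rewrite size_char_poly size_prod_XsubC => -[].
Qed.

Lemma nth_eigs_nonincr m (A : 'M[R]_m) i j : A^T = A -> (i <= j < m)%N ->
  nth 0 (eigs A) j <= nth 0 (eigs A) i.
Proof.
move=> symA /andP[ij jm]; have [sA _] := eigs_spec symA.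
apply: (sorted_leq_nth rev_ler_trans (fun x => lexx x) 0 sA) => //;
  by rewrite inE size_eigs // (leq_ltn_trans ij).
Qed.

Definition eigrow m (A : 'M[R]_m) : 'rV[R]_m := \row_i nth 0 (eigs A) i.

(** The characteristic polynomial determines the diagonal entries only up to order; a permutation
    matrix, absorbed into the orthogonal factor, sorts them. *)
Lemma eigs_diagonalization m (A : 'M[R]_m) : A^T = A ->
  exists U : 'M[R]_m, U *m U^T = 1%:M /\ A = U *m diag_mx (eigrow A) *m U^T.
Proof.
move=> symA; have [U [a [UU AE]]] := symmetric_diagonalization symA.
have [_ cA] := eigs_spec symA.
have szt : size (eigs A) == m by rewrite size_eigs.
pose t := Tuple szt.
have : perm_eq t [tuple a 0 i | i < m].
  apply: prod_XsubC_eq; rewrite -cA AE char_poly_orthogonal_conj // char_poly_diag.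
  by rewrite big_map big_enum.
move=> /tuple_permP [s tE].
have aE i : eigrow A 0 i = a 0 (s i).
  rewrite mxE -[eigs A]/(tval t) tE -(tnth_nth 0 [tuple tnth _ (s j) | j < m]).
  by rewrite !tnth_mktuple.
pose P : 'M[R]_m := perm_mx s.
have PP : P^T *m P = 1%:M.
  by rewrite /P tr_perm_mx -perm_mxM mulVg perm_mx1.
have PaE : P^T *m diag_mx (eigrow A) *m P = diag_mx a.
  have -> : diag_mx (eigrow A) = P *m diag_mx a *m P^T.
    apply/matrixP => i j; rewrite /P tr_perm_mx -row_permE -col_permE !mxE.
    by rewrite (inj_eq perm_inj) -aE mxE.
  by rewrite !mulmxA PP mul1mx -mulmxA PP mulmx1.
exists (U *m P^T); rewrite !trmx_mul trmxK; split.
  by rewrite mulmxA -[_ *m P^T *m P]mulmxA PP mulmx1.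
by rewrite [LHS]AE -PaE !mulmxA.
Qed.

Lemma quadratic_form_diag m (U : 'M[R]_m) (a x : 'rV[R]_m) :
  (x *m (U *m diag_mx a *m U^T) *m x^T) 0 0 =
  \sum_i a 0 i * ((x *m U) 0 i) ^+ 2.
Proof.
have -> : x *m (U *m diag_mx a *m U^T) *m x^T =
    (x *m U *m diag_mx a) *m (x *m U)^T by rewrite trmx_mul !mulmxA.
rewrite dotE; apply: eq_bigr => i _; rewrite mul_mx_diag mxE; ring.
Qed.

(* The vector [x] is orthogonal to the first [k] eigenvectors of [B] and to the
   last [m - k - 1] ones of [A]; it exists because these are [m - 1] conditions. *)
Lemma weyl_le m (A B : 'M[R]_m) (e : R) (k : 'I_m) : A^T = A -> B^T = B ->
  (forall i j, `|A i j - B i j| <= e) ->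
  eigrow A 0 k - eigrow B 0 k <= m%:R * e.
Proof.
move=> symA symB ABe.
have [U [UU AE]] := eigs_diagonalization symA.
have [V [VV BE]] := eigs_diagonalization symB.
pose W : 'M[R]_m :=
  \matrix_(i, j) if (j < k)%N then V i j else if (k < j)%N then U i j else 0.
(* Column [k] of [W] is zero by construction, whence a nonzero vector in the left kernel. *)
have : \det W == 0.
  rewrite (expand_det_col _ k) big1 // => i _.
  by rewrite mxE ltnn mul0r.
move=> /det0P[x x0 xW].
have xV (j : 'I_m) : (j < k)%N -> (x *m V) 0 j = 0.
  move=> jk; move/rowP: xW => /(_ j); rewrite [RHS]mxE => <-.
  by rewrite !mxE; apply: eq_bigr => i _; rewrite !mxE jk.
have xU (j : 'I_m) : (k < j)%N -> (x *m U) 0 j = 0.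
  move=> kj; move/rowP: xW => /(_ j); rewrite [RHS]mxE => <-.
  by rewrite !mxE; apply: eq_bigr => i _; rewrite !mxE kj ltnNge (ltnW kj).
have nx (Y : 'M[R]_m) : Y *m Y^T = 1%:M ->
    \sum_i ((x *m Y) 0 i) ^+ 2 = (x *m x^T) 0 0.
  move=> YY; transitivity ((x *m Y *m (x *m Y)^T) 0 0).
    by rewrite dotE; apply: eq_bigr => i _; rewrite expr2.
  by rewrite trmx_mul mulmxA -[x *m Y *m _]mulmxA YY mulmx1.
pose d := (x *m x^T) 0 0.
have d0 : 0 < d by rewrite lt0r dot_eq0 x0 dot_ge0.
have hA : eigrow A 0 k * d <= (x *m A *m x^T) 0 0.
  rewrite [in leRHS]AE quadratic_form_diag /d -(nx _ UU) mulr_sumr.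
  apply: ler_sum => i _; have [ik|ki] := leqP i k; last first.
    by rewrite xU // expr0n !mulr0.
  by apply: ler_wpM2r; rewrite ?sqr_ge0 // !mxE nth_eigs_nonincr // ik /=.
have hB : (x *m B *m x^T) 0 0 <= eigrow B 0 k * d.
  rewrite [in leLHS]BE quadratic_form_diag /d -(nx _ VV) mulr_sumr.
  apply: ler_sum => i _; have [ki|ik] := leqP k i; last first.
    by rewrite xV // expr0n !mulr0.
  by apply: ler_wpM2r; rewrite ?sqr_ge0 // !mxE nth_eigs_nonincr // ki /=.
have hAB : (x *m A *m x^T) 0 0 - (x *m B *m x^T) 0 0 <= m%:R * e * d.
  have -> : (x *m A *m x^T) 0 0 - (x *m B *m x^T) 0 0 =
      \sum_i \sum_j x 0 j * x 0 i * (A j i - B j i).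
    rewrite !mxE -sumrB; apply: eq_bigr => i _; rewrite !mxE !mulr_suml -sumrB.
    by apply: eq_bigr => j _; ring.
  (* By the inequality |ab| <= (a^2 + b^2) / 2; the resulting double sum is exactly m * e * d. *)
  apply: (@le_trans _ _ (\sum_(i < m) \sum_(j < m)
      ((x 0 j) ^+ 2 + (x 0 i) ^+ 2) / 2 * e)).
    apply: ler_sum => i _; apply: ler_sum => j _.
    apply: le_trans (ler_norm _) _; rewrite normrM; apply: ler_pM => //.
    rewrite normrM -(real_normK (num_real (x 0 j))) -(real_normK (num_real (x 0 i))).
    by have := sqr_ge0 (`|x 0 j| - `|x 0 i|); lra.
  rewrite /d dotE.
  under eq_bigr => i _ do under eq_bigr => j _ do rewrite mulrDl mulrDl.
  under eq_bigr => i _ do rewrite big_split /= sumr_const card_ord.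
  rewrite big_split /= sumr_const card_ord sumrMnl -!mulr_suml.
  rewrite (eq_bigr (fun i => x 0 i ^+ 2)) ; last by move=> i _; rewrite expr2.
  move: (\sum_(i < m) _) => Z.
  have -> : Z / 2 * e *+ m = m%:R * (Z / 2 * e) by rewrite mulr_natl.
  by have -> : m%:R * e * Z = m%:R * (Z / 2 * e) + m%:R * (Z / 2 * e) by field.
rewrite -(ler_pM2r d0) mulrBl; apply: le_trans hAB.
by apply: lerB.
Qed.

Lemma weyl m (A B : 'M[R]_m) (e : R) (k : 'I_m) : A^T = A -> B^T = B ->
  (forall i j, `|A i j - B i j| <= e) ->
  `|eigrow A 0 k - eigrow B 0 k| <= m%:R * e.
Proof.
move=> symA symB ABe; rewrite ler_norml; apply/andP; split.
  rewrite lerNl opprB; apply: weyl_le => // i j.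
  by rewrite distrC.
exact: weyl_le.
Qed.

End Spectral.

(** * Functions of class C^2 *)

Section Calculus.
Variables (R : realType) (E F : normedModType R).
Implicit Types (f g q : E -> F) (x y z v w : E) (d e : R).

Lemma ball_segment x y z d (t : R) : 0 <= t <= 1 ->
  ball x d y -> ball x d z -> ball x d (y + t *: (z - y)).
Proof.
move=> /andP[t0 t1]; rewrite -!ball_normE /= => xy xz.
have -> : x - (y + t *: (z - y)) = (1 - t) *: (x - y) + t *: (x - z).
  have -> : z - y = (x - y) - (x - z) by rewrite opprB [RHS]addrC subrKA.
  by rewrite opprD addrA [in LHS]scalerBr opprB scalerBl scale1r addrA addrAC.
apply: le_lt_trans (ler_normD _ _) _; rewrite !normrZ (ger0_norm t0).
rewrite (@ger0_norm _ (1 - t)) ?subr_ge0 //.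
have : `|x - y| <= Num.max `|x - y| `|x - z| by rewrite le_max lexx.
have : `|x - z| <= Num.max `|x - y| `|x - z| by rewrite le_max lexx orbT.
have : Num.max `|x - y| `|x - z| < d by rewrite gt_max xy.
move: (Num.max _ _) => M Md zM yM.
apply: le_lt_trans Md; have -> : M = (1 - t) * M + t * M by ring.
by apply: lerD; apply: ler_wpM2l; rewrite ?subr_ge0.
Qed.

Lemma is_diff0_littleo f x :
  (forall e, 0 < e -> \forall y \near x, `|f y - f x| <= e * `|y - x|) ->
  is_diff x f 0.
Proof.
move=> fo; have cst0 : continuous (\0 : E -> F) by move=> ?; exact: cvg_cst.
have h : f \o shift x = cst (f x) + \0 +o_ 0 id.
  apply/eqaddoP => e e0; have := fo e e0.
  rewrite (near_shift 0 x) /= => h; near=> y.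
  have : `|f (y + x) - f x| <= e * `|y + x - x| by near: y; rewrite subr0 in h.
  by rewrite addrK /= !fctE addr0.
have d0 : 'd f x = \0 :> (E -> F) by apply: diff_unique.
by apply: DiffDef => //; apply/diff_locallyP; rewrite d0; split.
Unshelve. all: by end_near. Qed.

Lemma differentiable_littleo f x e : differentiable f x -> 0 < e ->
  \forall y \near x, `|f y - f x - 'd f x (y - x)| <= e * `|y - x|.
Proof.
move=> /diff_locallyP[_ /eqaddoP dfo] e0.
have h : \forall k \near (0 : E), `|f (k + x) - f x - 'd f x k| <= e * `|k|.
  by have := dfo e e0; apply: filterS => k; rewrite /= !fctE opprD addrA.
rewrite (near_shift 0 x) subr0; near=> y; rewrite /= addrK.
by near: y.
Unshelve. all: by end_near. Qed.

(** Replaces the chain rule: derivatives of [f] are read off a smooth [q] that agrees with it to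
    first order, here with both composed with the nonsmooth eigenvalue map. *)
Lemma differentiable_approx f q x : differentiable q x ->
  (forall e, 0 < e -> \forall y \near x,
     `|(f y - q y) - (f x - q x)| <= e * `|y - x|) ->
  differentiable f x /\ forall v, 'D_v f x = 'D_v q x.
Proof.
move=> dq fq.
have fE : f = q + (f - q) by rewrite addrC subrK.
have [dr r0] : is_diff x (f - q) 0 by exact: is_diff0_littleo.
have df : differentiable f x by rewrite fE; exact: differentiableD.
split=> // v.
have rv : 'D_v (f - q) x = 0 by rewrite (deriveE _ dr) r0.
by rewrite [in LHS]fE (deriveD (diff_derivable dq) (diff_derivable dr)) rv addr0.
Qed.

Lemma differentiable_near_eq f q x : (\forall y \near x, f y = q y) ->
  differentiable q x -> differentiable f x.
Proof.
move=> fq dq; have [] // := @differentiable_approx f q x dq.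
move=> e e0; near=> y.
have -> : f y = q y by near: y.
have -> : f x = q x by exact: nbhs_singleton fq.
by rewrite !subrr normr0 mulr_ge0 // ltW.
Unshelve. all: by end_near. Qed.

(** The difference quotients on the two sides are the same function, so no differentiability of [f]
    enters. *)
Lemma derive_comp_linear (G : normedModType R) (L : {linear G -> E}) f (x v : G) :
  'D_v (f \o L) x = 'D_(L v) f (L x).
Proof.
rewrite /derive.
suff -> : (fun h => h^-1 *: ((f \o L \o shift x) (h *: v) - (f \o L) x)) =
          (fun h => h^-1 *: ((f \o shift (L x)) (h *: L v) - f (L x))) by [].
by apply/funext => h /=; rewrite linearP.
Qed.

Lemma deriveDd f x v w : differentiable f x ->
  'D_(v + w) f x = 'D_v f x + 'D_w f x.
Proof. by move=> df; rewrite !deriveE // linearD. Qed.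

Lemma deriveZd f x v (t : R) : differentiable f x ->
  'D_(t *: v) f x = t *: 'D_v f x.
Proof. by move=> df; rewrite !deriveE // linearZ. Qed.

Lemma derive_sumd (I : Type) (r : seq I) (P : pred I) f x (v : I -> E) :
  differentiable f x ->
  'D_(\sum_(i <- r | P i) v i) f x = \sum_(i <- r | P i) 'D_(v i) f x.
Proof.
move=> df; rewrite deriveE // linear_sum; apply: eq_bigr => i _.
by rewrite deriveE.
Qed.

Section C2.
Variable U : set E.
Hypothesis oU : open U.

Lemma C2_diff f x : C2_on U f -> U x -> differentiable f x.
Proof. by move=> /(_ 0 0)[h _] /h[]. Qed.

Lemma C2_diff1 f x v : C2_on U f -> U x -> differentiable ('D_v f) x.
Proof. by move=> /(_ v 0)[h _] /h[]. Qed.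

Lemma C2_cont2 f x v w : C2_on U f -> U x -> {for x, continuous ('D_w ('D_v f))}.
Proof. by move=> /(_ v w)[_ h] /h. Qed.

Lemma C2_onD f g : C2_on U f -> C2_on U g -> C2_on U (f + g).
Proof.
move=> cf cg v w.
have e1 u y : U y -> 'D_u (f + g) y = ('D_u f + 'D_u g) y.
  by move=> Uy; rewrite deriveD //; apply: diff_derivable; exact: C2_diff Uy.
have n1 x : U x -> \forall y \near x, 'D_v (f + g) y = ('D_v f + 'D_v g) y.
  move=> Ux; have : \forall y \near x, U y by exact: open_nbhs_nbhs.
  by apply: filterS => y; exact: e1.
have e2 y : U y -> 'D_w ('D_v (f + g)) y = ('D_w ('D_v f) + 'D_w ('D_v g)) y.
  move=> Uy; rewrite (near_eq_derive w (n1 _ Uy)) deriveD //;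
    by apply: diff_derivable; exact: C2_diff1 Uy.
split=> x Ux.
  split; first by apply: differentiableD; exact: C2_diff Ux.
  by apply: differentiable_near_eq (n1 _ Ux) _; apply: differentiableD; exact: C2_diff1 Ux.
rewrite /prop_for /continuous_at e2 //.
have : ('D_w ('D_v f) + 'D_w ('D_v g)) y @[y --> x] -->
       ('D_w ('D_v f) + 'D_w ('D_v g)) x.
  by apply: cvgD; exact: C2_cont2 Ux.
apply: cvg_trans; apply: near_eq_cvg; near=> y; rewrite e2 //.
by near: y; exact: open_nbhs_nbhs.
Unshelve. all: by end_near. Qed.

Lemma C2_onZ f (k : R) : C2_on U f -> C2_on U (k \*: f).
Proof.
move=> cf v w.
have e1 u y : U y -> 'D_u (k \*: f) y = (k \*: 'D_u f) y.
  by move=> Uy; rewrite deriveZ //; apply: diff_derivable; exact: C2_diff Uy.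
have n1 x : U x -> \forall y \near x, 'D_v (k \*: f) y = (k \*: 'D_v f) y.
  move=> Ux; have : \forall y \near x, U y by exact: open_nbhs_nbhs.
  by apply: filterS => y; exact: e1.
have e2 y : U y -> 'D_w ('D_v (k \*: f)) y = (k \*: 'D_w ('D_v f)) y.
  move=> Uy; rewrite (near_eq_derive w (n1 _ Uy)) deriveZ //;
    by apply: diff_derivable; exact: C2_diff1 Uy.
split=> x Ux.
  split; first by apply: differentiableZ; exact: C2_diff Ux.
  by apply: differentiable_near_eq (n1 _ Ux) _; apply: differentiableZ; exact: C2_diff1 Ux.
rewrite /prop_for /continuous_at e2 //.
have : (k \*: 'D_w ('D_v f)) y @[y --> x] --> (k \*: 'D_w ('D_v f)) x.
  by apply: cvgZr; exact: C2_cont2 Ux.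
apply: cvg_trans; apply: near_eq_cvg; near=> y; rewrite e2 //.
by near: y; exact: open_nbhs_nbhs.
Unshelve. all: by end_near. Qed.

End C2.

Lemma C2_on_comp_linear (G : normedModType R) (U : set E) (L : {linear G -> E}) f :
  continuous L -> C2_on U f -> C2_on (L @^-1` U) (f \o L).
Proof.
move=> cL cf v w.
have e1 u (h : E -> F) : 'D_u (h \o L) = 'D_(L u) h \o L.
  by apply/funext => y; rewrite derive_comp_linear.
split=> x Ux; rewrite !e1.
  by split; apply: differentiable_comp; [exact: linear_differentiable|
    exact: C2_diff Ux| exact: linear_differentiable|exact: C2_diff1 Ux].
by apply: continuous_comp; [exact: cL|exact: C2_cont2 Ux].
Qed.

Lemma C2_onS (U V : set E) f : V `<=` U -> C2_on U f -> C2_on V f.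
Proof. by move=> VU cf v w; have [h1 h2] := cf v w; split=> x /VU; auto. Qed.

End Calculus.

(** * Mean value theorem and symmetry of second derivatives *)

Section ScalarCalculus.
Variables (R : realType) (E : normedModType R).
Implicit Types (f g : E -> R) (x y z v w : E).

Lemma derive_along_line f x v (t : R) : differentiable f (x + t *: v) ->
  is_derive t 1 (fun s : R => f (x + s *: v)) ('D_v f (x + t *: v)).
Proof.
move=> df.
have eqq : (fun h : R => h^-1 *: (f (x + (h *: 1 + t) *: v) - f (x + t *: v))) =
    (fun h : R => h^-1 *: (f (h *: v + (x + t *: v)) - f (x + t *: v))).
  by apply/funext => h; rewrite [h *: 1]mulr1 scalerDl addrCA.
have dv := diff_derivable (v := v) df.
split; first by rewrite /derivable /= eqq; exact: dv.
by rewrite /derive /= eqq.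
Qed.

Lemma MVT_dir f x v :
  (forall t : R, 0 <= t <= 1 -> differentiable f (x + t *: v)) ->
  exists2 c : R, 0 < c < 1 & f (x + v) - f x = 'D_v f (x + c *: v).
Proof.
move=> df.
have [||c c01] := @MVT R (fun s : R => f (x + s *: v))
    (fun s => 'D_v f (x + s *: v)) 0 1 ltr01.
- move=> t; rewrite in_itv /= => /andP[t0 t1]; apply: derive_along_line.
  by apply: df; rewrite !ltW.
- apply: derivable_within_continuous => t; rewrite in_itv /= => t01.
  by have [] := derive_along_line (df _ t01).
rewrite scale1r scale0r addr0 subr0 mulr1 => fE; by exists c.
Qed.

Lemma nbhs_add_small x v w (P : set E) : nbhs x P ->
  exists2 t : R, 0 < t & forall a b : R, `|a| <= t -> `|b| <= t ->
    P (x + a *: v + b *: w).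
Proof.
move=> /nbhs_ballP[d /= d0 dP]; pose K := `|v| + `|w| + 1.
have K0 : 0 < K by rewrite ltr_wpDl // addr_ge0.
exists (d / K / 2) => [|a b at' bt]; first by rewrite !divr_gt0.
apply: dP; rewrite -ball_normE /= -addrA opprD addNKr normrN.
apply: le_lt_trans (ler_normD _ _) _; rewrite !normrZ.
have dK : 0 < d / K / 2 by rewrite !divr_gt0.
apply: (@le_lt_trans _ _ (d / K / 2 * (`|v| + `|w|))).
  by rewrite mulrDr lerD // ler_wpM2r.
apply: (@lt_le_trans _ _ (d / K / 2 * K)).
  by rewrite ltr_pM2l // ltrDl.
by rewrite mulrAC divfK ?gt_eqF // ler_pdivrMr //; lra.
Qed.

(* Both mixed derivatives approximate the second difference
   [f (x + t v + t w) - f (x + t v) - f (x + t w) + f x]. *)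
Lemma derive_comm_le (U : set E) f x v w (e : R) : open U -> C2_on U f -> U x ->
  0 < e -> exists2 t : R, 0 < t & forall s : R, 0 < s <= t ->
  `|s * s * 'D_w ('D_v f) x -
    (f (x + s *: v + s *: w) - f (x + s *: v) - (f (x + s *: w) - f x))|
  <= s * s * e.
Proof.
move=> oU cf Ux e0.
have nb : nbhs x (U `&` [set y | `|'D_w ('D_v f) x - 'D_w ('D_v f) y| <= e]).
  apply: filterI; first exact: open_nbhs_nbhs.
  by have /cvgrPdist_le/(_ e e0) := C2_cont2 (v := v) (w := w) cf Ux.
have [t t0 tP] := nbhs_add_small v w nb.
exists t => // s /andP[s0 st].
have inU (a b : R) : 0 <= a <= 1 -> 0 <= b <= 1 ->
    U (x + (a * s) *: v + (b * s) *: w) /\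
    `|'D_w ('D_v f) x - 'D_w ('D_v f) (x + (a * s) *: v + (b * s) *: w)| <= e.
  move=> /andP[a0 a1] /andP[b0 b1].
  by apply: tP; rewrite ger0_norm ?mulr_ge0 // ?(ltW s0) //;
    apply: le_trans st; rewrite ler_piMl // ltW.
(* The second difference is the increment of [g] along [s *: v]. One mean value theorem for [g]
   along v and one for ['D_v f] along w express it as s^2 times a mixed derivative at a nearby
   point. *)
pose g y := f (y + s *: w) - f y.
have gE y : g y = (f \o shift (s *: w)) y - f y by [].
have dsh y : differentiable f (y + s *: w) -> differentiable (f \o shift (s *: w)) y.
  by move=> df; apply: differentiable_comp.
have Dsh u y : 'D_u (f \o shift (s *: w)) y = 'D_u f (y + s *: w).
  rewrite /derive.
  suff -> : (fun h => h^-1 *: ((f \o shift (s *: w) \o shift y) (h *: u) -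
                               (f \o shift (s *: w)) y)) =
            (fun h => h^-1 *: ((f \o shift (y + s *: w)) (h *: u) -
                               f (y + s *: w))) by [].
  by apply/funext => h /=; rewrite addrA.
have [a|c /andP[c0 c1]] := @MVT_dir g x (s *: v).
  move=> a01; apply: differentiableB; last first.
    apply: (C2_diff cf); have [] := inU a 0 a01; rewrite ?lexx ?ler01 //.
    by rewrite mul0r scale0r addr0 scalerA.
  apply: dsh; apply: (C2_diff cf); have [] := inU a 1 a01; rewrite ?lexx ?ler01 //.
  by rewrite mul1r scalerA.
have c01 : 0 <= c <= 1 by rewrite !ltW.
pose y := x + (c * s) *: v.
have Uy : U y.
  have [] := inU c 0 c01; rewrite ?lexx ?ler01 //.
  by rewrite mul0r scale0r addr0.
have Uy' : U (y + s *: w).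
  by have [] := inU c 1 c01; rewrite ?lexx ?ler01 // mul1r.
rewrite scalerA -/y.
have -> : 'D_(s *: v) g y = s * ('D_v f (y + s *: w) - 'D_v f y).
  have -> : g = (f \o shift (s *: w)) - f by [].
  rewrite deriveB ?Dsh; last 2 first.
  - by apply: diff_derivable; apply: dsh; exact: C2_diff Uy'.
  - by apply: diff_derivable; exact: C2_diff Uy.
  by rewrite !deriveZd -?scalerBr //; exact: C2_diff cf _.
have [b|c' /andP[c0' c1']] := @MVT_dir ('D_v f) y (s *: w).
  by move=> b01; apply: (C2_diff1 v cf); have [] := inU c b c01 b01; rewrite scalerA.
have c01' : 0 <= c' <= 1 by rewrite !ltW.
rewrite scalerA => ->; have [Uz hz] := inU c c' c01 c01'.
rewrite deriveZd; last exact: C2_diff1 Uz.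
rewrite /g => ->; rewrite -[s *: _]/(s * _) mulrA -mulrBr normrM.
have ss : 0 < s * s by rewrite mulr_gt0.
by rewrite (gtr0_norm ss) ler_pM2l.
Qed.

Lemma derive_comm (U : set E) f x v w : open U -> C2_on U f -> U x ->
  'D_w ('D_v f) x = 'D_v ('D_w f) x.
Proof.
move=> oU cf Ux; apply/eqP; rewrite -subr_eq0 -normr_le0.
apply/ler_addgt0Pl => e e0; rewrite addr0.
have e2 : 0 < e / 2 by rewrite divr_gt0.
have [t t0 tP] := derive_comm_le v w oU cf Ux e2.
have [t' t0' tP'] := derive_comm_le w v oU cf Ux e2.
pose s := Num.min t t'.
have s0 : 0 < s by rewrite lt_min t0.
have := tP s; rewrite s0 ge_min lexx => /(_ isT).
have := tP' s; rewrite s0 ge_min lexx orbT => /(_ isT).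
rewrite (addrAC x (s *: v) (s *: w)).
set A := f _; set B := f _; set C := f _; set D := f _.
set P := 'D_v _ _; set Q := 'D_w _ _ => h1 h2.
have ss : 0 < s * s by rewrite mulr_gt0.
rewrite -(ler_pM2l ss) -{1}(gtr0_norm ss) -normrM.
have -> : s * s * (Q - P) = (s * s * Q - (A - C - (B - D))) - (s * s * P - (A - B - (C - D))).
  by ring.
apply: le_trans (ler_normB _ _) _.
have -> : s * s * e = s * s * (e / 2) + s * s * (e / 2) by field.
exact: (lerD h2 h1).
Qed.

End ScalarCalculus.

(** * Polynomial functions and divided differences *)

Section PolyFun.
Variables (R : realType) (E : normedModType R).

(** The generators are described by constant directional derivatives, which avoids bundled linear
    maps. The class is stable under directional derivatives, so its members are C^2 and their
    derivatives follow from the sum and product rules. *)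
Inductive polyfun : (E -> R) -> Prop :=
| polyfun_cst c : polyfun (fun=> c)
| polyfun_lin L : (forall x, differentiable L x) ->
    (forall v, exists c, 'D_v L = fun=> c) -> polyfun L
| polyfunD f g : polyfun f -> polyfun g -> polyfun (fun x => f x + g x)
| polyfunM f g : polyfun f -> polyfun g -> polyfun (fun x => f x * g x).

Lemma polyfun_diff f x : polyfun f -> differentiable f x.
Proof.
elim=> [c|L dL _|g h _ dg _ dh|g h _ dg _ dh].
- exact: differentiable_cst.
- exact: dL.
- exact: (differentiableD dg dh).
- exact: (differentiableM dg dh).
Qed.

Lemma derive_polyfunD f g x v : polyfun f -> polyfun g ->
  'D_v (fun y => f y + g y) x = 'D_v f x + 'D_v g x.
Proof.
move=> pf pg; exact: (deriveD (diff_derivable (polyfun_diff x pf))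
                              (diff_derivable (polyfun_diff x pg))).
Qed.

Lemma derive_polyfunM f g x v : polyfun f -> polyfun g ->
  'D_v (fun y => f y * g y) x = f x * 'D_v g x + g x * 'D_v f x.
Proof.
move=> pf pg; exact: (deriveM (diff_derivable (polyfun_diff x pf))
                              (diff_derivable (polyfun_diff x pg))).
Qed.

Lemma derive_cst0 (c : R) (x v : E) : 'D_v (fun _ : E => c) x = 0.
Proof. exact: derive_cst. Qed.

Lemma polyfun_derive f v : polyfun f -> polyfun ('D_v f).
Proof.
elim=> [c|L dL cL|g h pg IHg ph IHh|g h pg IHg ph IHh].
- rewrite (_ : 'D_v _ = fun=> 0); first exact: polyfun_cst.
  by apply/funext => x; exact: derive_cst0.
- by have [c ->] := cL v; exact: polyfun_cst.
- rewrite (_ : 'D_v _ = fun x => 'D_v g x + 'D_v h x); first exact: polyfunD.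
  by apply/funext => x; exact: derive_polyfunD.
- rewrite (_ : 'D_v _ = fun x => g x * 'D_v h x + h x * 'D_v g x).
    by apply: polyfunD; exact: polyfunM.
  by apply/funext => x; exact: derive_polyfunM.
Qed.

Lemma polyfun_cont f : polyfun f -> continuous f.
Proof. by move=> pf x; apply: differentiable_continuous; exact: polyfun_diff. Qed.

Lemma polyfun_C2 f U : polyfun f -> C2_on U f.
Proof.
move=> pf v w; split=> x _.
  by split; apply: polyfun_diff => //; exact: polyfun_derive.
by apply: polyfun_cont; apply: polyfun_derive; exact: polyfun_derive.
Qed.

Lemma derive_polyfunZ (c : R) f x v : polyfun f ->
  'D_v (fun y => c * f y) x = c * 'D_v f x.
Proof.
by move=> pf; rewrite (derive_polyfunM _ _ (polyfun_cst c) pf) derive_cst0 mulr0 addr0.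
Qed.

Lemma polyfunZ (c : R) f : polyfun f -> polyfun (fun x => c * f x).
Proof. by move=> pf; apply: polyfunM => //; exact: polyfun_cst. Qed.

Lemma polyfun_sum (I : Type) (r : seq I) (P : pred I) (f : I -> E -> R) :
  (forall i, polyfun (f i)) -> polyfun (fun x => \sum_(i <- r | P i) f i x).
Proof.
move=> pf; elim: r => [|i r IH].
  by under eq_fun do rewrite big_nil; exact: polyfun_cst.
under eq_fun do rewrite big_cons.
by case: (P i) => //; exact: polyfunD.
Qed.

Lemma derive_polyfun_sum (I : Type) (r : seq I) (P : pred I) (f : I -> E -> R) x v :
  (forall i, polyfun (f i)) ->
  'D_v (fun y => \sum_(i <- r | P i) f i y) x = \sum_(i <- r | P i) 'D_v (f i) x.
Proof.
move=> pf; elim: r => [|i r IH].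
  rewrite (_ : (fun y => _) = fun=> 0) ?derive_cst0 ?big_nil //.
  by apply/funext => y; rewrite big_nil.
rewrite (_ : (fun y => _) = (fun y => if P i then f i y + \sum_(j <- r | P j) f j y
                             else \sum_(j <- r | P j) f j y)).
  rewrite big_cons; case: (P i); last by rewrite IH.
  by rewrite derive_polyfunD ?IH //; exact: polyfun_sum.
by apply/funext => y; rewrite big_cons.
Qed.

End PolyFun.

Lemma polyfun_comp_linear (R : realType) (E G : normedModType R)
    (L : {linear G -> E}) (f : E -> R) :
  continuous L -> polyfun f -> polyfun (f \o L).
Proof.
move=> cL; elim=> [c|K dK cK|g h _ IHg _ IHh|g h _ IHg _ IHh].
- exact: polyfun_cst.
- apply: polyfun_lin => [x|v].
    apply: differentiable_comp; last exact: dK.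
    exact: linear_differentiable.
  have [c Kc] := cK (L v); exists c; apply/funext => x.
  by rewrite derive_comp_linear (congr1 (fun g => g (L x)) Kc).
- exact: (polyfunD IHg IHh).
- exact: (polyfunM IHg IHh).
Qed.

Lemma derive_coord (R : realType) m n (i : 'I_m) (j : 'I_n) (X v : 'M[R]_(m, n)) :
  'D_v (fun Y : 'M[R]_(m, n) => Y i j) X = v i j.
Proof.
have := derive_mx (@derivable_id _ _ X v).
by rewrite [LHS]derive_id => /matrixP/(_ i j); rewrite mxE => ->.
Qed.

Lemma polyfun_coord (R : realType) m n (i : 'I_m) (j : 'I_n) :
  polyfun (fun X : 'M[R]_(m, n) => X i j).
Proof.
apply: polyfun_lin => [X|v]; first exact: differentiable_coord.
by exists (v i j); apply/funext => X; exact: derive_coord.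
Qed.

(** * Divided differences and Hermite interpolation *)

Section DividedDifference.
Variable R : realType.
Implicit Types (h : {poly R}) (a b : R).

(** The sum of all monomials of degree k - 1 in a and b, which is the divided difference of t^k;
    being polynomial, it also makes sense for a = b. *)
Fixpoint ddX k a b : R := if k is k'.+1 then b ^+ k' + a * ddX k' a b else 0.

Lemma ddXP k a b : (a - b) * ddX k a b = a ^+ k - b ^+ k.
Proof.
elim: k => [|k IH] /=; first by rewrite mulr0 !expr0 subrr.
by rewrite mulrDr mulrCA IH !exprS; ring.
Qed.

Lemma ddX_diag k a : ddX k a a = a ^+ k.-1 *+ k.
Proof.
elim: k => [|k IH] //=; rewrite IH mulrnAr -exprS mulrS; congr (_ + _).
by case: k {IH} => //= k; rewrite !mulr0n.
Qed.

Definition ddpoly h a b := \sum_(k < size h) h`_k * ddX k a b.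

Lemma ddpoly_neq h a b : a != b -> ddpoly h a b = (h.[a] - h.[b]) / (a - b).
Proof.
move=> ab; have ab0 : a - b != 0 by rewrite subr_eq0.
apply: (mulfI ab0); rewrite mulrCA divff // mulr1 mulr_sumr !horner_coef -sumrB.
by apply: eq_bigr => k _; rewrite mulrCA ddXP mulrBr.
Qed.

Lemma ddpoly_diag h a : ddpoly h a a = h^`().[a].
Proof.
rewrite -[in RHS](coefK h) poly_def raddf_sum /= horner_sum.
apply: eq_bigr => k _; rewrite derivZ hornerZ derivXn hornerMn hornerXn.
by rewrite ddX_diag.
Qed.

(** The factor [w] vanishes to third order at every node of [s] and not at [c]; a quadratic factor
    vanishing at [c] then adjusts the first two derivatives there. *)
Lemma hermite_exists (c : R) (s : seq R) (a b : R) : c \notin s ->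
  exists h : {poly R}, [/\ h.[c] = 0, h^`().[c] = a, h^`()^`().[c] = b &
    forall d, d \in s -> [/\ h.[d] = 0, h^`().[d] = 0 & h^`()^`().[d] = 0]].
Proof.
move=> cs; pose w : {poly R} := \prod_(d <- s) ('X - d%:P) ^+ 3.
have wc : w.[c] != 0.
  rewrite horner_prod; elim: s cs {w} => [|d s IH]; first by rewrite big_nil oner_eq0.
  rewrite inE negb_or big_cons => /andP[cd /IH h]; rewrite mulf_neq0 //.
  by rewrite horner_exp hornerXsubC expf_neq0 // subr_eq0.
(* The solution of w(c) al = a and 2 w'(c) al + 2 w(c) be = b, the first two derivatives of [w * g]
   at [c]. *)
pose al := a / w.[c]; pose be := (b - 2 * w^`().[c] * al) / (2 * w.[c]).
pose g : {poly R} := (al%:P + be%:P * ('X - c%:P)) * ('X - c%:P).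
exists (w * g).
have gE : g^`() = be%:P * ('X - c%:P) + (al%:P + be%:P * ('X - c%:P)).
  by rewrite /g derivM derivD derivM !derivC !derivXsubC; ring.
have gE2 : g^`()^`() = be%:P + be%:P.
  by rewrite gE !derivD derivM !derivC !derivXsubC; ring.
have gc : g.[c] = 0 by rewrite hornerM hornerXsubC subrr mulr0.
have gc1 : g^`().[c] = al.
  by rewrite gE !(hornerD, hornerM) hornerN !hornerC hornerX subrr !mulr0 add0r addr0.
have gc2 : g^`()^`().[c] = be + be by rewrite gE2 hornerD hornerC.
clearbody g; split.
- by rewrite hornerM gc mulr0.
- by rewrite derivM hornerD !hornerM gc gc1 mulr0 add0r /al mulrC divfK.
- rewrite derivM derivD !derivM !(hornerD, hornerM) gc gc1 gc2 /be.
  by field.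
move=> d ds; pose L : {poly R} := 'X - d%:P.
have L1 : L^`() = 1 by rewrite derivXsubC.
have L0 : L.[d] = 0 by rewrite hornerXsubC subrr.
have [k ->] : exists k, w * g = k * (L * L * L).
  exists ((\prod_(e <- rem d s) ('X - e%:P) ^+ 3) * g).
  by rewrite /w (big_rem d) //= -/L; ring.
have k1 : (k * (L * L * L))^`() = (k^`() * L + (k + k + k)) * (L * L).
  by rewrite !derivM L1; ring.
move: (k^`() * L + (k + k + k)) k1 => k' k1; rewrite k1.
have k2 : (k' * (L * L))^`() = (k'^`() * L + (k' + k')) * L.
  by rewrite !derivM L1; ring.
by rewrite k2 !hornerM L0 !mulr0.
Qed.

End DividedDifference.

(** * Block-symmetric functions of eigenvalues *)

Section Models.
Variables (R : realType) (n : nat) (blk : rel 'I_n).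
Hypotheses (blkR : reflexive blk) (blkS : symmetric blk) (blkT : transitive blk).
Implicit Types (x y : 'rV[R]_n) (i j l : 'I_n) (h : {poly R}).

(** For a vector of eigenvalues this is the trace of h applied to the diagonal block that contains
    the index i. *)
Definition blocksum h i x := \sum_(l | blk i l) h.[x 0 l].

(* [A X v] plays the role of the direction [v] written in an eigenbasis of [X]. *)
Definition spectral_model (E : normedModType R) (Lam : E -> 'rV[R]_n)
    (A : E -> E -> 'M[R]_n) : Prop :=
  forall h i, [/\ polyfun (blocksum h i \o Lam),
    forall X v, 'D_v (blocksum h i \o Lam) X =
      \sum_(l | blk i l) h^`().[Lam X 0 l] * A X v l l &
    forall X v w, 'D_w ('D_v (blocksum h i \o Lam)) X =
      \sum_(a | blk i a) \sum_(b | blk i b)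
        ddpoly h^`() (Lam X 0 a) (Lam X 0 b) * (A X w a b * A X v b a)].

Lemma polyfun_horner (E : normedModType R) (f : E -> R) h : polyfun f ->
  polyfun (fun X => h.[f X]) /\
  forall X v, 'D_v (fun Y => h.[f Y]) X = h^`().[f X] * 'D_v f X.
Proof.
move=> pf; elim/poly_ind: h => [|h c [ph dh]].
  under eq_fun do rewrite horner0; split=> [|X v]; first exact: polyfun_cst.
  by rewrite linear0 horner0 mul0r derive_cst0.
under eq_fun do rewrite hornerMXaddC.
have phf := polyfunM ph pf.
split; first by apply: polyfunD => //; exact: polyfun_cst.
move=> X v; rewrite derive_polyfunD //; last exact: polyfun_cst.
rewrite derive_cst0 addr0 derive_polyfunM // dh derivD derivM derivX derivC addr0 mulr1.
by rewrite hornerD hornerMX; ring.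
Qed.

(** R^n seen as the diagonal matrices: the standard basis is an eigenbasis everywhere, so only
    diagonal entries of a direction occur. *)
Lemma row_model : @spectral_model 'rV[R]_n id (fun _ v => diag_mx v).
Proof.
move=> h i.
have ph k l := polyfun_horner k (@polyfun_coord R 1 n 0 l).
have D1 X (v : 'rV[R]_n) k : 'D_v (blocksum k i) X =
    \sum_(l | blk i l) k^`().[X 0 l] * v 0 l.
  rewrite derive_polyfun_sum => [|l]; last by have [] := ph k l.
  by apply: eq_bigr => l _; have [_ ->] := ph k l; rewrite derive_coord.
split.
- by apply: polyfun_sum => l; have [] := ph h l.
- move=> X v; rewrite D1; apply: eq_bigr => l _; by rewrite mxE eqxx mulr1n.
- move=> X v w.
  rewrite (_ : 'D_v (blocksum h i \o id) =
      fun Y => \sum_(l | blk i l) v 0 l * h^`().[Y 0 l]); last first.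
    by apply/funext => Y; rewrite D1; apply: eq_bigr => l _; rewrite mulrC.
  have pl l : polyfun (fun Y : 'rV[R]_n => h^`().[Y 0 l]) by have [] := ph h^`() l.
  rewrite derive_polyfun_sum => [|l]; last exact: polyfunZ.
  apply: eq_bigr => a ia; rewrite derive_polyfunZ //.
  have [_ ->] := ph h^`() a; rewrite derive_coord (bigD1 a) //= big1 => [|b /andP[_ ba]].
    by rewrite addr0 ddpoly_diag !mxE eqxx !mulr1n; ring.
  by rewrite !mxE (negPf ba) mulr0n !mulr0.
Qed.

Definition block_invariant (f : 'rV[R]_n -> R) :=
  forall (s : 'S_n), (forall i, blk i (s i)) -> forall y, f (perm_act s y) = f y.

Lemma blocksum_invariant h i : block_invariant (blocksum h i).
Proof.
move=> s sb y; rewrite /blocksum (reindex_inj (@perm_inj _ s)) /=.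
apply: eq_big => [l|l _]; last by rewrite mxE permK.
apply/idP/idP => il; apply: blkT il _ => //; by rewrite blkS.
Qed.

Definition tie x i j := blk i j && (x 0 i == x 0 j).

Lemma tie_refl x i : tie x i i. Proof. by rewrite /tie blkR eqxx. Qed.

Lemma tie_sym x i j : tie x i j = tie x j i.
Proof. by rewrite /tie blkS eq_sym. Qed.

Lemma tie_trans x i j l : tie x i j -> tie x j l -> tie x i l.
Proof.
by move=> /andP[ij /eqP xij] /andP[jl /eqP xjl]; rewrite /tie (blkT ij jl) xij xjl eqxx.
Qed.

Definition ntie x i : R := #|[pred l | tie x i l]|%:R.

Lemma ntie_neq0 x i : ntie x i != 0.
Proof. by rewrite pnatr_eq0 -lt0n; apply/card_gt0P; exists i; rewrite inE tie_refl. Qed.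

Lemma ntieE x i j : tie x i j -> ntie x i = ntie x j.
Proof.
move=> ij; congr (_%:R); apply: eq_card => l; rewrite !inE.
by apply/idP/idP; apply: tie_trans; rewrite // tie_sym.
Qed.

(** After exchanging the sums, [F l] is reached from the [ntie x l] indices tied to l, each with
    weight [a l / ntie x l]. *)
Lemma sum_tie_average x (a F : 'I_n -> R) :
  (forall i j, tie x i j -> a i = a j) ->
  \sum_i a i / ntie x i * \sum_(l | tie x i l) F l = \sum_l a l * F l.
Proof.
move=> ainv; under eq_bigr do rewrite mulr_sumr.
rewrite (exchange_big_dep xpredT) //=; apply: eq_bigr => l _.
rewrite (eq_bigr (fun=> a l / ntie x l * F l)) => [|i il]; last first.
  by rewrite (ainv _ _ il) (ntieE il).
rewrite sumr_const -[_ *+ _]mulr_natl.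
have -> : #|[pred i | tie x i l]|%:R = ntie x l.
  by congr (_%:R); apply: eq_card => i; rewrite !inE tie_sym.
by rewrite mulrA mulrCA divff ?ntie_neq0 // mulr1.
Qed.

(** Hermite interpolation at the values taken by the coordinates of [x]: the derivatives of one
    polynomial single out the tie class of i inside its block. *)
Lemma jet_poly_exists x i (a b : R) : exists h, forall l, blk i l ->
  [/\ h.[x 0 l] = 0, h^`().[x 0 l] = a * (tie x i l)%:R &
      h^`()^`().[x 0 l] = b * (tie x i l)%:R].
Proof.
pose s := [seq x 0 l | l <- enum 'I_n & x 0 l != x 0 i].
have [|h [h0 h1 h2 hs]] := @hermite_exists R (x 0 i) s a b.
  by apply/negP => /mapP[l]; rewrite mem_filter => /andP[/negP h _] /esym/eqP.
exists h => l il; rewrite /tie il /=; case: eqVneq => [<-|xil].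
  by rewrite !mulr1.
have [] := hs (x 0 l); last by move=> -> -> ->; rewrite !mulr0.
by apply: map_f; rewrite mem_filter mem_enum eq_sym xil.
Qed.

Section JetFunction.
Variables (x : 'rV[R]_n) (c : R) (al ga : 'I_n -> R) (be : 'I_n -> 'I_n -> R).
Hypothesis al_tie : forall i j, tie x i j -> al i = al j.
Hypothesis ga_tie : forall i j, tie x i j -> ga i = ga j.
Hypothesis be_tie : forall i j l, tie x i j -> be i l = be j l.
Hypothesis be_sym : forall i j, be i j = be j i.
Variables (p q : 'I_n -> {poly R}).
Hypothesis pP : forall i l, blk i l ->
  [/\ (p i).[x 0 l] = 0, (p i)^`().[x 0 l] = 1 * (tie x i l)%:R &
      (p i)^`()^`().[x 0 l] = 0 * (tie x i l)%:R].
Hypothesis qP : forall i l, blk i l ->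
  [/\ (q i).[x 0 l] = 0, (q i)^`().[x 0 l] = 0 * (tie x i l)%:R &
      (q i)^`()^`().[x 0 l] = 1 * (tie x i l)%:R].

Let P i y := (ntie x i)^-1 * blocksum (p i) i y.
Let Q i y := (ntie x i)^-1 * blocksum (q i) i y.

(** On R^n, to second order at [x], [P i] is the mean displacement of the coordinates tied to i and
    [Q i] is half the mean of their squared displacements. These are the building blocks of a Taylor
    polynomial that respects the symmetry. *)
Definition jetfun y : R :=
  c + ((\sum_i al i * P i y) + (\sum_i \sum_j (be i j / 2) * (P i y * P j y)) +
  \sum_i ga i * Q i y).

Lemma jetfun_invariant : block_invariant jetfun.
Proof.
move=> s sb y; rewrite /jetfun /P /Q.
have hE h i : blocksum h i (perm_act s y) = blocksum h i y.
  exact: blocksum_invariant.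
congr (_ + (_ + _ + _)).
- by apply: eq_bigr => i _; rewrite hE.
- by apply: eq_bigr => i _; apply: eq_bigr => j _; rewrite !hE.
- by apply: eq_bigr => i _; rewrite hE.
Qed.

Lemma jet_P0 i : P i x = 0.
Proof.
by rewrite /P /blocksum big1 ?mulr0 // => l il; have [] := pP il.
Qed.

Section JetModel.
Variables (E : normedModType R) (Lam : E -> 'rV[R]_n) (A : E -> E -> 'M[R]_n).
Hypothesis model : spectral_model Lam A.

Lemma polyfun_jetP i : polyfun (P i \o Lam).
Proof. by apply: polyfunZ; have [] := model (p i) i. Qed.

Lemma polyfun_jetQ i : polyfun (Q i \o Lam).
Proof. by apply: polyfunZ; have [] := model (q i) i. Qed.

Let pP' := polyfun_jetP.
Let pQ' := polyfun_jetQ.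

Let pPP i j : polyfun (fun Y => P i (Lam Y) * P j (Lam Y)).
Proof. exact: (polyfunM (polyfun_jetP i) (polyfun_jetP j)). Qed.

Let p1 : polyfun (fun Y => \sum_i al i * P i (Lam Y)).
Proof. by apply: polyfun_sum => i; apply: polyfunZ; exact: pP'. Qed.

Let p2 : polyfun (fun Y => \sum_i \sum_j (be i j / 2) * (P i (Lam Y) * P j (Lam Y))).
Proof. by apply: polyfun_sum => i; apply: polyfun_sum => j; apply: polyfunZ. Qed.

Let p3 : polyfun (fun Y => \sum_i ga i * Q i (Lam Y)).
Proof. by apply: polyfun_sum => i; apply: polyfunZ; exact: pQ'. Qed.

Lemma polyfun_jetfun : polyfun (jetfun \o Lam).
Proof.
apply: polyfunD; first exact: polyfun_cst.
exact: (polyfunD (polyfunD p1 p2) p3).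
Qed.

Lemma derive_jetfun_gen X v : 'D_v (jetfun \o Lam) X =
  (\sum_i al i * 'D_v (P i \o Lam) X) +
  (\sum_i \sum_j (be i j / 2) * (P i (Lam X) * 'D_v (P j \o Lam) X +
                                 P j (Lam X) * 'D_v (P i \o Lam) X)) +
  \sum_i ga i * 'D_v (Q i \o Lam) X.
Proof.
rewrite derive_polyfunD; [|exact: polyfun_cst|exact: (polyfunD (polyfunD p1 p2) p3)].
rewrite derive_cst0 add0r derive_polyfunD; [|exact: (polyfunD p1 p2)|exact: p3].
rewrite derive_polyfunD; [|exact: p1|exact: p2].
congr (_ + _ + _).
- rewrite derive_polyfun_sum => [|i]; last by apply: polyfunZ; exact: pP'.
  by apply: eq_bigr => i _; rewrite derive_polyfunZ //; exact: pP'.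
- rewrite derive_polyfun_sum => [|i]; last first.
    by apply: polyfun_sum => j; apply: polyfunZ.
  apply: eq_bigr => i _; rewrite derive_polyfun_sum => [|j]; last exact: polyfunZ.
  apply: eq_bigr => j _; rewrite derive_polyfunZ //; congr (_ * _).
  by rewrite (derive_polyfunM _ _ (polyfun_jetP i) (polyfun_jetP j)).
- rewrite derive_polyfun_sum => [|i]; last by apply: polyfunZ; exact: pQ'.
  by apply: eq_bigr => i _; rewrite derive_polyfunZ //; exact: pQ'.
Qed.

Lemma derive2_jetfun_gen X v w : 'D_w ('D_v (jetfun \o Lam)) X =
  (\sum_i al i * 'D_w ('D_v (P i \o Lam)) X) +
  (\sum_i \sum_j (be i j / 2) *
     (P i (Lam X) * 'D_w ('D_v (P j \o Lam)) X +
      'D_v (P j \o Lam) X * 'D_w (P i \o Lam) X +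
      (P j (Lam X) * 'D_w ('D_v (P i \o Lam)) X +
      'D_v (P i \o Lam) X * 'D_w (P j \o Lam) X))) +
  \sum_i ga i * 'D_w ('D_v (Q i \o Lam)) X.
Proof.
have -> : 'D_v (jetfun \o Lam) = fun Y =>
    (\sum_i al i * 'D_v (P i \o Lam) Y) +
    (\sum_i \sum_j (be i j / 2) * (P i (Lam Y) * 'D_v (P j \o Lam) Y +
                                   P j (Lam Y) * 'D_v (P i \o Lam) Y)) +
    \sum_i ga i * 'D_v (Q i \o Lam) Y.
  by apply/funext => Y; exact: derive_jetfun_gen.
have dP i u : polyfun ('D_u (P i \o Lam)) by exact: polyfun_derive (pP' i).
have dQ i u : polyfun ('D_u (Q i \o Lam)) by exact: polyfun_derive (pQ' i).
have mP i j : polyfun (fun Y => P i (Lam Y) * 'D_v (P j \o Lam) Y).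
  exact: (polyfunM (pP' i) (dP j v)).
have d1 : polyfun (fun Y => \sum_i al i * 'D_v (P i \o Lam) Y).
  by apply: polyfun_sum => i; exact: polyfunZ.
have sP i j : polyfun (fun Y => P i (Lam Y) * 'D_v (P j \o Lam) Y +
    P j (Lam Y) * 'D_v (P i \o Lam) Y) by exact: polyfunD.
have d2 : polyfun (fun Y => \sum_i \sum_j (be i j / 2) *
    (P i (Lam Y) * 'D_v (P j \o Lam) Y + P j (Lam Y) * 'D_v (P i \o Lam) Y)).
  by apply: polyfun_sum => i; apply: polyfun_sum => j; exact: polyfunZ.
have d3 : polyfun (fun Y => \sum_i ga i * 'D_v (Q i \o Lam) Y).
  by apply: polyfun_sum => i; exact: polyfunZ.
rewrite derive_polyfunD; [|exact: (polyfunD d1 d2)|exact: d3].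
rewrite derive_polyfunD; [|exact: d1|exact: d2].
congr (_ + _ + _).
- rewrite derive_polyfun_sum => [|i]; last exact: polyfunZ.
  by apply: eq_bigr => i _; rewrite derive_polyfunZ.
- rewrite derive_polyfun_sum => [|i]; last first.
    by apply: polyfun_sum => j; exact: polyfunZ.
  apply: eq_bigr => i _; rewrite derive_polyfun_sum => [|j]; last exact: polyfunZ.
  apply: eq_bigr => j _; rewrite derive_polyfunZ //; congr (_ * _).
  rewrite derive_polyfunD //; congr (_ + _).
  + by rewrite (derive_polyfunM _ _ (pP' i) (dP j v)).
  + by rewrite (derive_polyfunM _ _ (pP' j) (dP i v)).
- rewrite derive_polyfun_sum => [|i]; last exact: polyfunZ.
  by apply: eq_bigr => i _; rewrite derive_polyfunZ.
Qed.

Variable X : E.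
Hypothesis LX : Lam X = x.

Lemma derive_jetP i v :
  'D_v (P i \o Lam) X = (ntie x i)^-1 * \sum_(l | tie x i l) A X v l l.
Proof.
have [ph D1 _] := model (p i) i.
rewrite (derive_polyfunZ _ _ _ ph) D1 LX; congr (_ * _).
rewrite [RHS]big_mkcond /= [LHS]big_mkcond /=; apply: eq_bigr => l _.
rewrite /tie; case: ifP => //= il; have [_ -> _] := pP il.
by rewrite /tie il mul1r; case: eqP; rewrite ?mul1r ?mul0r.
Qed.

Lemma derive_jetQ i v : 'D_v (Q i \o Lam) X = 0.
Proof.
have [ph D1 _] := model (q i) i.
rewrite (derive_polyfunZ _ _ _ ph) D1 LX big1 ?mulr0 // => l il.
by have [_ -> _] := qP il; rewrite !mul0r.
Qed.

Lemma derive2_scaled h i (k : R) v w : 'D_w ('D_v (fun Y => k * blocksum h i (Lam Y))) X =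
  k * \sum_(a | blk i a) \sum_(b | blk i b)
        ddpoly h^`() (x 0 a) (x 0 b) * (A X w a b * A X v b a).
Proof.
have [ph D1 D2] := model h i; rewrite -LX -D2.
rewrite (_ : 'D_v (fun Y => _) = fun Y => k * 'D_v (blocksum h i \o Lam) Y).
  by rewrite derive_polyfunZ //; exact: polyfun_derive.
by apply/funext => Y; exact: derive_polyfunZ.
Qed.

Lemma derive2_jetP i v w : 'D_w ('D_v (P i \o Lam)) X = (ntie x i)^-1 *
  (\sum_(a | tie x i a) \sum_(b | blk a b)
      (A X w a b * A X v b a) / (x 0 a - x 0 b) -
   \sum_(b | tie x i b) \sum_(a | blk b a)
      (A X w a b * A X v b a) / (x 0 a - x 0 b)).
Proof.
rewrite derive2_scaled; congr (_ * _).
pose G a b := (A X w a b * A X v b a) / (x 0 a - x 0 b).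
transitivity (\sum_(a | blk i a) \sum_(b | blk i b)
    ((tie x i a)%:R * G a b - (tie x i b)%:R * G a b)).
  apply: eq_bigr => a ia; apply: eq_bigr => b ib; rewrite -mulrBl /G.
  have [_ pa pa2] := pP ia; have [_ pb _] := pP ib.
  (* For equal coordinates the divided difference is the second derivative of [p i], which is 0, in
     agreement with the convention that division by 0 gives 0. *)
  have [xab|xab] := eqVneq (x 0 a) (x 0 b).
    by rewrite -xab ddpoly_diag pa2 subrr invr0 !(mul0r, mulr0).
  by rewrite ddpoly_neq // pa pb !mul1r; ring.
under eq_bigr do rewrite sumrB; rewrite sumrB; congr (_ - _).
  rewrite [RHS]big_mkcond [LHS]big_mkcond /=; apply: eq_bigr => a _.
  have [tia|tia] := boolP (tie x i a); last first.
    by case: ifP => // _; rewrite big1 // => b _; rewrite mul0r.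
  have /andP[ia _] := tia; rewrite ia; apply: eq_big => [b|b _]; last by rewrite mul1r.
  by apply/idP/idP => h; apply: blkT h; rewrite // blkS.
rewrite exchange_big /= [RHS]big_mkcond [LHS]big_mkcond /=; apply: eq_bigr => b _.
have [tib|tib] := boolP (tie x i b); last first.
  by case: ifP => // _; rewrite big1 // => a _; rewrite mul0r.
have /andP[ib _] := tib; rewrite ib; apply: eq_big => [a|a _]; last by rewrite mul1r.
by apply/idP/idP => h; apply: blkT h; rewrite // blkS.
Qed.

(** The derivative of [q i] vanishes at every coordinate of the block, so divided differences
    between distinct values are 0 and only the second derivative on the tie class of i survives. *)
Lemma derive2_jetQ i v w : 'D_w ('D_v (Q i \o Lam)) X = (ntie x i)^-1 *
  \sum_(a | tie x i a) \sum_(b | tie x a b) (A X w a b * A X v b a).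
Proof.
rewrite derive2_scaled; congr (_ * _).
rewrite [RHS]big_mkcond [LHS]big_mkcond /=; apply: eq_bigr => a _.
case: (boolP (tie x i a)) => [/andP[ia xia]|tia]; last first.
  case: ifP => // ia; rewrite big1 // => b ib.
  have [_ qa qa2] := qP ia; have [_ qb _] := qP ib.
  have [xab|xab] := eqVneq (x 0 a) (x 0 b).
    by rewrite -xab ddpoly_diag qa2 (negPf tia) mulr0 mul0r.
  by rewrite ddpoly_neq // qa qb !mul0r subrr !mul0r.
rewrite ia [RHS]big_mkcond [LHS]big_mkcond /=; apply: eq_bigr => b _.
have -> : blk i b = blk a b.
  by apply/idP/idP => h; apply: blkT h; rewrite // blkS.
rewrite {1}/tie; case: (boolP (blk a b)) => //= ab.
have [_ qa qa2] := qP ia; have [_ qb _] := qP (blkT ia ab).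
have [xab|xab] := eqVneq (x 0 a) (x 0 b).
  by rewrite -xab ddpoly_diag qa2 /tie ia xia !mul1r.
by rewrite ddpoly_neq // qa qb !mul0r subrr !mul0r.
Qed.

Lemma derive_jetfun v : 'D_v (jetfun \o Lam) X = \sum_i al i * A X v i i.
Proof.
rewrite derive_jetfun_gen LX [X in _ + X]big1 ?addr0 => [|i _]; last first.
  by rewrite derive_jetQ mulr0.
rewrite [X in _ + X]big1 ?addr0 => [|i _]; last first.
  by rewrite big1 // => j _; rewrite !jet_P0 !mul0r addr0 mulr0.
rewrite -[RHS](sum_tie_average _ al_tie); apply: eq_bigr => i _.
by rewrite derive_jetP mulrA.
Qed.

(** The Hessian formula for functions of eigenvalues. An off-diagonal entry between separated
    coordinates is weighted by a divided difference of the gradient [al]; between tied ones this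
    term is 0 and [ga] takes its place. *)
Lemma derive2_jetfun v w : 'D_w ('D_v (jetfun \o Lam)) X =
  (\sum_i \sum_j be i j * (A X v i i * A X w j j)) +
  (\sum_i ga i * \sum_(j | tie x i j) A X w i j * A X v j i) +
  \sum_i \sum_(j | blk i j) (al i - al j) / (x 0 i - x 0 j) * (A X w i j * A X v j i).
Proof.
rewrite derive2_jetfun_gen LX -addrA [LHS]addrC; congr (_ + _ + _).
- pose V u i := \sum_(l | tie x i l) A X u l l.
  have VE u i : V u i = \sum_(l | tie x i l) A X u l l by [].
  have DV u i : 'D_u (P i \o Lam) X = (ntie x i)^-1 * V u i := derive_jetP i u.
  clearbody V.
  transitivity (\sum_i \sum_j be i j / ntie x i / ntie x j * (V v i * V w j)).
    (* Since every [P i] vanishes at [x], only products of first derivatives remain, in two halves;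
       exchanging i and j in the second, by symmetry of [be], makes it equal to the first. *)
    rewrite (eq_bigr (fun i => \sum_j (be i j / ntie x i / ntie x j / 2 * (V v i * V w j)) +
        \sum_j (be j i / ntie x j / ntie x i / 2 * (V v j * V w i)))); last first.
      move=> i _; rewrite -big_split /=; apply: eq_bigr => j _.
      rewrite !jet_P0 !mul0r !add0r !DV (be_sym j i).
      move: (V v i) (V w j) (V v j) (V w i) (be i j) (ntie x i) (ntie x j) => ? ? ? ? ? ? ?.
      by ring.
    rewrite big_split /= [X in _ + X]exchange_big /= -big_split /=.
    apply: eq_bigr => i _; rewrite -big_split /=; apply: eq_bigr => j _.
    by field; rewrite !ntie_neq0.
  transitivity (\sum_j (\sum_i be i j * A X v i i) / ntie x j * V w j).
    rewrite exchange_big /=; apply: eq_bigr => j _.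
    rewrite -(@sum_tie_average x (fun i => be i j) (fun i => A X v i i)); last first.
      by move=> i i' h; exact: be_tie.
    rewrite !mulr_suml; apply: eq_bigr => i _; rewrite -VE.
    by move: (V v i) (V w j) (be i j) (ntie x i) (ntie x j) => ? ? ? ? ?; ring.
  under eq_bigr do rewrite VE.
  rewrite (@sum_tie_average x (fun j => \sum_i be i j * A X v i i)); last first.
    by move=> j j' jj; apply: eq_bigr => i _; rewrite be_sym (be_tie _ jj) be_sym.
  rewrite [RHS]exchange_big /=; apply: eq_bigr => j _; rewrite mulr_suml.
  by apply: eq_bigr => i _; rewrite mulrA.
- rewrite -[RHS](sum_tie_average _ ga_tie); apply: eq_bigr => i _.
  by rewrite derive2_jetQ mulrA.
- under eq_bigr do rewrite derive2_jetP mulrA mulrBr.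
  rewrite sumrB !sum_tie_average //.
  rewrite (eq_bigr (fun a => \sum_(b | blk a b) al a *
      (A X w a b * A X v b a / (x 0 a - x 0 b)))); last by move=> a _; rewrite mulr_sumr.
  rewrite [X in _ - X](eq_bigr (fun b => \sum_(a | blk b a) al b *
      (A X w a b * A X v b a / (x 0 a - x 0 b)))); last by move=> a _; rewrite mulr_sumr.
  rewrite [X in _ - X](exchange_big_dep xpredT) //= -sumrB; apply: eq_bigr => i _.
  rewrite [X in _ - X](eq_bigl (blk i)) => [|j]; last by rewrite blkS.
  by rewrite -sumrB; apply: eq_bigr => j _; ring.
Qed.

End JetModel.
End JetFunction.
End Models.

Lemma cvg_mx (R : realType) (T : Type) (F : set_system T) (FF : Filter F) m p
    (f : T -> 'M[R]_(m, p)) (l : 'M[R]_(m, p)) :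
  (forall i j, f t i j @[t --> F] --> l i j) -> f @ F --> l.
Proof.
move=> fl; apply/cvgrPdist_le => e e0.
have h : \forall t \near F, forall i j, `|l i j - f t i j| <= e.
  apply: filter_forall => i; apply: filter_forall => j.
  by have /cvgrPdist_le := fl i j; apply.
near=> t; apply: mx_norm_le_entries => [|i j]; first exact: ltW.
by rewrite !mxE; move: i j; near: t.
Unshelve. all: by end_near. Qed.

Lemma continuous_mulmxr (R : realType) m n p (B : 'M[R]_(n, p)) :
  continuous (mulmxr B : 'M[R]_(m, n) -> 'M[R]_(m, p)).
Proof.
move=> X; apply: (cvg_mx (nbhs_filter X)) => i j; rewrite /= mxE.
under eq_fun do rewrite mxE.
apply: (cvg_sumr (nbhs_filter X)) => k _.
by apply: cvgM; [exact: continuous_coord|exact: cvg_cst].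
Qed.

(** * Derivatives under permutations of coordinates *)

Section Permutations.
Variables (R : realType) (n : nat).
Implicit Types (s : 'S_n) (x y v w : 'rV[R]_n) (f : 'rV[R]_n -> R).

Lemma perm_actE s x : perm_act s x = x *m perm_mx s.
Proof.
have -> : perm_mx s = perm_mx (s^-1)^-1 :> 'M[R]_n by rewrite invgK.
by rewrite -col_permE; apply/rowP => i; rewrite !mxE.
Qed.

(** A product of permutations applies its left factor first, which is why the order is reversed. *)
Lemma perm_actM s t x : perm_act s (perm_act t x) = perm_act (t * s) x.
Proof. by rewrite !perm_actE -mulmxA perm_mxM. Qed.

Lemma perm_act_norm s x : `|perm_act s x| = `|x|.
Proof.
have le t (y : 'rV[R]_n) : `|perm_act t y| <= `|y|.
  by apply: mx_norm_le_entries => // i j; rewrite mxE; exact: mx_entry_le_norm.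
apply/le_anti; rewrite le /=; apply: le_trans (le s^-1%g _).
by rewrite perm_actM mulgV perm_actE perm_mx1 mulmx1.
Qed.

Lemma perm_actB s x y : perm_act s (x - y) = perm_act s x - perm_act s y.
Proof. by rewrite !perm_actE mulmxBl. Qed.

Lemma perm_act_delta s i : perm_act s (delta_mx 0 i) = delta_mx 0 (s i) :> 'rV[R]_n.
Proof.
apply/rowP => l; rewrite !mxE !eqxx /=; congr (_%:R); congr (nat_of_bool _).
by rewrite -(inj_eq (@perm_inj _ s)) permKV.
Qed.

Lemma derive_perm_act s f y v :
  'D_v (fun z => f (perm_act s z)) y = 'D_(perm_act s v) f (perm_act s y).
Proof.
have E : perm_act s = mulmxr (perm_mx s) :> ('rV[R]_n -> 'rV[R]_n).
  by apply/funext => z; rewrite perm_actE.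
by rewrite !E; exact: (derive_comp_linear (mulmxr (perm_mx s))).
Qed.

Lemma derive_row_basis f x v : differentiable f x ->
  'D_v f x = \sum_i v 0 i * 'D_(delta_mx 0 i) f x.
Proof.
move=> df; rewrite {1}(row_sum_delta v) derive_sumd //.
by apply: eq_bigr => i _; rewrite deriveZd.
Qed.

Lemma derive2_row_basis (U : set 'rV[R]_n) f x v w :
  open U -> C2_on U f -> U x ->
  'D_w ('D_v f) x =
  \sum_i \sum_j v 0 i * w 0 j * 'D_(delta_mx 0 j) ('D_(delta_mx 0 i) f) x.
Proof.
move=> oU cf Ux.
pose g := \sum_i (v 0 i \*: 'D_(delta_mx 0 i) f).
have ng : \forall y \near x, 'D_v f y = g y.
  have : \forall y \near x, U y by exact: open_nbhs_nbhs.
  apply: filterS => y Uy; rewrite derive_row_basis; last exact: C2_diff Uy.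
  by rewrite /g fct_sumE.
rewrite (near_eq_derive w ng) /g.
have d1 i : differentiable ('D_(delta_mx 0 i) f) x by exact: C2_diff1 Ux.
rewrite derive_sum => [|i]; last by apply: derivableZ; exact: diff_derivable.
apply: eq_bigr => i _; rewrite deriveZ; last exact: diff_derivable.
rewrite derive_row_basis // [_ *: _]mulr_sumr; apply: eq_bigr => j _.
by rewrite mulrA.
Qed.

End Permutations.

(** * Realizing the 2-jet of a block-symmetric function *)

Section JetMatch.
Variables (R : realType) (n : nat) (blk : rel 'I_n).
Hypotheses (blkR : reflexive blk) (blkS : symmetric blk) (blkT : transitive blk).
Local Notation e i := (delta_mx 0 i : 'rV[R]_n).
Local Notation tie := (tie blk).
Implicit Types (x y : 'rV[R]_n) (f : 'rV[R]_n -> R).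

Lemma derive_invariant f (s : 'S_n) y v : block_invariant blk f ->
  (forall i, blk i (s i)) -> 'D_v f y = 'D_(perm_act s v) f (perm_act s y).
Proof.
move=> finv sb.
have fE : (fun z => f (perm_act s z)) = f by apply/funext => z; exact: finv.
by rewrite -derive_perm_act fE.
Qed.

Lemma derive2_invariant f (s : 'S_n) y v w : block_invariant blk f ->
  (forall i, blk i (s i)) ->
  'D_w ('D_v f) y = 'D_(perm_act s w) ('D_(perm_act s v) f) (perm_act s y).
Proof.
move=> finv sb; rewrite -(derive_perm_act s ('D_(perm_act s v) f)).
suff -> : (fun z => 'D_(perm_act s v) f (perm_act s z)) = 'D_v f by [].
by apply/funext => z; rewrite (derive_invariant z v finv sb).
Qed.

Lemma tperm_block i j : blk i j -> forall l, blk l (tperm i j l).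
Proof. by move=> ij l; case: tpermP => [->|->|_ _]; rewrite // blkS. Qed.

Lemma tperm_tie x i j : tie x i j -> perm_act (tperm i j) x = x.
Proof.
move=> /andP[_ /eqP xij]; apply/rowP => l; rewrite mxE tpermV.
by case: tpermP => [->|->|].
Qed.

(** The swap of i and j preserves [f], fixes [x] and sends [e i] to [e j]. *)
Lemma grad_tie f x i j : block_invariant blk f ->
  tie x i j -> 'D_(e i) f x = 'D_(e j) f x.
Proof.
move=> finv tij; have /andP[bij _] := tij.
rewrite (derive_invariant x (e i) finv (tperm_block bij)).
by rewrite perm_act_delta tpermL (tperm_tie tij).
Qed.

Lemma hess_perm f x (s : 'S_n) i j : block_invariant blk f ->
  (forall l, tie x l (s l)) ->
  'D_(e j) ('D_(e i) f) x = 'D_(e (s j)) ('D_(e (s i)) f) x.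
Proof.
move=> finv ts; have sb l : blk l (s l) by have /andP[] := ts l.
have xE : perm_act s x = x.
  apply/rowP => l; rewrite mxE; have /andP[_ /eqP] := ts ((s^-1)%g l).
  by rewrite permKV.
have := derive2_invariant x (e i) (e j) finv sb.
by rewrite !perm_act_delta xE.
Qed.

Section Hessian.
Variables (x : 'rV[R]_n) (H : 'I_n -> 'I_n -> R).
Hypothesis H_perm : forall (s : 'S_n) i j, (forall l, tie x l (s l)) ->
  H i j = H (s i) (s j).

Lemma tperm_tied i j : tie x i j -> forall l, tie x l (tperm i j l).
Proof.
move=> tij l; case: tpermP => [->|->|_ _] //; first by rewrite (tie_sym blkS).
exact: tie_refl.
Qed.

(** Two swaps inside the tie class carry (a, b) to (a', b'): the first brings a to a', the second
    moves the image of b to b' and leaves a' in place. *)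
Lemma hess_offdiag a b a' b' : tie x a b -> tie x a a' -> tie x a b' ->
  a != b -> a' != b' -> H a b = H a' b'.
Proof.
move=> ab aa' ab' nab nab'; pose c := tperm a a' b.
have ca' : c != a' by rewrite /c -{2}(tpermL a a') (inj_eq perm_inj) eq_sym.
have tc : tie x c b'.
  have := tperm_tied aa' b; rewrite -/c (tie_sym blkS) => cb.
  apply: (tie_trans blkT cb); apply: (tie_trans blkT _ ab').
  by rewrite (tie_sym blkS).
rewrite (H_perm a b (tperm_tied aa')) tpermL -/c.
rewrite (H_perm a' c (tperm_tied tc)) tpermL tpermD //.
by rewrite eq_sym.
Qed.

(** Splits [H] into [hess_be] plus a diagonal [hess_ga], both constant along tie classes as [jetfun]
    requires. Within a class the common off-diagonal entry is also put on the diagonal; a singleton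
    class has none and gets 0, its diagonal entry going entirely to [hess_ga]. *)
Definition hess_be i j : R :=
  if tie x i j then
    (if [pick l | tie x i l && (l != i)] is Some l then H i l else 0)
  else H i j.

Definition hess_ga i : R := H i i - hess_be i i.

Lemma hessE i j : H i j = hess_be i j + (i == j)%:R * hess_ga i.
Proof.
have [<-|ij] := eqVneq i j; first by rewrite mul1r /hess_ga addrC subrK.
rewrite mul0r addr0 /hess_be; case: ifP => // tij.
case: pickP => [l /andP[il li]|/(_ j)]; last by rewrite tij eq_sym ij.
by apply: hess_offdiag => //; [exact: tie_refl|rewrite eq_sym].
Qed.

Lemma hess_be_tie i j l : tie x i j -> hess_be i l = hess_be j l.
Proof.
move=> ij; have ji : tie x j i by rewrite (tie_sym blkS).
have -> : hess_be j l = if tie x i l then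
    (if [pick l | tie x j l && (l != j)] is Some l then H j l else 0)
  else H j l.
  rewrite /hess_be; congr (if _ then _ else _).
  by apply/idP/idP; exact: tie_trans.
rewrite /hess_be; case: ifP => [il|til].
  (* If both classes offer a second element, the two entries are off-diagonal in the same class. If
     only one does, the other index is alone in its class and equals its tied partner, a
     contradiction. *)
  case: pickP => [k /andP[ik ki]|hi]; case: pickP => [k' /andP[jk' k'j]|hj] //.
  - apply: hess_offdiag => //; rewrite 1?eq_sym //.
    exact: (tie_trans blkT ij jk').
  - have [kj|kj] := eqVneq k j.
      have := hj i; rewrite ji /= => /negbT; rewrite negbK => /eqP ii.
      by move: ki; rewrite kj ii eqxx.
    by have := hj k; rewrite kj (tie_trans blkT ji ik).
  - have [ki|ki] := eqVneq k' i.
      have := hi j; rewrite ij /= => /negbT; rewrite negbK => /eqP jj.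
      by move: k'j; rewrite ki jj eqxx.
    by have := hi k'; rewrite ki (tie_trans blkT ij jk').
rewrite (H_perm i l (tperm_tied ij)) tpermL tpermD //.
  by apply/eqP => il; move: til; rewrite il tie_refl.
by apply/eqP => jl; move: til; rewrite -jl ij.
Qed.

Lemma hess_ga_tie i j : tie x i j -> hess_ga i = hess_ga j.
Proof.
move=> ij; have ji : tie x j i by rewrite (tie_sym blkS).
rewrite /hess_ga (H_perm i i (tperm_tied ij)) tpermL; congr (_ - _).
rewrite (hess_be_tie _ ij) {1}/hess_be ji {1}/hess_be tie_refl //.
Qed.

Lemma hess_be_sym : (forall i j, H i j = H j i) ->
  forall i j, hess_be i j = hess_be j i.
Proof.
move=> Hs i j; have [ij|ij] := boolP (tie x i j).
  have ji : tie x j i by rewrite (tie_sym blkS).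
  rewrite (hess_be_tie _ ij) /hess_be ji tie_refl //.
by rewrite /hess_be (tie_sym blkS x j i) (negPf ij).
Qed.

Lemma hess_be_bound (eps : R) : (forall i j, `|H i j| <= eps) ->
  forall i j, `|hess_be i j| <= eps.
Proof.
move=> Hb i j; have e0 : 0 <= eps by apply: le_trans (Hb i j).
rewrite /hess_be; case: ifP => // _; case: pickP => [l _|_] //.
by rewrite normr0.
Qed.

Lemma hess_ga_bound (eps : R) : (forall i j, `|H i j| <= eps) ->
  forall i, `|hess_ga i| <= 2 * eps.
Proof.
move=> Hb i; rewrite /hess_ga; apply: le_trans (ler_normB _ _) _.
by rewrite mulr_natl mulr2n; apply: lerD; [exact: Hb|exact: hess_be_bound].
Qed.

End Hessian.

Lemma sum_le_card (F : 'I_n -> R) (K : R) (P : pred 'I_n) :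
  0 <= K -> (forall i, P i -> `|F i| <= K) -> `|\sum_(i | P i) F i| <= n%:R * K.
Proof.
move=> K0 FK; apply: le_trans (ler_norm_sum _ _ _) _.
rewrite big_mkcond /=; apply: (@le_trans _ _ (\sum_(i < n) K)).
  by apply: ler_sum => i _; case: ifP => // Pi; exact: FK.
by rewrite sumr_const card_ord mulr_natl.
Qed.

(** One [jetfun] read in two models: the row model shows that its coefficients reproduce the jet of
    [f], and an arbitrary model gives its derivatives upstairs. The constant 4 is 1 + 2 + 1, for the
    contributions of [be], of [ga] and of the gradient quotients. *)
Lemma jet_match (U : set 'rV[R]_n) f x : open U -> C2_on U f ->
  block_invariant blk f -> U x ->
  exists q : 'rV[R]_n -> R, [/\ block_invariant blk q, polyfun q,
    forall v, 'D_v q x = 'D_v f x,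
    forall v w, 'D_w ('D_v q) x = 'D_w ('D_v f) x &
    forall (E : normedModType R) (Lam : E -> 'rV[R]_n) (A : E -> E -> 'M[R]_n),
    spectral_model blk Lam A -> polyfun (q \o Lam) /\
    forall X, Lam X = x ->
    (forall v, 'D_v (q \o Lam) X = \sum_i 'D_(e i) f x * A X v i i) /\
    forall v w (eps K : R), 0 <= eps -> 0 <= K ->
      (forall i j, `|'D_(e j) ('D_(e i) f) x| <= eps) ->
      (forall i j, blk i j ->
        `|('D_(e i) f x - 'D_(e j) f x) / (x 0 i - x 0 j)| <= eps) ->
      (forall i j k l, `|A X w i j * A X v k l| <= K) ->
      `|'D_w ('D_v (q \o Lam)) X| <= n%:R * (n%:R * (4 * (eps * K)))].
Proof.
move=> oU cf finv Ux.
have [al alE] : exists al : 'I_n -> R, forall i, 'D_(e i) f x = al i.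
  by exists (fun i => 'D_(e i) f x).
have [H HE] : exists H : 'I_n -> 'I_n -> R,
    forall i j, 'D_(e j) ('D_(e i) f) x = H i j.
  by exists (fun i j => 'D_(e j) ('D_(e i) f) x).
pose be := hess_be x H; pose ga := hess_ga x H.
have H_perm (s : 'S_n) i j : (forall l, tie x l (s l)) -> H i j = H (s i) (s j).
  by move=> ts; rewrite -!HE; exact: hess_perm.
have Hs i j : H i j = H j i.
  by rewrite -!HE; exact: (derive_comm (e i) (e j) oU cf Ux).
have al_tie i j : tie x i j -> al i = al j.
  by move=> tij; rewrite -!alE; exact: grad_tie.
have ga_tie i j : tie x i j -> ga i = ga j by exact: hess_ga_tie.
have be_tie i j l : tie x i j -> be i l = be j l by exact: hess_be_tie.
have be_sym i j : be i j = be j i by exact: hess_be_sym.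
have /choice[p pP] := fun i => jet_poly_exists blk x i 1 0.
have /choice[q qP] := fun i => jet_poly_exists blk x i 0 1.
pose J := jetfun blk x (f x) al ga be p q.
have Jinv : block_invariant blk J by exact: jetfun_invariant.
have JP (E : normedModType R) (Lam : E -> 'rV[R]_n) A :
    spectral_model blk Lam A -> polyfun (J \o Lam).
  exact: polyfun_jetfun.
have JD1 (E : normedModType R) (Lam : E -> 'rV[R]_n) A X v :
    spectral_model blk Lam A -> Lam X = x ->
    'D_v (J \o Lam) X = \sum_i al i * A X v i i.
  by move=> mod LX; exact: (derive_jetfun blkR blkS blkT _ _ _ al_tie pP qP mod LX v).
have JD2 (E : normedModType R) (Lam : E -> 'rV[R]_n) A X v w :
    spectral_model blk Lam A -> Lam X = x ->
    'D_w ('D_v (J \o Lam)) X =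
      (\sum_i \sum_j be i j * (A X v i i * A X w j j)) +
      (\sum_i ga i * \sum_(j | tie x i j) A X w i j * A X v j i) +
      \sum_i \sum_(j | blk i j) (al i - al j) / (x 0 i - x 0 j) *
         (A X w i j * A X v j i).
  by move=> mod LX; exact: (derive2_jetfun blkR blkS blkT _ al_tie ga_tie be_tie
    be_sym pP qP mod LX v w).
have rm := @row_model R n blk.
clearbody J; exists J; split.
- exact: Jinv.
- exact: (JP _ _ _ rm).
- move=> v; rewrite (derive_row_basis v (C2_diff cf Ux)).
  rewrite [LHS](JD1 _ _ _ x v rm erefl).
  by apply: eq_bigr => i _; rewrite mxE eqxx mulr1n mulrC alE.
- move=> v w; rewrite (derive2_row_basis v w oU cf Ux).
  rewrite [LHS](JD2 _ _ _ x v w rm erefl).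
  under [RHS]eq_bigr do under eq_bigr do rewrite HE.
  rewrite [X in _ + X]big1 ?addr0 => [|i _]; last first.
    rewrite big1 // => j ij; have [<-|nij] := eqVneq i j; first by rewrite !subrr !mul0r.
    by rewrite mxE (negPf nij) mulr0n mul0r mulr0.
  rewrite -big_split /=; apply: eq_bigr => i _.
  have -> : \sum_(j | tie x i j) diag_mx w i j * diag_mx v j i = w 0 i * v 0 i.
    rewrite (bigD1 i) ?tie_refl //= big1 ?addr0 => [|j /andP[_ ji]].
      by rewrite !mxE eqxx !mulr1n.
    by rewrite mxE eq_sym (negPf ji) mulr0n mul0r.
  rewrite [RHS](eq_bigr (fun j => be i j * (v 0 i * w 0 j) +
      (i == j)%:R * (ga i * (v 0 i * w 0 j)))); last first.
    move=> j _; rewrite (hessE H_perm i j) -/(be i j) -/(ga i).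
    by move: (be i j) (ga i) => ? ?; ring.
  rewrite big_split /=; congr (_ + _).
    by apply: eq_bigr => j _; rewrite !mxE !eqxx !mulr1n.
  rewrite (bigD1 i) //= big1 => [|j ji]; last by rewrite eq_sym (negPf ji) mul0r.
  by rewrite eqxx mul1r addr0 [w 0 i * _]mulrC.
move=> E Lam A mod; split; first exact: JP mod.
move=> X LX; split=> [v|v w eps K e0 K0 Hb0 Gb0 Ab].
  under eq_bigr do rewrite alE.
  exact: JD1.
rewrite (JD2 _ _ _ X v w mod LX).
have Hb i j : `|H i j| <= eps by rewrite -HE.
have Gb i j : blk i j -> `|(al i - al j) / (x 0 i - x 0 j)| <= eps.
  by rewrite -!alE; exact: Gb0.
have eK : 0 <= eps * K by exact: mulr_ge0.
have -> : n%:R * (n%:R * (4 * (eps * K))) = n%:R * (n%:R * (eps * K)) +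
   n%:R * (2 * eps * (n%:R * K)) + n%:R * (n%:R * (eps * K)) by ring.
apply: le_trans (ler_normD _ _) _; apply: lerD; first apply: le_trans (ler_normD _ _) _; first apply: lerD.
- apply: sum_le_card => [|i _]; first exact: mulr_ge0.
  apply: sum_le_card => // j _; rewrite normrM [X in _ * `|X|]mulrC.
  by apply: ler_pM => //; exact: hess_be_bound.
- apply: sum_le_card => [|i _]; first by rewrite !mulr_ge0.
  rewrite normrM; apply: ler_pM => //; first exact: hess_ga_bound.
  by apply: sum_le_card => // j _.
- apply: sum_le_card => [|i _]; first exact: mulr_ge0.
  apply: sum_le_card => // j ij; rewrite normrM.
  by apply: ler_pM => //; exact: Gb.
Qed.

End JetMatch.

Lemma nearS (T : topologicalType) (x : T) (P Q : set T) :
  (forall y, P y -> Q y) -> (\forall y \near x, P y) -> \forall y \near x, Q y.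
Proof. exact: filterS. Qed.

Lemma nearI (T : topologicalType) (x : T) (P Q : set T) :
  (\forall y \near x, P y) -> (\forall y \near x, Q y) ->
  \forall y \near x, P y /\ Q y.
Proof. exact: filterI. Qed.

Lemma near_eq_cvg_to (R : realType) (T : topologicalType) (x : T) (f g : T -> R) (l : R) :
  (\forall y \near x, f y = g y) -> g y @[y --> x] --> l -> f y @[y --> x] --> l.
Proof.
move=> fg gl; apply: cvg_trans gl; apply: near_eq_cvg.
by apply: filterS fg => y ->.
Qed.

Lemma near_forall_ord (T : topologicalType) (x : T) n (P : 'I_n -> set T) :
  (forall i, \forall y \near x, P i y) -> \forall y \near x, forall i, P i y.
Proof. by move=> h; apply: filter_forall. Qed.

(** * Block-symmetric functions with vanishing 2-jet at a point *)

Section SmallJets.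
Variables (R : realType) (n : nat) (blk : rel 'I_n).
Hypotheses (blkR : reflexive blk) (blkS : symmetric blk) (blkT : transitive blk).
Local Notation e i := (delta_mx 0 i : 'rV[R]_n).
Variables (U : set 'rV[R]_n) (r : 'rV[R]_n -> R) (x0 : 'rV[R]_n).
Hypotheses (oU : open U) (cr : C2_on U r) (rinv : block_invariant blk r).
Hypothesis (Ux0 : U x0).
Hypothesis r1 : forall v, 'D_v r x0 = 0.
Hypothesis r2 : forall v w, 'D_w ('D_v r) x0 = 0.

Lemma near_small_hess (eps : R) : 0 < eps ->
  \forall x \near x0, forall i j, `|'D_(e j) ('D_(e i) r) x| <= eps.
Proof.
move=> eps0; apply: near_forall_ord => i; apply: near_forall_ord => j.
have /cvgrPdist_le/(_ eps eps0) := C2_cont2 (v := e i) (w := e j) cr Ux0.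
by apply: nearS => x; rewrite r2 sub0r normrN.
Qed.

Lemma near_small_grad (eps : R) i : 0 < eps ->
  \forall x \near x0, `|'D_(e i) r x| <= eps.
Proof.
move=> eps0.
have /cvgrPdist_le/(_ eps eps0) := differentiable_continuous (C2_diff1 (e i) cr Ux0).
by apply: nearS => x; rewrite r1 sub0r normrN.
Qed.

(* The swap of [i] and [j] turns a difference of partial derivatives at one point
   into an increment of a single partial derivative. *)
Lemma grad_quotient_tied (d eps : R) i j x : tie blk x0 i j -> 0 <= eps ->
  (forall y, ball x0 d y -> U y /\ forall a b, `|'D_(e b) ('D_(e a) r) y| <= eps) ->
  ball x0 d x ->
  `|('D_(e i) r x - 'D_(e j) r x) / (x 0 i - x 0 j)| <= 2 * eps.
Proof.
move=> tij eps0 bP xb; have /andP[bij _] := tij.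
have [xij|xij] := eqVneq (x 0 i) (x 0 j).
  by rewrite xij subrr invr0 mulr0 normr0 mulr_ge0.
pose y := perm_act (tperm i j) x.
(* The swap fixes [x0], where i and j are tied, and is an isometry. *)
have yb : ball x0 d y.
  rewrite -ball_normE /= -[x0](tperm_tie tij) -perm_actB perm_act_norm.
  by move: xb; rewrite -ball_normE.
have -> : 'D_(e j) r x = 'D_(e i) r y.
  rewrite (derive_invariant x (e j) rinv (tperm_block blkR blkS bij)).
  by rewrite perm_act_delta tpermR.
(* The factor [x 0 i - x 0 j] cancels the denominator and leaves two second derivatives, each at
   most [eps]. *)
have xyE : x - y = (x 0 i - x 0 j) *: (e i + (-1) *: e j).
  rewrite scaleN1r; apply/rowP => l; rewrite !mxE !eqxx /= tpermV.
  case: tpermP => [->|->|/eqP li /eqP lj].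
  - have -> : (i == j) = false by apply/eqP => ij; move: xij; rewrite ij eqxx.
    by rewrite eqxx subr0 mulr1.
  - have -> : (j == i) = false by apply/eqP => ij; move: xij; rewrite ij eqxx.
    by rewrite eqxx mulr0n mulr1n; ring.
  - by rewrite (negPf li) (negPf lj) !subrr mulr0.
have [t t01|c /andP[c0 c1]] := @MVT_dir R _ ('D_(e i) r) y (x - y).
  by have [Uz _] := bP _ (ball_segment t01 yb xb); exact: C2_diff1 Uz.
have c01 : 0 <= c <= 1 by rewrite !ltW.
have [Uz hz] := bP _ (ball_segment c01 yb xb).
move: (y + c *: (x - y)) Uz hz => z Uz hz; rewrite [y + _]addrC subrK => ->.
have dz := C2_diff1 (e i) cr Uz.
rewrite xyE (deriveZd _ _ dz) (deriveDd _ _ dz) (deriveZd _ _ dz) scaleN1r.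
have x_neq0 : x 0 i - x 0 j != 0 by rewrite subr_eq0.
have [[h1 h1E] [h2 h2E]] : (exists h : R, 'D_(e i) ('D_(e i) r) z = h) /\
    (exists h : R, 'D_(e j) ('D_(e i) r) z = h) by split; eexists.
have := hz i i; have := hz i j; rewrite h1E h2E => b2 b1.
rewrite -[_ *: _]/(_ * _) mulrAC divff // mul1r.
apply: le_trans (ler_normB _ _) _; rewrite mulr_natl mulr2n.
exact: lerD.
Qed.

(** Pairs tied at [x0] are controlled by second derivatives; for the other pairs of a block the
    denominator stays away from 0 near [x0] while the gradient tends to 0. *)
Lemma near_small_quotient (eps : R) : 0 < eps ->
  \forall x \near x0, forall i j, blk i j ->
    `|('D_(e i) r x - 'D_(e j) r x) / (x 0 i - x 0 j)| <= eps.
Proof.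
move=> eps0; apply: near_forall_ord => i; apply: near_forall_ord => j.
have [bij|nb] := boolP (blk i j); last first.
  by apply: (@nearS _ x0 setT) => //; exact: (@filterT _ _ (nbhs_filter x0)).
have [tij|tij] := boolP (tie blk x0 i j).
  have e2 : 0 < eps / 2 by rewrite divr_gt0.
  have nU : \forall y \near x0, U y by exact: open_nbhs_nbhs.
  have /nbhs_ballP[d /= d0 dP] := nearI nU (near_small_hess e2).
  have : \forall x \near x0, ball x0 d x by exact: nbhsx_ballx.
  apply: nearS => x xb _.
  have -> : eps = 2 * (eps / 2) by rewrite mulrCA divff ?mulr1.
  by apply: (@grad_quotient_tied d) => //; rewrite ltW.
have xij : 0 < `|x0 0 i - x0 0 j|.
  by rewrite normr_gt0 subr_eq0; move: tij; rewrite /tie bij.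
pose d := `|x0 0 i - x0 0 j|.
(* Within d/4 of [x0] the two coordinates stay at least d/2 apart, so two partial derivatives
   bounded by eps * d/4 give a quotient of at most eps. *)
have d4 : 0 < eps * (d / 4) by rewrite mulr_gt0 // divr_gt0.
have d2 : 0 < d / 4 by rewrite divr_gt0.
have nx : \forall x \near x0, ball x0 (d / 4) x by exact: nbhsx_ballx.
have := nearI nx
  (nearI (near_small_grad i d4) (near_small_grad j d4)).
apply: nearS => x [xb [hi hj]] _; rewrite normrM normfV.
have xd : d / 2 <= `|x 0 i - x 0 j|.
  move: xb; rewrite -ball_normE /= => xb.
  have := mx_entry_le_norm (x0 - x) 0 i; have := mx_entry_le_norm (x0 - x) 0 j.
  rewrite !mxE => bj bi.
  have : d <= `|x 0 i - x 0 j| + `|x0 0 i - x 0 i| + `|x0 0 j - x 0 j|.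
    rewrite /d (_ : x0 0 i - x0 0 j =
      (x 0 i - x 0 j) + (x0 0 i - x 0 i) - (x0 0 j - x 0 j)); last by ring.
    by apply: le_trans (ler_normB _ _) _; rewrite lerD2r ler_normD.
  move: xb bj bi; move: `|x0 - x| `|x0 0 i - _| `|x0 0 j - _| `|x 0 i - _| => *; lra.
have xp : 0 < `|x 0 i - x 0 j| by apply: lt_le_trans xd; rewrite divr_gt0.
rewrite ler_pdivrMr //; apply: le_trans (ler_normB _ _) _.
have [[a aE] [b bE]] : (exists a : R, 'D_(e i) r x = a) /\
    (exists b : R, 'D_(e j) r x = b) by split; eexists.
move: hi hj; rewrite aE bE => hi hj; apply: le_trans (lerD hi hj) _.
apply: le_trans (_ : _ <= eps * (d / 2)) _; last by rewrite ler_pM2l.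
by rewrite -mulrDr ler_pM2l //; lra.
Qed.

End SmallJets.

(** * Regularity of compositions with the eigenvalue map *)

Section SpectralC2.
Variables (R : realType) (n : nat) (blk : rel 'I_n).
Hypotheses (blkR : reflexive blk) (blkS : symmetric blk) (blkT : transitive blk).
Local Notation e i := (delta_mx 0 i : 'rV[R]_n).
Variables (E : normedModType R) (Lam : E -> 'rV[R]_n) (A : E -> E -> 'M[R]_n).
Hypothesis model : spectral_model blk Lam A.
Variables (C D : R).
Hypotheses (C0 : 0 < C) (D0 : 0 < D).
Hypothesis lip : forall X Y, `|Lam X - Lam Y| <= C * `|X - Y|.
Hypothesis bnd : forall X v i j, `|A X v i j| <= D * `|v|.

Lemma Lam_continuous : continuous Lam.
Proof.
move=> X; apply/cvgrPdist_lt => eps eps0.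
have : \forall Y \near X, ball X (eps / C) Y by apply: nbhsx_ballx; rewrite divr_gt0.
apply: nearS => Y; rewrite -ball_normE /= => XY.
by apply: le_lt_trans (lip _ _) _; rewrite mulrC -ltr_pdivlMr.
Qed.

Lemma Lam_near (P : set 'rV[R]_n) X :
  (\forall y \near Lam X, P y) -> \forall Y \near X, P (Lam Y).
Proof. exact: Lam_continuous. Qed.

(** A Lipschitz inner map, differentiable or not, preserves an error o(|y - x|). *)
Lemma littleo_comp_Lam (r : 'rV[R]_n -> R) X : differentiable r (Lam X) ->
  (forall v, 'D_v r (Lam X) = 0) -> forall eps, 0 < eps ->
  \forall Y \near X, `|r (Lam Y) - r (Lam X)| <= eps * `|Y - X|.
Proof.
move=> dr r0 eps eps0.
have eC : 0 < eps / C by rewrite divr_gt0.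
have := Lam_near (differentiable_littleo dr eC).
apply: nearS => Y /=; rewrite -deriveE // r0 subr0 => h.
apply: le_trans h _; rewrite mulrAC ler_pdivrMr // -mulrA ler_pM2l //.
by rewrite mulrC; exact: lip.
Qed.

Section OneFunction.
Variables (U : set 'rV[R]_n) (f : 'rV[R]_n -> R).
Hypotheses (oU : open U) (cf : C2_on U f) (finv : block_invariant blk f).

(** Subtract from [f] a [q] with the same gradient at [Lam X]: the rest has zero derivative there
    and contributes o(|Y - X|), while [q \o Lam] is polynomial with a known derivative. *)
Lemma spectral_diff1 X : U (Lam X) -> differentiable (f \o Lam) X /\
  forall v, 'D_v (f \o Lam) X = \sum_i 'D_(e i) f (Lam X) * A X v i i.
Proof.
move=> UX.
have [q [_ pq q1 _ qm]] := jet_match blkR blkS blkT oU cf finv UX.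
have [pqL /(_ X erefl)[D1 _]] := qm _ _ _ model.
have df : differentiable f (Lam X) by exact: C2_diff UX.
have dq : differentiable q (Lam X) by exact: polyfun_diff.
have dr : differentiable (f - q) (Lam X) by exact: differentiableB.
have r0 v : 'D_v (f - q) (Lam X) = 0.
  by rewrite (deriveB (diff_derivable df) (diff_derivable dq)) q1 subrr.
have [dfL DfL] := differentiable_approx (polyfun_diff X pqL)
  (littleo_comp_Lam dr r0 : forall eps, 0 < eps -> \forall Y \near X,
     `|((f \o Lam) Y - (q \o Lam) Y) - ((f \o Lam) X - (q \o Lam) X)| <= eps * `|Y - X|).
by split=> // v; rewrite DfL D1.
Qed.

End OneFunction.

(** By the first-derivative formula, ['D_v] of the two compositions with [f] and [q] differ by a sum
    of differences of partial derivatives times diagonal entries of [A]. The differences are o(|Y -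
    X|), as the 2-jets agree at [Lam X], and the entries are bounded, so [A] may jump with Y. *)
Lemma spectral_diff2 (U : set 'rV[R]_n) f X : open U -> C2_on U f ->
  block_invariant blk f -> U (Lam X) ->
  (forall v, differentiable ('D_v (f \o Lam)) X) /\
  forall v w eps, 0 <= eps ->
    (forall i j, `|'D_(e j) ('D_(e i) f) (Lam X)| <= eps) ->
    (forall i j, blk i j -> `|('D_(e i) f (Lam X) - 'D_(e j) f (Lam X)) /
                              (Lam X 0 i - Lam X 0 j)| <= eps) ->
    `|'D_w ('D_v (f \o Lam)) X| <=
      n%:R * (n%:R * (4 * (eps * (D * `|w| * (D * `|v|))))).
Proof.
move=> oU cf finv UX.
have [q [qinv pq q1 q2 qm]] := jet_match blkR blkS blkT oU cf finv UX.
have [pqL /(_ X erefl)[_ D2]] := qm _ _ _ model.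
suff h v : differentiable ('D_v (f \o Lam)) X /\
    forall w, 'D_w ('D_v (f \o Lam)) X = 'D_w ('D_v (q \o Lam)) X.
  split=> [v|v w eps e0 Hb Gb]; first by have [] := h v.
  have [_ ->] := h v; apply: D2 => //; first by rewrite !mulr_ge0 // ltW.
  by move=> i j k l; rewrite normrM; apply: ler_pM.
apply: differentiable_approx; first exact: polyfun_diff (polyfun_derive v pqL).
move=> eps eps0.
have cq : C2_on U q by exact: polyfun_C2.
(* The sum has n terms with entries at most D * |v|; the summand 1 makes [K] a legitimate
   divisor. *)
pose K := n%:R * (D * `|v|) + 1.
have K0 : 0 < K by rewrite ltr_wpDl // !mulr_ge0 // ltW.
have eK : 0 < eps / K by rewrite divr_gt0.
have df i : differentiable ('D_(e i) f) (Lam X) by exact: C2_diff1 UX.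
have dq i : differentiable ('D_(e i) q) (Lam X) by exact: C2_diff1 UX.
have dr i : differentiable ('D_(e i) f - 'D_(e i) q) (Lam X) by exact: differentiableB.
have r0 i u : 'D_u ('D_(e i) f - 'D_(e i) q) (Lam X) = 0.
  by rewrite (deriveB (diff_derivable (df i)) (diff_derivable (dq i))) q2 subrr.
have nb : \forall Y \near X, forall i,
    `|'D_(e i) f (Lam Y) - 'D_(e i) q (Lam Y)| <= eps / K * `|Y - X|.
  apply: near_forall_ord => i.
  have := littleo_comp_Lam (dr i) (r0 i) eK; apply: nearS => Y.
  by rewrite !fctE q1 subrr subr0.
have nU : \forall Y \near X, U (Lam Y).
  by apply: Lam_near; exact: open_nbhs_nbhs.
have := nearI nb nU; apply: nearS => Y [Yb UY].
have DY Z : U (Lam Z) -> 'D_v (f \o Lam) Z - 'D_v (q \o Lam) Z =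
    \sum_i ('D_(e i) f (Lam Z) - 'D_(e i) q (Lam Z)) * A Z v i i.
  move=> UZ; have [_ ->] := spectral_diff1 oU cf finv UZ.
  have [_ ->] := spectral_diff1 oU cq qinv UZ.
  by rewrite -sumrB; apply: eq_bigr => i _; rewrite mulrBl.
rewrite (DY X UX) big1 => [|i _]; last by rewrite q1 subrr mul0r.
rewrite subr0 (DY Y UY).
apply: le_trans (sum_le_card (K := eps / K * `|Y - X| * (D * `|v|)) _ _) _.
- by rewrite !mulr_ge0 ?invr_ge0 ?(ltW eps0) ?(ltW K0) ?(ltW D0).
- by move=> i _; rewrite normrM; apply: ler_pM.
- have -> : n%:R * (eps / K * `|Y - X| * (D * `|v|)) =
      eps * `|Y - X| * (n%:R * (D * `|v|) / K) by ring.
  by rewrite ler_piMr ?mulr_ge0 ?(ltW eps0) // ler_pdivrMr // mul1r /K lerDl.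
Qed.

(** For continuity at [X], write f = q + r with [q] fitted at [Lam X]. The second derivatives of
    [q \o Lam] are polynomial; those of [r \o Lam] at nearby points are bounded by Hessian entries
    and gradient quotients of [r], which tend to 0. *)
Lemma spectral_C2 (U : set 'rV[R]_n) f : open U -> C2_on U f ->
  block_invariant blk f -> C2_on (Lam @^-1` U) (f \o Lam).
Proof.
move=> oU cf finv v w; split=> X UX.
  split; first by have [] := spectral_diff1 oU cf finv UX.
  by have [] := spectral_diff2 oU cf finv UX.
have {}UX : U (Lam X) := UX.
have [q [qinv pq q1 q2 qm]] := jet_match blkR blkS blkT oU cf finv UX.
have [pqL _] := qm _ _ _ model.
have cq : C2_on U q by exact: polyfun_C2.
pose r := f + (-1) \*: q.
have cr : C2_on U r by exact: (C2_onD oU cf (C2_onZ oU (-1) cq)).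
have rE y : r y = f y - q y by rewrite /r -[LHS]/(f y + (-1) *: q y) scaleN1r.
have rinv : block_invariant blk r.
  by move=> s sb y; rewrite !rE finv // qinv.
have nU : \forall Y \near X, U (Lam Y).
  by apply: Lam_near; exact: open_nbhs_nbhs.
have frq : f \o Lam = (q \o Lam) + (r \o Lam).
  by apply/funext => Y; rewrite !fctE /= rE addrC subrK.
have DfL u Y : U (Lam Y) ->
    'D_u (f \o Lam) Y = ('D_u (q \o Lam) + 'D_u (r \o Lam)) Y.
  move=> UY; rewrite frq deriveD //; apply: diff_derivable.
    exact: polyfun_diff.
  by have [] := spectral_diff1 oU cr rinv UY.
have DDfL Y : U (Lam Y) -> 'D_w ('D_v (f \o Lam)) Y =
    'D_w ('D_v (q \o Lam)) Y + 'D_w ('D_v (r \o Lam)) Y.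
  move=> UY; have nY : \forall Z \near Y, 'D_v (f \o Lam) Z =
      ('D_v (q \o Lam) + 'D_v (r \o Lam)) Z.
    have : \forall Z \near Y, U (Lam Z).
      by apply: Lam_near; exact: open_nbhs_nbhs.
    by apply: nearS => Z; exact: DfL.
  rewrite (near_eq_derive w nY) deriveD //; apply: diff_derivable.
    exact: polyfun_diff (polyfun_derive v pqL).
  by have [] := spectral_diff2 oU cr rinv UY.
have df : differentiable f (Lam X) by exact: C2_diff UX.
have dq : differentiable q (Lam X) by exact: polyfun_diff.
have rfun : r = f - q by apply/funext => y; rewrite rE.
have r1 u : 'D_u r (Lam X) = 0.
  by rewrite rfun (deriveB (diff_derivable df) (diff_derivable dq)) q1 subrr.
have r2 u u' : 'D_u' ('D_u r) (Lam X) = 0.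
  have dfu : differentiable ('D_u f) (Lam X) by exact: C2_diff1 UX.
  have dqu : differentiable ('D_u q) (Lam X) by exact: C2_diff1 UX.
  have ny : \forall y \near Lam X, 'D_u r y = ('D_u f - 'D_u q) y.
    have : \forall y \near Lam X, U y by exact: open_nbhs_nbhs.
    apply: nearS => y Uy; rewrite rfun deriveB //; apply: diff_derivable.
      exact: C2_diff Uy.
    exact: polyfun_diff.
  rewrite (near_eq_derive u' ny).
  by rewrite (deriveB (diff_derivable dfu) (diff_derivable dqu)) q2 subrr.
have cqL : {for X, continuous ('D_w ('D_v (q \o Lam)))}.
  by apply: polyfun_cont; apply: polyfun_derive; exact: polyfun_derive.
have crL : 'D_w ('D_v (r \o Lam)) Y @[Y --> X] --> 0.
  apply/cvgr0Pnorm_le => eps eps0.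
  pose K := n%:R * (n%:R * (4 * (D * `|w| * (D * `|v|)))) + 1.
  have K0 : 0 < K by rewrite ltr_wpDl // !mulr_ge0 // ltW.
  have eK : 0 < eps / K by rewrite divr_gt0.
  have h1 := Lam_near (near_small_hess cr UX r2 eK).
  have h2 := Lam_near (near_small_quotient blkR blkS oU cr rinv UX r1 r2 eK).
  have := nearI nU (nearI h1 h2); apply: nearS => Y [UY [hY qY]].
  have [_ /(_ v w _ (ltW eK) hY qY)] := spectral_diff2 oU cr rinv UY.
  move=> h; apply: le_trans h _.
  have -> : n%:R * (n%:R * (4 * (eps / K * (D * `|w| * (D * `|v|))))) =
     eps * ((n%:R * (n%:R * (4 * (D * `|w| * (D * `|v|))))) / K) by ring.
  by rewrite ler_piMr ?(ltW eps0) // ler_pdivrMr // mul1r /K lerDl.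
(* The same estimate with eps = 0 gives the value at [X] itself. *)
have r0X : 'D_w ('D_v (r \o Lam)) X = 0.
  have h1 i j : `|'D_(e j) ('D_(e i) r) (Lam X)| <= 0 by rewrite r2 normr0.
  have h2 i j : blk i j -> `|('D_(e i) r (Lam X) - 'D_(e j) r (Lam X)) /
                              (Lam X 0 i - Lam X 0 j)| <= 0.
    by move=> _; rewrite !r1 subrr mul0r normr0.
  have b0 : n%:R * (n%:R * (4 * (0 * (D * `|w| * (D * `|v|))))) = 0 :> R.
    by rewrite mul0r !mulr0.
  have [_ /(_ v w 0 (lexx _) h1 h2)] := spectral_diff2 oU cr rinv UX.
  by rewrite b0 => h; apply/eqP; rewrite -normr_le0; exact: h.
rewrite /prop_for /continuous_at (DDfL X UX) r0X.
apply: (near_eq_cvg_to _ (cvgD cqL crL)).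
by move: nU; apply: nearS => Y UY; exact: DDfL.
Qed.

End SpectralC2.

(** * Block-diagonal symmetric matrices *)

Lemma mxBE (R : realType) m n (A B : 'M[R]_(m, n)) i j : (A - B) i j = A i j - B i j.
Proof. by rewrite !mxE. Qed.

Section BlockDecomposition.
Variables (R : realType) (n : nat) (s : 'S_n).

Definition same_orbit : rel 'I_n := fun i j => j \in porbit s i.

Lemma same_orbit_refl : reflexive same_orbit. Proof. by move=> i; exact: porbit_id. Qed.

Lemma same_orbit_sym : symmetric same_orbit. Proof. by move=> i j; rewrite /same_orbit porbit_sym. Qed.

Lemma same_orbitE i j : same_orbit i j = (porbit s i == porbit s j).
Proof. by rewrite eq_porbit_mem /same_orbit porbit_sym. Qed.

Lemma same_orbit_trans : transitive same_orbit.
Proof. by move=> j i k; rewrite !same_orbitE => /eqP -> /eqP ->. Qed.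

(** The isometric inclusion of the coordinates in [B], listed increasingly, into R^n. *)
Definition inclmx (B : {set 'I_n}) : 'M[R]_(#|B|, n) :=
  \matrix_(a, i) (enum_val a == i)%:R.

Lemma inclmx_disjoint B B' : B \in porbits s -> B' \in porbits s -> B != B' ->
  inclmx B *m (inclmx B')^T = 0.
Proof.
move=> /imsetP[i _ ->] /imsetP[j _ ->] ij; apply/matrixP => a b; rewrite !mxE.
rewrite big1 // => k _; rewrite !mxE.
have [ak|_] := eqVneq (enum_val a) k; last by rewrite mul0r.
have [bk|_] := eqVneq (enum_val b) k; last by rewrite mulr0.
have := enum_valP a; have := enum_valP b; rewrite ak bk -!eq_porbit_mem.
by move=> /eqP kj /eqP ki; move: ij; rewrite -ki kj eqxx.
Qed.

Lemma inclmx_id B : inclmx B *m (inclmx B)^T = 1%:M.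
Proof.
apply/matrixP => a b; rewrite !mxE (bigD1 (enum_val a)) //= !mxE eqxx mul1r.
rewrite big1 ?addr0 => [|k ka]; last by rewrite mxE eq_sym (negPf ka) mul0r.
by rewrite (inj_eq enum_val_inj) eq_sym.
Qed.

Definition blockmx (F : forall B : {set 'I_n}, 'M[R]_#|B|) : 'M[R]_n :=
  \sum_(B in porbits s) (inclmx B)^T *m F B *m inclmx B.

Lemma blockmxE (F : forall B : {set 'I_n}, 'M[R]_#|B|) (G : 'I_n -> 'I_n -> R) :
  (forall B, B \in porbits s -> forall a b, F B a b = G (enum_val a) (enum_val b)) ->
  forall i j, blockmx F i j = if same_orbit i j then G i j else 0.
Proof.
move=> FG i j; rewrite /blockmx summxE.
transitivity (\sum_(B in porbits s) if (i \in B) && (j \in B) then G i j else 0).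
  apply: eq_bigr => B PB; rewrite mxE.
  transitivity (\sum_(l in B) \sum_(k in B) (k == i)%:R * G k l * (l == j)%:R).
    rewrite [RHS]big_enum_val /=; apply: eq_bigr => b _; rewrite !mxE.
    rewrite [RHS]big_enum_val /= -mulr_suml; congr (_ * _).
    by apply: eq_bigr => a _; rewrite !mxE FG.
  have [iB|iB] /= := boolP (i \in B); last first.
    rewrite big1 // => l _; rewrite big1 // => k kB.
    by have [ki|] := eqVneq k i; [move: iB; rewrite -ki kB|rewrite !mul0r].
  have [jB|jB] := boolP (j \in B); last first.
    rewrite big1 // => l lB; rewrite big1 // => k kB.
    by have [lj|] := eqVneq l j; [move: jB; rewrite -lj lB|rewrite mulr0].
  rewrite (bigD1 j) //= (bigD1 i) //= !eqxx mul1r mulr1.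
  rewrite big1 ?addr0 => [|k /andP[_ ki]]; last by rewrite (negPf ki) !mul0r.
  rewrite big1 ?addr0 // => l /andP[_ lj]; rewrite big1 // => k _.
  by rewrite (negPf lj) mulr0.
rewrite (bigD1 (porbit s i)) /=; last by apply/imsetP; exists i.
rewrite porbit_id /= -/(same_orbit i j) big1 ?addr0 // => B /andP[/imsetP[k _ ->] ki].
case: ifP => // /andP[ik _]; move: ki.
by rewrite -eq_porbit_mem in ik; rewrite (eqP ik) eqxx.
Qed.

(** Inclusions of distinct orbits have orthogonal ranges, so the cross terms vanish. *)
Lemma blockmxM F G : blockmx F *m blockmx G = blockmx (fun B => F B *m G B).
Proof.
rewrite /blockmx mulmx_suml; apply: eq_bigr => B PB.
rewrite mulmx_sumr (bigD1 B) //= big1 ?addr0 => [|B' /andP[PB' BB']].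
  rewrite !mulmxA -[_ *m inclmx B *m (inclmx B)^T]mulmxA inclmx_id mulmx1.
  by rewrite -!mulmxA.
rewrite !mulmxA -[_ *m inclmx B *m (inclmx B')^T]mulmxA inclmx_disjoint //.
  by rewrite mulmx0 !mul0mx.
by rewrite eq_sym.
Qed.

Lemma blockmx_tr F : (blockmx F)^T = blockmx (fun B => (F B)^T).
Proof.
rewrite /blockmx linear_sum /=; apply: eq_bigr => B _.
by rewrite !trmx_mul trmxK mulmxA.
Qed.

Lemma blockmx_orb F i j : ~~ same_orbit i j -> blockmx F i j = 0.
Proof.
move=> nij; rewrite /blockmx summxE big1 // => B PB; rewrite mxE big1 // => b _.
rewrite [inclmx B b j]mxE; have [bj|] := eqVneq (enum_val b) j; last by rewrite mulr0.
rewrite mxE big1 ?mul0r // => a _; rewrite !mxE.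
have [ai|] := eqVneq (enum_val a) i; last by rewrite mul0r.
have := enum_valP a; have := enum_valP b; rewrite ai bj => jB iB.
case/imsetP: (PB) => k _ BE; move: jB iB nij; rewrite {1 2}BE -!eq_porbit_mem same_orbitE.
by move=> /eqP -> /eqP ->; rewrite eqxx.
Qed.

Lemma index_sorted_count (t : seq 'I_n) (k : 'I_n) :
  sorted (fun a b : 'I_n => (a < b)%N) t -> k \in t ->
  index k t = count (fun j : 'I_n => (j < k)%N) t.
Proof.
elim: t => [|a t IH] //= st.
have ta : all (fun b : 'I_n => (a < b)%N) t.
  by move: st; rewrite path_sortedE; [move=> /andP[]|move=> x y z; exact: ltn_trans].
rewrite inE eq_sym; have [<- _|ak /=] := eqVneq a k.
  rewrite ltnn add0n; apply/esym/eqP; rewrite -leqn0 leqNgt -has_count.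
  by apply/hasPn => b /(allP ta); rewrite -leqNgt => /ltnW.
move=> kt; rewrite (allP ta _ kt) add1n IH //; exact: path_sorted st.
Qed.

(** The enumeration of [B] is strictly increasing, so counting smaller elements gives the position.
    This identifies the rank used in [lambda_sigma] with the index of an eigenvalue of the block. *)
Lemma enum_val_position (B : {set 'I_n}) (a : 'I_#|B|) :
  #|[set j in B | (j < enum_val a)%N]%SET| = a.
Proof.
have -> : nat_of_ord a = index (enum_val a) (enum B).
  by rewrite (enum_val_nth (enum_val a)) index_uniq // -?cardE // enum_uniq.
rewrite index_sorted_count; last first.
- by rewrite mem_enum; exact: enum_valP.
- rewrite /enum_mem -enumT; apply: sorted_filter => [x y z|]; first exact: ltn_trans.
  have := iota_ltn_sorted 0 n; rewrite -val_enum_ord.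
  by rewrite sorted_map.
rewrite -size_filter cardE; apply: perm_size; apply: uniq_perm => [||j].
- exact: enum_uniq.
- by apply: filter_uniq; exact: enum_uniq.
by rewrite mem_enum inE [RHS]mem_filter mem_enum andbC.
Qed.

Lemma lambda_sigma_enum_val (X : 'M[R]_n) (B : {set 'I_n}) (a : 'I_#|B|) :
  B \in porbits s -> lambda_sigma s X 0 (enum_val a) = eigrow (blocksub X B) 0 a.
Proof.
move=> /imsetP[i _ BE]; rewrite !mxE.
have -> : porbit s (enum_val a) = B.
  have : enum_val a \in porbit s i by rewrite -BE; exact: enum_valP.
  by rewrite -eq_porbit_mem => /eqP ->; rewrite BE.
by rewrite enum_val_position.
Qed.

Lemma blocksub_sym (X : 'M[R]_n) B : X^T = X -> (blocksub X B)^T = blocksub X B.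
Proof.
move=> symX; apply/matrixP => a b; rewrite !mxE -[in LHS]symX mxE //.
Qed.

(** Each block is diagonalized separately and the orthogonal factors are assembled, which keeps the
    eigenbasis itself block-diagonal. *)
Lemma Ssigma_diagonalization (X : 'M[R]_n) : Ssigma s X ->
  exists U : 'M[R]_n, [/\ U *m U^T = 1%:M, forall i j, ~~ same_orbit i j -> U i j = 0 &
    X = U *m diag_mx (lambda_sigma s X) *m U^T].
Proof.
move=> [symX bX].
have h (B : {set 'I_n}) : exists V : 'M[R]_#|B|, V *m V^T = 1%:M /\
    blocksub X B = V *m diag_mx (eigrow (blocksub X B)) *m V^T.
  by apply: eigs_diagonalization; exact: blocksub_sym.
pose V B := projT1 (cid (h B)).
have VV B : V B *m (V B)^T = 1%:M by have [] := projT2 (cid (h B)).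
have VX B : blocksub X B = V B *m diag_mx (eigrow (blocksub X B)) *m (V B)^T.
  by have [] := projT2 (cid (h B)).
have one : blockmx (fun B => 1%:M) = 1%:M.
  apply/matrixP => i j; rewrite (@blockmxE _ (fun i j => (i == j)%:R)) => [|B _ a b].
    by rewrite mxE; case: eqVneq => [->|]; rewrite ?same_orbit_refl // if_same.
  by rewrite mxE (inj_eq enum_val_inj).
have diagE : blockmx (fun B => diag_mx (eigrow (blocksub X B))) =
    diag_mx (lambda_sigma s X).
  apply/matrixP => i j.
  rewrite (@blockmxE _ (fun i j => lambda_sigma s X 0 i *+ (i == j))) => [|B PB a b].
    rewrite [RHS]mxE; have [->|_] := eqVneq i j; first by rewrite same_orbit_refl.
    by rewrite !mulr0n if_same.
  by rewrite lambda_sigma_enum_val // mxE (inj_eq enum_val_inj).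
have XE : X = blockmx (fun B => blocksub X B).
  apply/matrixP => i j; rewrite (@blockmxE _ (fun i j => X i j)) => [|B _ a b].
    by case: ifP => // /negbT; exact: bX.
  by rewrite mxE.
exists (blockmx V); split.
- rewrite blockmx_tr blockmxM -one; apply: eq_bigr => B _; by rewrite VV.
- exact: blockmx_orb.
- rewrite -diagE blockmx_tr !blockmxM [LHS]XE; apply: eq_bigr => B _.
  by rewrite -VX.
Qed.

Lemma lambda_sigma_lip (X Y : 'M[R]_n) (e : R) : 0 <= e -> Ssigma s X -> Ssigma s Y ->
  (forall i j, `|X i j - Y i j| <= e) ->
  forall i, `|lambda_sigma s X 0 i - lambda_sigma s Y 0 i| <= n%:R * e.
Proof.
move=> e0 [symX _] [symY _] XYe i.
have PB : porbit s i \in porbits s by apply/imsetP; exists i.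
pose a := enum_rank_in (porbit_id s i) i.
have ai : enum_val a = i by rewrite enum_rankK_in // porbit_id.
rewrite -ai !(lambda_sigma_enum_val _ _ PB).
apply: (@le_trans _ _ (#|porbit s i|%:R * e)).
  apply: weyl; [exact: blocksub_sym|exact: blocksub_sym|move=> k l; rewrite !mxE; exact: XYe].
rewrite ler_wpM2r // ler_nat; apply: leq_trans (max_card _) _.
by rewrite card_ord.
Qed.

(** The linear projection of all matrices onto S^n_sigma. Precomposing with it extends the
    eigenvalue map to the whole normed space in which open sets and derivatives are taken. *)
Definition symblock (X : 'M[R]_n) : 'M[R]_n :=
  \matrix_(i, j) if same_orbit i j then (X i j + X j i) / 2 else 0.

Lemma symblock_is_linear : linear symblock.
Proof.
move=> a X Y; apply/matrixP => i j; rewrite !mxE; case: ifP => _; last by ring.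
by field.
Qed.

HB.instance Definition _ := GRing.isLinear.Build R 'M[R]_n 'M[R]_n _ symblock
  symblock_is_linear.

Lemma symblock_Ssigma X : Ssigma s (symblock X).
Proof.
split; first by apply/matrixP => i j; rewrite !mxE same_orbit_sym addrC.
by move=> i j nij; rewrite mxE /same_orbit (negPf nij).
Qed.

Lemma symblock_id X : Ssigma s X -> symblock X = X.
Proof.
move=> [symX bX]; apply/matrixP => i j; rewrite mxE; case: ifP => [_|/negbT /bX-> //].
have -> : X j i = X i j by rewrite -[in LHS]symX mxE.
by field.
Qed.

Lemma symblock_norm X : `|symblock X| <= `|X|.
Proof.
apply: mx_norm_le_entries => // i j; rewrite mxE; case: ifP => _; last by rewrite normr0.
rewrite normrM normfV (@ger0_norm _ 2) // ler_pdivrMr // mulr_natr mulr2n.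
by apply: le_trans (ler_normD _ _) _; apply: lerD; exact: mx_entry_le_norm.
Qed.

Lemma continuous_symblock : continuous symblock.
Proof.
move=> X; apply: (cvg_mx (nbhs_filter X)) => i j; rewrite mxE.
under eq_fun do rewrite mxE.
case: (same_orbit i j); last exact: cvg_cst.
apply: cvgM; last exact: cvg_cst.
by apply: cvgD; exact: continuous_coord.
Qed.

Lemma derive_comp_symblock (f : 'M[R]_n -> R) (X v : 'M[R]_n) :
  'D_v (f \o symblock) X = 'D_(symblock v) f (symblock X).
Proof. exact: derive_comp_linear. Qed.

End BlockDecomposition.

(** * Derivatives of polynomials of a matrix *)

Section MatrixFunctions.
Variables (R : realType) (n : nat).
Implicit Types (X v w U M : 'M[R]_n) (x : 'rV[R]_n).

Definition mpow k X : 'M[R]_n := iter k (mulmx X) 1%:M.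

Definition hmx (h : {poly R}) X : 'M[R]_n := \sum_(k < size h) h`_k *: mpow k X.

Lemma mpow_diag U x k : U *m U^T = 1%:M ->
  mpow k (U *m diag_mx x *m U^T) = U *m diag_mx (\row_i x 0 i ^+ k) *m U^T.
Proof.
move=> UU; have UtU : U^T *m U = 1%:M by exact: mulmx1C.
elim: k => [|k IH] /=.
  rewrite (_ : diag_mx _ = 1%:M) ?mulmx1 //.
  by apply/matrixP => i j; rewrite !mxE expr0.
rewrite /mpow /= -/(mpow k _) IH !mulmxA -[_ *m U^T *m U]mulmxA UtU mulmx1.
rewrite -[U *m _ *m diag_mx _]mulmxA mulmx_diag; congr (_ *m diag_mx _ *m _).
by apply/rowP => i; rewrite !mxE exprS.
Qed.

Lemma hmx_diag U x h : U *m U^T = 1%:M ->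
  hmx h (U *m diag_mx x *m U^T) = U *m diag_mx (\row_i h.[x 0 i]) *m U^T.
Proof.
move=> UU; rewrite /hmx; under eq_bigr do rewrite mpow_diag // scalemxAl scalemxAr.
rewrite -mulmx_suml -mulmx_sumr; congr (_ *m _ *m _); apply/matrixP => i j.
rewrite summxE !mxE horner_coef -sumrMnl; apply: eq_bigr => k _.
by rewrite !mxE mulrnAr.
Qed.

Lemma polyfun_mpow k i j : polyfun (fun X => mpow k X i j).
Proof.
elim: k i j => [|k IH] i j; first exact: polyfun_cst.
rewrite (_ : (fun X => _) = fun X => \sum_l X i l * mpow k X l j); last first.
  by apply/funext => X; rewrite /mpow /= mxE.
by apply: polyfun_sum => l; apply: polyfunM; [exact: polyfun_coord|exact: IH].
Qed.

Definition ddmx (g : R -> R -> R) x M : 'M[R]_n :=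
  \matrix_(a, b) (g (x 0 a) (x 0 b) * M a b).

(** The Daleckii-Krein formula for powers: in an eigenbasis, differentiation multiplies entrywise by
    divided differences. The product rule on X * X^k reproduces the recursion of [ddX], with b^k
    coming from v X^k and the factor a from X. *)
Lemma derive_mpow U x v k i j : U *m U^T = 1%:M ->
  'D_v (fun X => mpow k X i j) (U *m diag_mx x *m U^T) =
  (U *m ddmx (@ddX R k) x (U^T *m v *m U) *m U^T) i j.
Proof.
move=> UU; have UtU : U^T *m U = 1%:M by exact: mulmx1C.
set Y := U *m diag_mx x *m U^T.
elim: k i j => [|k IH] i j.
  rewrite derive_cst0 (_ : ddmx _ _ _ = 0) ?mulmx0 ?mul0mx ?mxE //.
  by apply/matrixP => a b; rewrite !mxE mul0r.
rewrite (_ : (fun X => _) = fun X => \sum_l X i l * mpow k X l j); last first.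
  by apply/funext => X; rewrite /mpow /= mxE.
rewrite derive_polyfun_sum => [|l]; last first.
  by apply: polyfunM; [exact: polyfun_coord|exact: polyfun_mpow].
transitivity ((v *m mpow k Y + Y *m (U *m ddmx (@ddX R k) x (U^T *m v *m U) *m U^T)) i j).
  rewrite mxE [X in _ = X + _]mxE [X in _ = _ + X]mxE -big_split /=.
  apply: eq_bigr => l _; rewrite derive_polyfunM; last exact: polyfun_mpow.
    by rewrite IH derive_coord [LHS]addrC [mpow k Y l j * _]mulrC.
  exact: polyfun_coord.
suff -> : v *m mpow k Y + Y *m (U *m ddmx (@ddX R k) x (U^T *m v *m U) *m U^T) =
    U *m ddmx (@ddX R k.+1) x (U^T *m v *m U) *m U^T by [].
have -> : v *m mpow k Y = U *m ((U^T *m v *m U) *m diag_mx (\row_i x 0 i ^+ k)) *m U^T.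
  by rewrite /Y mpow_diag // !mulmxA UU mul1mx.
have -> : Y *m (U *m ddmx (@ddX R k) x (U^T *m v *m U) *m U^T) =
    U *m (diag_mx x *m ddmx (@ddX R k) x (U^T *m v *m U)) *m U^T.
  by rewrite /Y !mulmxA -[_ *m U^T *m U]mulmxA UtU mulmx1.
rewrite -mulmxDl -mulmxDr; congr (_ *m _ *m _); apply/matrixP => a b.
by rewrite mul_mx_diag mul_diag_mx !mxE /=; ring.
Qed.

Lemma polyfun_hmx h i j : polyfun (fun X => hmx h X i j).
Proof.
rewrite (_ : (fun X => _) = fun X => \sum_(k < size h) h`_k * mpow k X i j); last first.
  by apply/funext => X; rewrite summxE; apply: eq_bigr => k _; rewrite mxE.
by apply: polyfun_sum => k; apply: polyfunZ; exact: polyfun_mpow.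
Qed.

Lemma derive_hmx U x v h i j : U *m U^T = 1%:M ->
  'D_v (fun X => hmx h X i j) (U *m diag_mx x *m U^T) =
  (U *m ddmx (ddpoly h) x (U^T *m v *m U) *m U^T) i j.
Proof.
move=> UU.
rewrite (_ : (fun X => _) = fun X => \sum_(k < size h) h`_k * mpow k X i j); last first.
  by apply/funext => X; rewrite summxE; apply: eq_bigr => k _; rewrite mxE.
rewrite derive_polyfun_sum => [|k]; last by apply: polyfunZ; exact: polyfun_mpow.
under eq_bigr => k _ do rewrite (derive_polyfunZ _ _ _ (polyfun_mpow k i j)) derive_mpow //.
have -> : ddmx (ddpoly h) x (U^T *m v *m U) =
    \sum_(k < size h) h`_k *: ddmx (@ddX R k) x (U^T *m v *m U).
  apply/matrixP => a b; rewrite summxE [LHS]mxE /ddpoly mulr_suml.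
  by apply: eq_bigr => k _; rewrite [RHS]mxE [in RHS]mxE mulrA.
rewrite mulmx_sumr mulmx_suml summxE; apply: eq_bigr => k _.
by rewrite -scalemxAr -scalemxAl [RHS]mxE.
Qed.

End MatrixFunctions.

(** * The eigenvalue map as a spectral model *)

Section SpectralModel.
Variables (R : realType) (n : nat) (s : 'S_n).
Local Notation blk := (same_orbit s).

Definition eigbasis_spec (X U : 'M[R]_n) :=
  [/\ U *m U^T = 1%:M, forall i j, ~~ blk i j -> U i j = 0 &
    symblock s X = U *m diag_mx (lambda_sigma s (symblock s X)) *m U^T].

Lemma eigbasis_ex (X : 'M[R]_n) : exists U, eigbasis_spec X U.
Proof. exact: Ssigma_diagonalization (symblock_Ssigma s X). Qed.

Definition Lsym (X : 'M[R]_n) : 'rV[R]_n := lambda_sigma s (symblock s X).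

Section Basis.
Variable basis : 'M[R]_n -> 'M[R]_n.
Hypothesis basisP : forall X, eigbasis_spec X (basis X).

(** [basis] is an arbitrary choice of eigenbasis at each [X], so this may be discontinuous in
    [X]. *)
Definition rotated (X v : 'M[R]_n) : 'M[R]_n :=
  (basis X)^T *m symblock s v *m basis X.

(** Block-diagonality of [U] restricts its orthogonality relations to the rows of one block, so
    conjugation preserves every block trace and not only the full one. *)
Lemma block_trace (U M : 'M[R]_n) i : U *m U^T = 1%:M ->
  (forall i j, ~~ blk i j -> U i j = 0) ->
  \sum_(l | blk i l) (U *m M *m U^T) l l = \sum_(l | blk i l) M l l.
Proof.
move=> UU Ub; have UtU : U^T *m U = 1%:M by exact: mulmx1C.
have UUE a b : \sum_(l | blk i l) U l a * U l b = (blk i a && (a == b))%:R.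
  have [ia|nia] /= := boolP (blk i a); last first.
    rewrite big1 // => l il; rewrite Ub ?mul0r //.
    by apply: contra nia; apply: same_orbit_trans.
  move/matrixP: UtU => /(_ a b); rewrite !mxE => <-.
  rewrite big_mkcond /=; apply: eq_bigr => l _; rewrite !mxE; case: ifP => // /negbT il.
  rewrite [U l a]Ub ?mul0r //; apply: contra il => la.
  by apply: same_orbit_trans ia _; rewrite same_orbit_sym.
transitivity (\sum_a \sum_b M a b * \sum_(l | blk i l) U l a * U l b).
  transitivity (\sum_(l | blk i l) \sum_a \sum_b M a b * (U l a * U l b)).
    apply: eq_bigr => l _; rewrite mxE exchange_big /=; apply: eq_bigr => b _.
    rewrite !mxE mulr_suml; apply: eq_bigr => a _; ring.
  rewrite exchange_big /=; apply: eq_bigr => a _.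
  by rewrite exchange_big /=; apply: eq_bigr => b _; rewrite mulr_sumr.
rewrite [RHS]big_mkcond /=; apply: eq_bigr => a _; rewrite (bigD1 a) //= UUE eqxx andbT.
rewrite big1 ?addr0 => [|b ba]; last by rewrite UUE eq_sym (negPf ba) andbF mulr0.
by case: ifP; rewrite ?mulr1 ?mulr0.
Qed.

Lemma block_mul (M N : 'M[R]_n) : (forall i j, ~~ blk i j -> M i j = 0) ->
  (forall i j, ~~ blk i j -> N i j = 0) ->
  forall i j, ~~ blk i j -> (M *m N) i j = 0.
Proof.
move=> Mb Nb i j ij; rewrite mxE big1 // => k _.
have [ik|/Mb->] := boolP (blk i k); last by rewrite mul0r.
rewrite [N k j]Nb ?mulr0 //; apply: contra ij; exact: same_orbit_trans.
Qed.

Lemma rotated_block X v i j : ~~ blk i j -> rotated X v i j = 0.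
Proof.
have [_ Ub _] := basisP X; apply: block_mul => //; apply: block_mul.
  by move=> a b ab; rewrite mxE Ub // same_orbit_sym.
by have [_] := symblock_Ssigma s v.
Qed.

Lemma rotatedK X v : basis X *m rotated X v *m (basis X)^T = symblock s v.
Proof.
have [UU _ _] := basisP X; rewrite /rotated !mulmxA UU mul1mx -mulmxA UU.
by rewrite mulmx1.
Qed.

Lemma blocksum_hmx h i X :
  blocksum blk h i (Lsym X) = \sum_(l | blk i l) hmx h (symblock s X) l l.
Proof.
have [UU Ub XE] := basisP X; rewrite XE hmx_diag // block_trace //.
by apply: eq_bigr => l _; rewrite !mxE eqxx mulr1n.
Qed.

Lemma Lsym_derive h i X v : 'D_v (blocksum blk h i \o Lsym) X =
  \sum_(l | blk i l) h^`().[Lsym X 0 l] * rotated X v l l.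
Proof.
rewrite (_ : _ \o _ = (fun Y => \sum_(l | blk i l) hmx h Y l l) \o symblock s).
  rewrite derive_comp_symblock derive_polyfun_sum => [|l]; last exact: polyfun_hmx.
  have [UU Ub XE] := basisP X; rewrite XE.
  under eq_bigr do rewrite derive_hmx //.
  by rewrite block_trace //; apply: eq_bigr => l _; rewrite mxE ddpoly_diag.
by apply/funext => Y; exact: blocksum_hmx.
Qed.

(** The first derivative as the block trace of h'(X) v, free of [basis]: in this form it can be
    differentiated again although the eigenbasis has no regularity in [X]. *)
Lemma Lsym_derive_mul h i X v : 'D_v (blocksum blk h i \o Lsym) X =
  \sum_(l | blk i l) \sum_k symblock s v k l * hmx h^`() (symblock s X) l k.
Proof.
rewrite Lsym_derive; have [UU Ub XE] := basisP X.
transitivity (\sum_(l | blk i l) (hmx h^`() (symblock s X) *m symblock s v) l l).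
  rewrite -[symblock s v](rotatedK X v); move: (rotated X v) => rv.
  rewrite XE hmx_diag // !mulmxA -[_ *m (basis X)^T *m basis X]mulmxA (mulmx1C UU) mulmx1.
  rewrite -[basis X *m _ *m rv]mulmxA block_trace //.
  by apply: eq_bigr => l _; rewrite mul_diag_mx !mxE.
by apply: eq_bigr => l _; rewrite mxE; apply: eq_bigr => k _; rewrite mulrC.
Qed.

Lemma Lsym_model : spectral_model blk Lsym rotated.
Proof.
move=> h i; split.
- rewrite (_ : _ \o _ = (fun Y => \sum_(l | blk i l) hmx h Y l l) \o symblock s).
    apply: polyfun_comp_linear; first exact: continuous_symblock.
    by apply: polyfun_sum => l; exact: polyfun_hmx.
  by apply/funext => Y; exact: blocksum_hmx.
- exact: Lsym_derive.
move=> X v w.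
rewrite (_ : 'D_v (blocksum blk h i \o Lsym) =
  (fun Y => \sum_(l | blk i l) \sum_k symblock s v k l * hmx h^`() Y l k) \o symblock s);
  last by apply/funext => Y; exact: Lsym_derive_mul.
have ph l k : polyfun (fun Y => symblock s v k l * hmx h^`() Y l k).
  by apply: polyfunZ; exact: polyfun_hmx.
rewrite derive_comp_symblock derive_polyfun_sum => [|l]; last exact: polyfun_sum.
have [UU Ub XE] := basisP X; rewrite XE.
transitivity (\sum_(l | blk i l)
    (basis X *m (ddmx (ddpoly h^`()) (Lsym X) (rotated X w) *m rotated X v) *m
     (basis X)^T) l l).
  apply: eq_bigr => l _; rewrite derive_polyfun_sum //.
  have -> : basis X *m (ddmx (ddpoly h^`()) (Lsym X) (rotated X w) *m rotated X v) *m
     (basis X)^T = (basis X *m ddmx (ddpoly h^`()) (Lsym X) (rotated X w) *m (basis X)^T)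
     *m symblock s v.
    rewrite -[symblock s v](rotatedK X v).
    move: (rotated X v) (ddmx _ _ _) => rv dm.
    by rewrite !mulmxA -[_ *m (basis X)^T *m basis X]mulmxA (mulmx1C UU) mulmx1.
  rewrite [RHS]mxE; apply: eq_bigr => k _.
  rewrite (derive_polyfunZ _ _ _ (polyfun_hmx h^`() l k)) derive_hmx // mulrC.
  by [].
rewrite block_trace //; apply: eq_bigr => a ia; rewrite mxE [RHS]big_mkcond /=.
apply: eq_bigr => b _; rewrite [ddmx _ _ _ a b]mxE -mulrA; case: ifP => // /negbT ib.
rewrite [rotated X w a b]rotated_block ?mul0r ?mulr0 //; apply: contra ib.
exact: same_orbit_trans.
Qed.

(** Entries of an orthogonal matrix are at most 1 in absolute value, and the two products sum over n
    indices each; the added 1 keeps the constant positive when n = 0. *)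
Lemma rotated_bound X v i j : `|rotated X v i j| <= (n%:R * n%:R + 1) * `|v|.
Proof.
have [UU _ _] := basisP X.
have U1 a b : `|basis X a b| <= 1.
  rewrite -[leLHS]ger0_norm // -[1](@ger0_norm R) // -ler_sqr ?nnegrE //.
  rewrite !normr_id [in leRHS]normr1 expr1n -normrX ger0_norm ?sqr_ge0 //.
  move/matrixP: UU => /(_ a a); rewrite !mxE eqxx mulr1n => <-.
  rewrite (bigD1 b) //= !mxE -expr2 lerDl; apply: sumr_ge0 => k _.
  by rewrite mxE -expr2 sqr_ge0.
apply: (@le_trans _ _ (n%:R * (n%:R * `|v|))); last first.
  by rewrite mulrA mulrDl mul1r lerDl.
rewrite /rotated mxE; apply: sum_le_card => [|k _]; first by rewrite mulr_ge0.
rewrite normrM -[leRHS]mulr1; apply: ler_pM => //.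
rewrite mxE; apply: sum_le_card => // l _; rewrite normrM -[leRHS]mul1r mxE.
apply: ler_pM => //; apply: le_trans (symblock_norm s v).
exact: mx_entry_le_norm.
Qed.

End Basis.

Lemma Lsym_lip (X Y : 'M[R]_n) : `|Lsym X - Lsym Y| <= (n%:R + 1) * `|X - Y|.
Proof.
apply: (@le_trans _ _ (n%:R * `|X - Y|)); last by rewrite mulrDl mul1r lerDl.
apply: mx_norm_le_entries => [|i j]; first by rewrite mulr_ge0.
rewrite ord1 mxBE.
apply: lambda_sigma_lip; [by []|exact: symblock_Ssigma|exact: symblock_Ssigma|].
move=> a b; apply: le_trans (symblock_norm s (X - Y)).
apply: le_trans (mx_entry_le_norm _ a b).
by rewrite linearB /= mxBE.
Qed.

End SpectralModel.

(** * Newton correction for C^2 equations *)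

Lemma near_eq_continuous (R : realType) (T : topologicalType) (x : T) (f g : T -> R) :
  (\forall y \near x, f y = g y) -> g y @[y --> x] --> g x -> f y @[y --> x] --> f x.
Proof.
by move=> fg gx; rewrite (nbhs_singleton fg); exact: near_eq_cvg_to fg gx.
Qed.

Section RowValued.
Variables (R : realType) (E : normedModType R) (k : nat).
Implicit Types (F G : E -> 'rV[R]_k) (x y v w : E).

Lemma differentiable_coord_row F x c : differentiable F x ->
  differentiable (fun y => F y 0 c) x.
Proof. move=> dF.
exact: (@differentiable_comp _ _ _ _ F (fun A : 'rV[R]_k => A 0 c) x dF
  (differentiable_coord _ _ _)). Qed.

Lemma derive_coord_row F x v c : differentiable F x ->
  'D_v (fun y => F y 0 c) x = 'D_v F x 0 c.
Proof. by move=> dF; rewrite (derive_mx (diff_derivable dF)) mxE. Qed.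

Lemma differentiable_rows F x : (forall c, differentiable (fun y => F y 0 c) x) ->
  differentiable F x.
Proof.
move=> dF; have -> : F = \sum_c (fun y => F y 0 c *: (delta_mx 0 c : 'rV[R]_k)).
  by apply/funext => y; rewrite fct_sumE {1}(row_sum_delta (F y)).
by apply: differentiable_sum => c; apply: differentiableZl; exact: dF.
Qed.

Variable U : set E.
Hypothesis oU : open U.

Lemma C2_coord_row F c : C2_on U F -> C2_on U (fun y => F y 0 c).
Proof.
move=> cF.
have nU x : U x -> \forall y \near x, U y by move=> Ux; exact: open_nbhs_nbhs.
have n1 x v : U x -> \forall y \near x, 'D_v (fun z => F z 0 c) y = 'D_v F y 0 c.
  by move=> /nU; apply: nearS => y Uy; apply: derive_coord_row; exact: C2_diff Uy.
move=> v w; split=> x Ux.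
  split; first by apply: differentiable_coord_row; exact: C2_diff Ux.
  apply: differentiable_near_eq (n1 x v Ux) _.
  by apply: differentiable_coord_row; exact: C2_diff1 Ux.
have n2 : \forall y \near x,
    'D_w ('D_v (fun z => F z 0 c)) y = 'D_w ('D_v F) y 0 c.
  move: (nU x Ux); apply: nearS => y Uy; rewrite (near_eq_derive w (n1 y v Uy)).
  by apply: derive_coord_row; exact: C2_diff1 Uy.
apply: (near_eq_continuous n2).
have h := C2_cont2 (v := v) (w := w) cF Ux.
exact: (cvg_comp _ _ h (@continuous_coord R 1 k 0 c _)).
Qed.

Lemma C2_rows F : (forall c, C2_on U (fun y => F y 0 c)) -> C2_on U F.
Proof.
move=> cF.
have nU x : U x -> \forall y \near x, U y by move=> Ux; exact: open_nbhs_nbhs.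
have dF y : U y -> differentiable F y.
  by move=> Uy; apply: differentiable_rows => c; exact: C2_diff Uy.
have n1 x v c : U x -> \forall y \near x, 'D_v F y 0 c = 'D_v (fun z => F z 0 c) y.
  by move=> /nU; apply: nearS => y Uy; apply/esym/derive_coord_row/dF.
have d1 y v : U y -> differentiable ('D_v F) y.
  move=> Uy; apply: differentiable_rows => c.
  apply: differentiable_near_eq (n1 y v c Uy) _; exact: C2_diff1 Uy.
move=> v w; split=> x Ux; first by split; [exact: dF|exact: d1].
apply: (cvg_mx (nbhs_filter x)) => i c; rewrite ord1.
have n2 : \forall y \near x,
    'D_w ('D_v F) y 0 c = 'D_w ('D_v (fun z => F z 0 c)) y.
  move: (nU x Ux); apply: nearS => y Uy; rewrite -(near_eq_derive w (n1 y v c Uy)).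
  by apply/esym/derive_coord_row/d1.
by apply: (near_eq_continuous n2); exact: C2_cont2 Ux.
Qed.

End RowValued.

Section Newton.
Variables (R : realType) (n k : nat) (U : set 'rV[R]_n) (F : 'rV[R]_n -> 'rV[R]_k).
Hypotheses (oU : open U) (cF : C2_on U F).
Variable x : 'rV[R]_n.
Hypothesis Ux : U x.
Local Notation e i := (delta_mx 0 i : 'rV[R]_n).

(** Mean value theorem for each coordinate of [F] on the segment from z to y, on which all partial
    derivatives are within eps / K of their values at [x]. Uniformity in both points is what the
    Newton and swap arguments use. *)
Lemma strict_differentiability (eps : R) : 0 < eps ->
  exists2 d : R, 0 < d & forall y, ball x d y -> U y /\
    forall z, ball x d z -> `|F y - F z - 'D_(y - z) F x| <= eps * `|y - z|.
Proof.
move=> eps0; pose K := n%:R + 1 : R.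
have K0 : 0 < K by rewrite ltr_wpDl.
have eK : 0 < eps / K by rewrite divr_gt0.
have cc c := C2_coord_row oU c cF.
have nU : \forall y \near x, U y by exact: open_nbhs_nbhs.
have nD : \forall y \near x, forall c i,
    `|'D_(e i) (fun z => F z 0 c) x - 'D_(e i) (fun z => F z 0 c) y| <= eps / K.
  apply: near_forall_ord => c; apply: near_forall_ord => i.
  by have /cvgrPdist_le/(_ _ eK) := differentiable_continuous (C2_diff1 (e i) (cc c) Ux).
have /nbhs_ballP[d /= d0 dP] := nearI nU nD.
exists d => // y yb; split=> [|z zb]; first by have [] := dP _ yb.
apply: mx_norm_le_entries => [|i c]; first by rewrite mulr_ge0 // ltW.
rewrite ord1 !mxBE -(derive_coord_row _ _ (C2_diff cF Ux)).
have [t t01|t /andP[t0 t1]] := @MVT_dir R _ (fun z => F z 0 c) z (y - z).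
  by have [Uz _] := dP _ (ball_segment t01 zb yb); exact: C2_diff (cc c) Uz.
have t01 : 0 <= t <= 1 by rewrite !ltW.
have [Uz hz] := dP _ (ball_segment t01 zb yb).
move: (z + t *: (y - z)) Uz hz => q Uq hq.
rewrite [z + _]addrC subrK => ->.
rewrite (derive_row_basis _ (C2_diff (cc c) Uq)) (derive_row_basis _ (C2_diff (cc c) Ux)).
rewrite -sumrB; apply: le_trans (sum_le_card (K := `|y - z| * (eps / K)) _ _) _.
- by rewrite mulr_ge0 // ltW.
- move=> l _; rewrite -mulrBr normrM; apply: ler_pM => //; first exact: mx_entry_le_norm.
  by rewrite distrC; exact: hq.
- have -> : n%:R * (`|y - z| * (eps / K)) = eps * `|y - z| * (n%:R / K) by ring.
  by rewrite ler_piMr ?mulr_ge0 ?(ltW eps0) // ler_pdivrMr // mul1r /K lerDl.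
Qed.

Hypothesis Fx : F x = 0.
Variable N : 'M[R]_(k, n).
Hypothesis FN : forall u : 'rV[R]_k, 'D_(u *m N) F x = u.

(** A bound for the operator norm of u -> u N in the max norms, increased by 1 so that it can be
    divided by. *)
Definition mulK := k%:R * `|N| + 1.

Lemma mulK_gt0 : 0 < mulK. Proof. by rewrite ltr_wpDl // mulr_ge0. Qed.

Lemma mul_norm_le (u : 'rV[R]_k) : `|u *m N| <= mulK * `|u|.
Proof.
apply: (@le_trans _ _ (k%:R * (`|u| * `|N|))); last first.
  by rewrite /mulK mulrDl mul1r mulrCA mulrC -[X in X <= _]addr0 lerD // mulrAC.
apply: mx_norm_le_entries => [|i j]; first by rewrite !mulr_ge0.
rewrite mxE; apply: sum_le_card => [|l _]; first by rewrite mulr_ge0.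
by rewrite normrM ler_pM //; exact: mx_entry_le_norm.
Qed.

(* A minimizer [u] of [|F (z + u N)|] on the ball of radius [2 |F z|] is a zero,
   since the Newton step [u - F (z + u N)] stays in the ball and halves the value. *)
Lemma newton : exists2 d : R, 0 < d & forall z, ball x d z ->
  exists u : 'rV[R]_k, `|u| <= 2 * `|F z| /\ F (z + u *m N) = 0.
Proof.
have K0 := mulK_gt0.
(* Since the derivative of [F] along u N is u, this tolerance makes u -> u - F (z + u N) Lipschitz
   with constant 1/2. *)
have e0 : 0 < (2 * mulK)^-1 by rewrite invr_gt0 mulr_gt0.
have [d d0 dP] := strict_differentiability e0.
(* The bound on [F z] gives |u N| <= mulK * 2 |F z| <= d / 2 for all candidates u, which keeps z + u
   N in the ball of radius d. *)
have nF : \forall z \near x, ball x (d / 2) z /\ `|F z| < d / 2 / (2 * mulK).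
  apply: nearI; first by apply: nbhsx_ballx; rewrite divr_gt0.
  have h0 : 0 < d / 2 / (2 * mulK) by rewrite !divr_gt0 // mulr_gt0.
  have /cvgrPdist_lt/(_ _ h0) := differentiable_continuous (C2_diff cF Ux).
  by apply: nearS => z; rewrite Fx sub0r normrN.
have /nbhs_ballP[d' /= d0' dP'] := nF.
exists d' => // z zb; have [zb2 Fz] := dP' _ zb.
pose B := [set u : 'rV[R]_k | `|u| <= 2 * `|F z|].
have inb u : B u -> ball x d (z + u *m N).
  rewrite /B /= => Bu; rewrite -ball_normE /= opprD addrA.
  apply: le_lt_trans (ler_normB _ _) _; rewrite [d]splitr.
  move: zb2; rewrite -ball_normE /= => zb2; apply: ltr_leD => //.
  apply: le_trans (mul_norm_le u) _; apply: le_trans (ler_wpM2l (ltW K0) Bu) _.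
  move: Fz; rewrite ltr_pdivlMr ?mulr_gt0 // => /ltW; apply: le_trans.
  by rewrite mulrCA mulrA mulrC.
have contr u u' : B u -> B u' ->
    `|(u - F (z + u *m N)) - (u' - F (z + u' *m N))| <= `|u - u'| / 2.
  move=> Bu Bu'; have [_ /(_ _ (inb _ Bu'))] := dP _ (inb _ Bu).
  have -> : z + u *m N - (z + u' *m N) = (u - u') *m N.
    by rewrite mulmxBl opprD addrACA subrr add0r.
  rewrite FN => h.
  have -> : u - F (z + u *m N) - (u' - F (z + u' *m N)) =
     - (F (z + u *m N) - F (z + u' *m N) - (u - u')).
    by rewrite !opprB [RHS]addrC !addrA; apply/rowP => c; rewrite !mxE; ring.
  rewrite normrN; apply: le_trans h _.
  apply: le_trans (ler_wpM2l (ltW e0) (mul_norm_le _)) _.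
  have -> : (2 * mulK)^-1 * (mulK * `|u - u'|) = `|u - u'| / 2.
    by field; rewrite gt_eqF.
  by [].
have B0 : B 0 by rewrite /B /= normr0 mulr_ge0.
have Bstep u : B u -> B (u - F (z + u *m N)).
  move=> Bu; have := contr _ _ Bu B0; rewrite mul0mx addr0 sub0r subr0 opprK => h.
  rewrite /B /=.
  have -> : u - F (z + u *m N) = (u - F (z + u *m N) + F z) - F z by rewrite addrK.
  apply: le_trans (ler_normB _ _) _; move: Bu h; rewrite /B /=.
  move: `|u| `|F z| `|_ + _| => a b c; lra.
have cB : closed B.
  have -> : B = (fun u : 'rV[R]_k => `|u|) @^-1` [set t | t <= 2 * `|F z|] by [].
  apply: closed_comp; last exact: closed_le.
  by move=> u _; exact: norm_continuous.
have bB : bounded_set B.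
  exists (2 * `|F z|); split; first exact: num_real.
  by move=> M MF u Bu; exact: le_trans Bu (ltW MF).
have cont : {within B, continuous (fun u => `|F (z + u *m N)|)}.
  apply: continuous_in_subspaceT => u /set_mem Bu.
  have c1 : (z + u' *m N) @[u' --> u] --> z + u *m N.
    apply: (cvg_mx (nbhs_filter u)) => a b; rewrite !mxE.
    under eq_fun do rewrite !mxE.
    apply: cvgD; first exact: cvg_cst.
    apply: (cvg_sumr (nbhs_filter u)) => l _.
    by apply: cvgM; [exact: continuous_coord|exact: cvg_cst].
  have c2 : F y @[y --> z + u *m N] --> F (z + u *m N).
    apply: differentiable_continuous; apply: (C2_diff cF).
    by have [] := dP _ (inb _ Bu).
  have c3 : F (z + u' *m N) @[u' --> u] --> F (z + u *m N).
    exact: (@cvg_comp _ _ _ (fun u' => z + u' *m N) F _ _ _ c1 c2).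
  exact: (cvg_norm c3).
have B_neq0 : B !=set0 by exists 0.
have [u /set_mem Bu umin] := EVT_min_rV B_neq0 (bounded_closed_compact bB cB) cont.
exists u; split=> //.
have h1 := umin _ (mem_set (Bstep _ Bu)).
have h2 := contr _ _ Bu (Bstep _ Bu).
set w := F (z + u *m N) in h1 h2 *.
have h3 : `|F (z + (u - w) *m N)| <= `|w| / 2.
  move: h2; set w' := F (z + (u - w) *m N).
  have -> : u - w - (u - w - w') = w' by rewrite opprB addrC subrK.
  by rewrite opprB addrC subrK.
apply/eqP; rewrite -normr_le0; move: (le_trans h1 h3).
move: `|w| => t; lra.
Qed.

(** Near [x] the increment of [F] along u N differs from u by at most |u| / 2, so it vanishes only
    for u = 0. *)
Lemma kernel_injective : exists2 d : R, 0 < d &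
  forall z (u : 'rV[R]_k), ball x d z -> ball x d (z + u *m N) ->
    F z = 0 -> F (z + u *m N) = 0 -> u = 0.
Proof.
have K0 := mulK_gt0.
have e0 : 0 < (2 * mulK)^-1 by rewrite invr_gt0 mulr_gt0.
have [d d0 dP] := strict_differentiability e0.
exists d => // z u zb zub Fz Fzu; have [_ /(_ _ zb)] := dP _ zub.
rewrite Fz Fzu subrr [z + _]addrC addrK FN sub0r normrN => h.
apply/eqP; rewrite -normr_le0; move: (le_trans h (ler_wpM2l (ltW e0) (mul_norm_le u))).
have -> : (2 * mulK)^-1 * (mulK * `|u|) = `|u| / 2.
  by field; rewrite gt_eqF.
by move: `|u| => t; lra.
Qed.

End Newton.

(** * Tangent directions and averaged charts *)

Lemma deriveBd (R : realType) (E F : normedModType R) (f : E -> F) (x v w : E) :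
  differentiable f x -> 'D_(v - w) f x = 'D_v f x - 'D_w f x.
Proof. by move=> df; rewrite !deriveE // linearB. Qed.

(** The main terms differ by 2s, the perturbations by at most s / 2. *)
Lemma swap_gap (R : realType) (s a b c : R) : 0 < s ->
  - (s / 4) <= a <= s / 4 -> - (s / 4) <= b <= s / 4 ->
  c + s * (1 - 0) + a = c + s * (0 - 1) + b -> False.
Proof. by move=> s0 /andP[? ?] /andP[? ?] h; lra. Qed.

Section Tangent.
Variables (R : realType) (n k : nat) (M : set 'rV[R]_n).
Local Notation e i := (delta_mx 0 i : 'rV[R]_n).
Implicit Types (x y z : 'rV[R]_n).

Lemma differential_right_inverse (F : 'rV[R]_n -> 'rV[R]_k) x : differentiable F x ->
  (forall z : 'rV[R]_k, exists h, setT h /\ 'd F x h = z) ->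
  exists N : 'M[R]_(k, n), forall u : 'rV[R]_k, 'D_(u *m N) F x = u.
Proof.
move=> dF sF.
have /choice[h hP] : forall c : 'I_k, exists h, 'd F x h = delta_mx 0 c.
  by move=> c; have [h [_ hc]] := sF (delta_mx 0 c); exists h.
exists (\matrix_c h c) => u.
rewrite mulmx_sum_row derive_sumd // [RHS]row_sum_delta; apply: eq_bigr => c _.
by rewrite rowK deriveZd // deriveE // hP.
Qed.

Lemma near_coord_neq x (i j : 'I_n) : x 0 i != x 0 j ->
  \forall y \near x, (y : 'rV[R]_n) 0 i != (y : 'rV[R]_n) 0 j.
Proof.
move=> xij.
have cB : ((y : 'rV[R]_n) 0 i - (y : 'rV[R]_n) 0 j) @[y --> x] --> x 0 i - x 0 j.
  exact: (cvgB (@continuous_coord R 1 n 0 i x) (@continuous_coord R 1 n 0 j x)).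
have d0 : 0 < `|x 0 i - x 0 j| by rewrite normr_gt0 subr_eq0.
move/cvgrPdist_lt: cB => /(_ _ d0); apply: nearS => y hy.
by apply/eqP => yij; move: hy; rewrite yij subrr subr0 ltxx.
Qed.

Lemma nbhs_eball x (d : R) : 0 < d -> \forall y \near x, eball x d y.
Proof.
move=> d0; rewrite /eball /=.
have c : (\sum_i (x 0 i - y 0 i) ^+ 2) @[y --> x] --> \sum_(i < n) (x 0 i - x 0 i) ^+ 2.
  apply: (cvg_sumr (nbhs_filter x)) => i _.
  have h : (x 0 i - y 0 i) @[y --> x] --> x 0 i - x 0 i.
    by apply: cvgB; [exact: cvg_cst|exact: continuous_coord].
  exact: (cvgM h h).
have e0 : 0 < d ^+ 2 by rewrite exprn_gt0.
move/cvgrPdist_lt: c => /(_ _ e0); apply: nearS => y.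
rewrite [X in X - _]big1 => [|i _]; last by rewrite subrr expr0n.
rewrite sub0r normrN ger0_norm //; apply: sumr_ge0 => i _; exact: sqr_ge0.
Qed.

Lemma eball_center x (d : R) : 0 < d -> eball x d x.
Proof. by move=> d0; apply: nbhs_singleton; exact: nbhs_eball. Qed.

(** Local symmetry used at the centre of its ball, for permutations in the stabilizer of [x]. *)
Lemma locally_symmetric_near x : locally_symmetric M -> M x ->
  \forall y \near x, forall s : 'S_n, perm_act s x = x -> M y -> M (perm_act s y).
Proof.
move=> [_ /(_ x)] h Mx; have [d d0 dP] := h Mx.
have := nbhs_eball x d0; apply: nearS => y yb s sx My.
have [] // : (M `&` eball x d) (perm_act s y).
rewrite -(dP x Mx (eball_center x d0) s sx).
by exists y.
Qed.

Section Chart.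
Variables (i j : 'I_n).
Hypothesis ij : i != j.
Local Notation eij := (e i - e j).

Lemma norm_eij : `|eij| <= 1.
Proof.
apply: mx_norm_le_entries => // a l; rewrite ord1 !mxE /=.
case: (eqVneq l i) => [->|li]; first by rewrite (negPf ij) subr0 normr1.
by case: (l == j); rewrite ?sub0r ?normrN ?normr1 ?subrr ?normr0.
Qed.

Lemma swap_diff y : y - perm_act (tperm i j) y = (y 0 i - y 0 j) *: eij.
Proof.
apply/rowP => l; rewrite !mxE !eqxx /= tpermV.
case: tpermP => [->|->|/eqP li /eqP lj].
- by rewrite eqxx (negPf ij) subr0 mulr1.
- by rewrite eqxx eq_sym (negPf ij) mulr0n mulr1n; ring.
- by rewrite (negPf li) (negPf lj) !subrr mulr0.
Qed.

Definition glued x := \forall y \near x, M y -> y 0 i = y 0 j.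

Variables (U : set 'rV[R]_n) (F : 'rV[R]_n -> 'rV[R]_k) (x : 'rV[R]_n).
Hypotheses (oU : open U) (Ux : U x) (cF : C2_on U F) (Mx : M x).
Hypothesis MF : forall y, U y -> (M y <-> F y = 0).
Hypothesis sym : locally_symmetric M.
Hypothesis xij : x 0 i = x 0 j.

(** A point y of M and its swap both lie in M and differ by (y_i - y_j)(e_i - e_j). As [F] vanishes
    at both, strict differentiability gives L |y_i - y_j| <= (L / 2) |y_i - y_j|. *)
Lemma glued_transversal : 'D_eij F x <> 0 -> glued x.
Proof.
move=> /eqP Fe; pose L := `|'D_eij F x|.
have L0 : 0 < L by rewrite normr_gt0.
have L2 : 0 < L / 2 by rewrite divr_gt0.
have [d d0 dP] := strict_differentiability oU cF Ux L2.
have sx : perm_act (tperm i j) x = x.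
  by apply/eqP; rewrite eq_sym -subr_eq0 swap_diff xij subrr scale0r.
have nb : \forall y \near x, ball x d y by exact: nbhsx_ballx.
have := nearI nb (locally_symmetric_near sym Mx); apply: nearS => y [yb ys] My.
have Msy := ys _ sx My.
have syb : ball x d (perm_act (tperm i j) y).
  rewrite -ball_normE /= -[X in X - _]sx -perm_actB perm_act_norm.
  by move: yb; rewrite -ball_normE.
have [Uy /(_ _ syb)] := dP _ yb; have [Usy _] := dP _ syb.
rewrite ((MF Uy).1 My) ((MF Usy).1 Msy) swap_diff (deriveZd _ _ (C2_diff cF Ux)).
rewrite subrr sub0r normrN !normrZ -/L => h.
apply/eqP; rewrite -subr_eq0 -normr_le0.
have h2 := le_trans h (ler_wpM2l (ltW L2) (ler_wpM2l (normr_ge0 (y 0 i - y 0 j)) norm_eij)).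
move: h2; rewrite mulr1 mulrC mulrAC ler_pdivlMr // => h2.
by rewrite -(ler_pM2l L0) mulr0; move: h2; move: (L * `|y 0 i - y 0 j|) => t; lra.
Qed.

Hypothesis Fx : F x = 0.
Variable N : 'M[R]_(k, n).
Hypothesis FN : forall u : 'rV[R]_k, 'D_(u *m N) F x = u.

(** Starting from a point [a] of M with equal coordinates i and j, move by s in the tangent
    direction e_i - e_j and return to M by a Newton correction too short to close the gap 2s just
    opened. *)
Lemma not_glued_tangent : 'D_eij F x = 0 ->
  \forall a \near x, M a -> ~ glued a.
Proof.
move=> Fe; have K0 := mulK_gt0 N.
have [dN dN0 dNP] := newton oU cF Ux Fx FN.
(* The tangent move then gives |F z| <= s / (8 mulK N), hence a correction of norm at most mulK N *
   2 |F z| <= s / 4. *)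
have e0 : 0 < (8 * mulK N)^-1 by rewrite invr_gt0 mulr_gt0.
have [d d0 dP] := strict_differentiability oU cF Ux e0.
pose r := Num.min dN d / 2.
have r0 : 0 < r by rewrite divr_gt0 // lt_min dN0.
have : \forall a \near x, ball x r a by exact: nbhsx_ballx.
apply: nearS => a ab Ma ga.
have aij : a 0 i = a 0 j by exact: (nbhs_singleton ga).
have /nbhs_ballP[t /= t0 tP] := ga.
(* Small enough for [z] and [p] to stay in the balls around [x], and for [p] to stay in the ball
   around [a] where points of M have equal coordinates i and j. *)
pose s := Num.min r t / 4.
have s0 : 0 < s by rewrite divr_gt0 // lt_min r0.
have sr : s <= r / 4 by rewrite ler_pM2r ?invr_gt0 // ge_min lexx.
have st : s <= t / 4 by rewrite ler_pM2r ?invr_gt0 // ge_min lexx orbT.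
pose z := a + s *: eij.
have az : `|s *: eij| <= s.
  by rewrite normrZ gtr0_norm // ler_piMr ?norm_eij // ltW.
have rd : r + r <= d by rewrite -splitr ge_min lexx orbT.
have rN : r + r <= dN by rewrite -splitr ge_min lexx.
have xa : `|x - a| < r by move: ab; rewrite -ball_normE.
have zb : `|x - z| < r + r.
  rewrite /z opprD addrA; apply: le_lt_trans (ler_normB _ _) _.
  by apply: ltr_leD => //; apply: le_trans az _; move: sr r0; lra.
have ab' : ball x d a by rewrite -ball_normE /=; move: xa rd r0; lra.
have zb' : ball x d z by rewrite -ball_normE /=; exact: lt_le_trans zb rd.
have zbN : ball x dN z by rewrite -ball_normE /=; exact: lt_le_trans zb rN.
have [Ua _] := dP _ ab'; have Fa := (MF Ua).1 Ma.
have Fz : `|F z| <= (8 * mulK N)^-1 * s.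
  have [_ /(_ _ ab')] := dP _ zb'.
  have -> : z - a = s *: eij by rewrite /z addrC addKr.
  rewrite Fa subr0 (deriveZd _ _ (C2_diff cF Ux)) Fe scaler0 subr0 => h.
  by apply: le_trans h _; apply: ler_wpM2l => //; exact: ltW.
have [u [uz Fu]] := dNP _ zbN.
have uN : `|u *m N| <= s / 4.
  apply: le_trans (mul_norm_le N u) _; apply: le_trans (ler_wpM2l (ltW K0) uz) _.
  apply: le_trans (ler_wpM2l (ltW K0) (ler_wpM2l _ Fz)) _ => //.
  have -> : mulK N * (2 * ((8 * mulK N)^-1 * s)) = s / 4 by field; rewrite gt_eqF.
  by [].
pose p := z + u *m N.
have pb : ball x d p.
  rewrite -ball_normE /= /p /z !opprD !addrA.
  apply: le_lt_trans (ler_normB _ _) _.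
  apply: le_lt_trans (lerD (ler_normB _ _) (lexx _)) _.
  by move: xa az uN sr rd s0; move: `|x - a| `|s *: eij| `|u *m N| => ? ? ?; lra.
have [Up _] := dP _ pb.
have Mp : M p by apply/(MF Up).
have : p 0 i = p 0 j.
  apply: tP Mp; rewrite -ball_normE /= /p /z !opprD !addrA subrr sub0r.
  apply: le_lt_trans (ler_normB _ _) _; rewrite normrN.
  by move: az uN st s0; move: `|s *: eij| `|u *m N| => ? ?; lra.
have ui := le_trans (mx_entry_le_norm (u *m N) 0 i) uN.
have uj := le_trans (mx_entry_le_norm (u *m N) 0 j) uN.
have pE l : p 0 l = a 0 l + s * ((l == i)%:R - (l == j)%:R) + (u *m N) 0 l.
  by rewrite /p /z ![in LHS]mxE !eqxx /= [in RHS]mxE.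
rewrite !pE aij !eqxx (negPf ij) [j == i]eq_sym (negPf ij) mulr0n mulr1n.
by move: ui uj; rewrite !ler_norml => ui uj; exact: swap_gap s0 ui uj.
Qed.

End Chart.

Lemma tangent_swap (U : set 'rV[R]_n) (F : 'rV[R]_n -> 'rV[R]_k) x i j :
  connected M -> locally_symmetric M ->
  (forall x, M x -> C2_submanifold_around setT M k x) ->
  (exists y, M y /\ injective (fun l : 'I_n => y 0 l)) ->
  open U -> U x -> C2_on U F -> M x -> (forall y, U y -> (M y <-> F y = 0)) ->
  x 0 i = x 0 j -> 'D_(e i) F x = 'D_(e j) F x.
Proof.
move=> conM sym chart [y0 [My0 inj]] oU Ux cF Mx MF xij.
have [->//|ij] := eqVneq i j.
have dF := C2_diff cF Ux.
suff : 'D_(e i - e j) F x = 0.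
  by rewrite (deriveBd _ _ dF) => /eqP; rewrite subr_eq0 => /eqP h; exact: h.
apply: contrapT => Fe; have gx := glued_transversal ij oU Ux cF Mx MF sym xij Fe.
pose G := glued i j.
have Gij a : M a -> G a -> a 0 i = a 0 j by move=> Ma Ga; exact: (nbhs_singleton Ga).
suff BM : M `&` G = M.
  have [_ Gy] : (M `&` G) y0 by rewrite BM.
  by have /inj ij' := Gij _ My0 Gy; move: ij; rewrite ij' eqxx.
apply: conM; first by exists x.
  exists G => //; rewrite openE => a Ga.
  have h : nbhs a (fun y => nbhs y (fun z => M z -> z 0 i = z 0 j)) := near_join Ga.
  exact: h.
exists (closure (M `&` G)); first exact: closed_closure.
apply/seteqP; split=> [a MGa|a [Ma ca]].
  by split; [exact: MGa.1|exact: subset_closure].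
split=> //.
have aij : a 0 i = a 0 j.
  apply/eqP; apply: contrapT => /negP aij.
  have [b [[Mb Gb] /= bij]] := ca _ (near_coord_neq aij).
  by move: bij; rewrite (Gij _ Mb Gb) eqxx.
(* Closedness, by a chart at the limit point [a]: if e_i - e_j is transversal there, [a] is glued;
   if it is tangent, no point of M near [a] is glued, although [a] is a limit of such points. *)
have [_ [V [H [oV Va cH sH MH]]]] := chart a Ma.
have MH' b : V b -> (M b <-> H b = 0) by move=> Vb; exact: MH.
have [He|He] := pselect ('D_(e i - e j) H a = 0); last first.
  exact: (glued_transversal ij oV Va cH Ma MH' sym aij He).
have [N HN] := differential_right_inverse (C2_diff cH Va) sH.
have na := not_glued_tangent ij oV Va cH MH' ((MH' a Va).1 Ma) HN He.
by have [b [[Mb Gb] /= nb]] := ca _ na; case: (nb Mb Gb).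
Qed.

End Tangent.

(** * Averaging a chart over the permutations that preserve the blocks *)

Section Averaging.
Variables (R : realType) (n k : nat) (s : 'S_n) (F : 'rV[R]_n -> 'rV[R]_k).
Local Notation e i := (delta_mx 0 i : 'rV[R]_n).
Local Notation blk := (same_orbit s).

Definition blockperms : {set 'S_n} := [set t : 'S_n | [forall i, blk i (t i)]]%SET.

Lemma blockpermsP (t : 'S_n) : reflect (forall i, blk i (t i)) (t \in blockperms).
Proof. by rewrite inE; exact: forallP. Qed.

Definition averaged (y : 'rV[R]_n) : 'rV[R]_k :=
  (#|blockperms|%:R)^-1 *: \sum_(t in blockperms) F (perm_act t y).

Lemma blockperms_card : (#|blockperms|%:R : R) != 0.
Proof.
rewrite pnatr_eq0 -lt0n; apply/card_gt0P; exists 1%g; apply/blockpermsP => i.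
by rewrite perm1; exact: same_orbit_refl.
Qed.

Lemma averaged_invariant c : block_invariant blk (fun y => averaged y 0 c).
Proof.
move=> t tb y; rewrite /averaged; congr ((_ *: _ : 'rV_k) _ _).
rewrite [RHS](reindex_inj (mulgI t)) /=; apply: eq_big => [u|u _]; last first.
  by rewrite perm_actM.
apply/idP/idP => /blockpermsP ub; apply/blockpermsP => i.
  rewrite permM; apply: same_orbit_trans (tb i) (ub _).
have := ub ((t^-1)%g i); rewrite permM permKV; apply: same_orbit_trans.
by rewrite same_orbit_sym; have := tb ((t^-1)%g i); rewrite permKV.
Qed.

Variables (U : set 'rV[R]_n) (xb : 'rV[R]_n) (rho : R).
Hypotheses (oU : open U) (cF : C2_on U F).
Hypothesis rU : ball xb rho `<=` U.
Hypothesis rho0 : 0 < rho.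
Hypothesis xb_blk : forall i j, blk i j -> xb 0 i = xb 0 j.
Hypothesis gradF : forall i j, blk i j -> 'D_(e i) F xb = 'D_(e j) F xb.

Lemma ball_xb_open : open (ball xb rho).
Proof. exact: ball_open. Qed.

Lemma blockperm_fix t : t \in blockperms -> perm_act t xb = xb.
Proof.
move=> /blockpermsP tb; apply/rowP => i; rewrite mxE.
by apply: xb_blk; have := tb ((t^-1)%g i); rewrite permKV.
Qed.

Lemma blockperm_ball t y d : t \in blockperms -> ball xb d y -> ball xb d (perm_act t y).
Proof.
move=> tb; rewrite -ball_normE /= -{2}(blockperm_fix tb) -perm_actB.
by rewrite perm_act_norm.
Qed.

Lemma C2_perm_act t : t \in blockperms ->
  C2_on (ball xb rho) (fun y => F (perm_act t y)).
Proof.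
move=> tb.
have -> : (fun y => F (perm_act t y)) = F \o mulmxr (perm_mx t).
  by apply/funext => y; rewrite /= perm_actE.
have := C2_on_comp_linear (@continuous_mulmxr R 1 n n (perm_mx t)) cF.
apply: C2_onS => y yb; apply: rU; rewrite /= -perm_actE.
exact: blockperm_ball.
Qed.

Lemma C2_sum (r : seq 'S_n) : all [in blockperms] r ->
  C2_on (ball xb rho) (fun y => \sum_(t <- r) F (perm_act t y)).
Proof.
elim: r => [_|t r IH /= /andP[tb /IH{}IH]].
  (* The empty sum is written as a multiple of [F] to inherit its regularity. *)
  have -> : (fun y : 'rV[R]_n => \sum_(t <- [::]) F (perm_act t y)) = 0 \*: F.
    by apply/funext => y; rewrite big_nil /= scale0r.
  by apply: C2_onS rU _; exact: C2_onZ.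
have -> : (fun y => \sum_(t' <- t :: r) F (perm_act t' y)) =
    (fun y => F (perm_act t y)) + (fun y => \sum_(t' <- r) F (perm_act t' y)).
  by apply/funext => y; rewrite big_cons.
exact: (C2_onD ball_xb_open (C2_perm_act tb) IH).
Qed.

Lemma averagedE : averaged = (#|blockperms|%:R)^-1 \*:
  (fun y => \sum_(t <- enum blockperms) F (perm_act t y)).
Proof. by apply/funext => y; rewrite /averaged /= big_enum. Qed.

Lemma averaged_C2 : C2_on (ball xb rho) averaged.
Proof.
rewrite averagedE; apply: C2_onZ; first exact: ball_xb_open.
by apply: C2_sum; apply/allP => t; rewrite mem_enum.
Qed.

(** Each block permutation fixes [xb], and the partial derivatives there agree within a block, so
    all terms of the average have the same derivative at [xb]. *)
Lemma derive_averaged v : 'D_v averaged xb = 'D_v F xb.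
Proof.
have Ub : U xb by apply: rU; exact: ballxx.
have dF := C2_diff cF Ub.
have B h : 'D_h F xb = \sum_j h 0 j *: 'D_(e j) F xb.
  rewrite [in LHS](row_sum_delta h) derive_sumd; last exact: dF.
  by apply: eq_bigr => j _; rewrite deriveZd; last exact: dF.
have DFE h t : t \in blockperms -> 'D_h (fun y => F (perm_act t y)) xb = 'D_h F xb.
  move=> tb.
  have -> : (fun y => F (perm_act t y)) = F \o mulmxr (perm_mx t).
    by apply/funext => y; rewrite /= perm_actE.
  rewrite derive_comp_linear /= -!perm_actE (blockperm_fix tb).
  rewrite (B (perm_act t h)) (B h) (reindex_inj (@perm_inj _ t)) /=.
  apply: eq_bigr => i _; rewrite mxE permK.
  have -> : 'D_(e (t i)) F xb = 'D_(e i) F xb; last by [].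
  by apply/esym/gradF; have /blockpermsP := tb; exact.
have Dsum (r : seq 'S_n) : all [in blockperms] r ->
    'D_v (fun y => \sum_(t <- r) F (perm_act t y)) xb = (size r)%:R *: 'D_v F xb.
  elim: r => [_|t r IH /= /andP[tb ar]].
    have -> : (fun y : 'rV[R]_n => \sum_(t <- [::]) F (perm_act t y)) = cst 0.
      by apply/funext => y; rewrite big_nil.
    by rewrite derive_cst scale0r.
  have -> : (fun y => \sum_(t' <- t :: r) F (perm_act t' y)) =
      (fun y => F (perm_act t y)) + (fun y => \sum_(t' <- r) F (perm_act t' y)).
    by apply/funext => y; rewrite big_cons.
  rewrite deriveD.
  - by rewrite DFE // IH // [in RHS]mulrS scalerDl scale1r.
  - by apply: diff_derivable; apply: (C2_diff (C2_perm_act tb)); exact: ballxx.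
  - by apply: diff_derivable; apply: (C2_diff (C2_sum ar)); exact: ballxx.
have ae : all [in blockperms] (enum blockperms) by apply/allP => t; rewrite mem_enum.
rewrite averagedE deriveZ.
  by rewrite Dsum // scalerA -cardE mulVf ?blockperms_card ?scale1r.
by apply: diff_derivable; apply: (C2_diff (C2_sum ae)); exact: ballxx.
Qed.

End Averaging.

(** * Lifting the averaged chart *)

Lemma Delta_orb (R : realType) (n : nat) (s : 'S_n) (x : 'rV[R]_n) (i j : 'I_n) :
  Delta s x -> same_orbit s i j -> x 0 i = x 0 j.
Proof.
move=> sx ij; have : porbit s i \in Ppart x by rewrite sx; apply: imset_f.
move=> /imsetP[l _ il].
have /eqP -> : x 0 i == x 0 l by have := porbit_id s i; rewrite il inE.
by have /eqP -> : x 0 j == x 0 l by move: ij; rewrite /same_orbit il inE.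
Qed.

Section LocalEquation.
Variables (R : realType) (n k : nat) (M : set 'rV[R]_n) (s : 'S_n).
Variables (U : set 'rV[R]_n) (F : 'rV[R]_n -> 'rV[R]_k) (x : 'rV[R]_n) (rho : R).
Local Notation e i := (delta_mx 0 i : 'rV[R]_n).
Hypotheses (oU : open U) (cF : C2_on U F) (rU : ball x rho `<=` U) (rho0 : 0 < rho).
Hypothesis MF : forall y, U y -> (M y <-> F y = 0).
Hypotheses (Mx : M x) (sym : locally_symmetric M).
Hypothesis x_blk : forall i j, same_orbit s i j -> x 0 i = x 0 j.
Hypothesis gradF : forall i j, same_orbit s i j -> 'D_(e i) F x = 'D_(e j) F x.
Variable N : 'M[R]_(k, n).
Hypothesis FN : forall u : 'rV[R]_k, 'D_(u *m N) F x = u.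

(** Block permutations fix [x], so by local symmetry they keep nearby points of M in M, where every
    term of the average is 0. *)
Lemma averaged_vanish : \forall y \near x, M y -> averaged s F y = 0.
Proof.
have nb : \forall y \near x, ball x rho y by exact: nbhsx_ballx.
have := nearI nb (locally_symmetric_near sym Mx); apply: nearS => y [yb ys] My.
rewrite /averaged big1 ?scaler0 // => t tb.
apply/MF; first by apply: rU; exact: (blockperm_ball x_blk tb yb).
exact: ys (blockperm_fix x_blk tb) My.
Qed.

(* If the averaged chart vanishes at [y], Newton's correction [y + u N] of [y] lies on
   [M], so the averaged chart vanishes there too; it is injective along the range
   of [N], hence [u = 0]. *)
Lemma averaged_equation : \forall y \near x, M y <-> averaged s F y = 0.
Proof.
have Ux : U x by apply: rU; exact: ballxx.
have Fx : F x = 0 by apply/(MF Ux).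
have [dN dN0 dNP] := newton oU cF Ux Fx FN.
have AN u : 'D_(u *m N) (averaged s F) x = u.
  by rewrite (derive_averaged oU cF rU rho0 x_blk gradF); exact: FN.
have oB : open (ball x rho) by exact: ball_open.
have [dK dK0 dKP] := kernel_injective oB
  (averaged_C2 oU cF rU x_blk) (ballxx x rho0) AN.
have /nbhs_ballP[dv /= dv0 dvP] := averaged_vanish.
pose r := Num.min rho (Num.min dK dv).
have r0 : 0 < r by rewrite !lt_min rho0 dK0 dv0.
have K0 := mulK_gt0 N.
(* So small a value of [F y] makes the correction at most mulK N * 2 * r / (8 mulK N) = r / 4, and
   the corrected point stays within r of [x]. *)
have e0 : 0 < r / (8 * mulK N) by rewrite divr_gt0 // mulr_gt0.
have cFx : \forall y \near x, `|F y| < r / (8 * mulK N).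
  have /cvgrPdist_lt/(_ _ e0) := differentiable_continuous (C2_diff cF Ux).
  by apply: nearS => y; rewrite Fx sub0r normrN.
have d0 : 0 < Num.min dN (r / 2) by rewrite lt_min dN0 divr_gt0.
have nb : \forall y \near x, ball x (Num.min dN (r / 2)) y by exact: nbhsx_ballx.
have := nearI (nearI nb cFx) averaged_vanish; apply: nearS => y [[yb Fy] yv].
split=> [//|Ay].
have yN : ball x dN y.
  by move: yb; rewrite -!ball_normE /= lt_min => /andP[].
have yr : `|x - y| < r / 2.
  by move: yb; rewrite -ball_normE /= lt_min => /andP[].
have [u [uF Fu]] := dNP y yN.
have uN : `|u *m N| <= r / 4.
  apply: le_trans (mul_norm_le N u) _; apply: le_trans (ler_wpM2l (ltW K0) uF) _.
  apply: le_trans (ler_wpM2l (ltW K0) (ler_wpM2l _ (ltW Fy))) _ => //.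
  have -> : mulK N * (2 * (r / (8 * mulK N))) = r / 4 by field; rewrite gt_eqF.
  by [].
have zr : `|x - (y + u *m N)| < r.
  rewrite opprD addrA; apply: le_lt_trans (ler_normB _ _) _.
  by move: yr uN r0; move: `|x - y| `|u *m N| => ? ?; lra.
have [rr rK rv] : [/\ r <= rho, r <= dK & r <= dv].
  by rewrite /r !ge_min !lexx !orbT.
have zb t : r <= t -> ball x t (y + u *m N).
  by move=> rt; rewrite -ball_normE /=; exact: lt_le_trans zr rt.
have Mz : M (y + u *m N) by apply/MF => //; apply: rU; exact: zb.
have Az : averaged s F (y + u *m N) = 0 by exact: dvP (zb _ rv) Mz.
have yK : ball x dK y.
  by rewrite -ball_normE /=; move: yr rK r0; move: `|x - y| => ?; lra.
have u0 := dKP y u yK (zb _ rK) Ay Az.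
by move: Mz; rewrite u0 mul0mx addr0.
Qed.

End LocalEquation.

(** * Composing a block-symmetric chart with the eigenvalue map *)

Section SpectralChart.
Variables (R : realType) (n k : nat) (s : 'S_n).
Variables (F : 'rV[R]_n -> 'rV[R]_k) (U : set 'rV[R]_n).
Hypotheses (oU : open U) (cF : C2_on U F).
Hypothesis Finv : forall c, block_invariant (same_orbit s) (fun y => F y 0 c).

Lemma Lsym_open : open (@Lsym R n s @^-1` U).
Proof.
have C0 : 0 < n%:R + 1 :> R by rewrite ltr_wpDl ?ler0n.
have /continuousP := Lam_continuous C0 (@Lsym_lip R n s); exact.
Qed.

Lemma Lsym_C2 : C2_on (@Lsym R n s @^-1` U) (F \o @Lsym R n s).
Proof.
have /choice[basis basisP] := @eigbasis_ex R n s.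
have C0 : 0 < n%:R + 1 :> R by rewrite ltr_wpDl ?ler0n.
have D0 : 0 < n%:R * n%:R + 1 :> R by rewrite ltr_wpDl ?mulr_ge0 ?ler0n.
apply: (C2_rows Lsym_open) => c.
exact: (spectral_C2 (@same_orbit_refl n s) (@same_orbit_sym n s)
  (@same_orbit_trans n s) (Lsym_model basisP) C0 D0 (@Lsym_lip R n s)
  (rotated_bound basisP) oU (C2_coord_row oU c cF) (Finv c)).
Qed.

(** A direction h of R^n is lifted to the matrix with diagonal h in an eigenbasis of X; its
    [rotated] form is [diag_mx h], so the first-derivative formula returns the derivative along
    h. *)
Lemma Lsym_surjective X h : U (Lsym s X) ->
  exists H, Ssigma s H /\ 'D_H (F \o @Lsym R n s) X = 'D_h F (Lsym s X).
Proof.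
move=> UX; have /choice[basis basisP] := @eigbasis_ex R n s.
have C0 : 0 < n%:R + 1 :> R by rewrite ltr_wpDl ?ler0n.
have [BB Bblk _] := basisP X; have BB' := mulmx1C BB.
pose H := basis X *m diag_mx h *m (basis X)^T.
have SH : Ssigma s H.
  split; first by rewrite /H !trmx_mul trmxK tr_diag_mx mulmxA.
  have BTblk i j : ~~ same_orbit s i j -> (basis X)^T i j = 0.
    by rewrite same_orbit_sym mxE => /Bblk.
  have Dblk i j : ~~ same_orbit s i j -> diag_mx h i j = 0.
    move=> ij; rewrite mxE; case: eqVneq ij => [->|_ _]; last by rewrite mulr0n.
    by rewrite same_orbit_refl.
  by move=> i j; exact: (block_mul (block_mul Bblk Dblk) BTblk).
exists H; split; first exact: SH.
have rotH : rotated s basis X H = diag_mx h.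
  rewrite /rotated (symblock_id SH) /H !mulmxA BB' mul1mx -mulmxA BB'.
  by rewrite mulmx1.
have dG := C2_diff Lsym_C2 UX; have dF := C2_diff cF UX.
apply/rowP => c; rewrite -(derive_coord_row H c dG) -(derive_coord_row h c dF).
have [_ DE] := spectral_diff1 (@same_orbit_refl n s) (@same_orbit_sym n s)
  (@same_orbit_trans n s) (Lsym_model basisP) C0 (@Lsym_lip R n s) oU
  (C2_coord_row oU c cF) (Finv c) UX.
have := DE H; rewrite rotH => DH; apply: etrans DH _.
rewrite (derive_row_basis h (differentiable_coord_row c dF)).
by apply: eq_bigr => i _; rewrite mxE eqxx mulr1n mulrC.
Qed.

End SpectralChart.

Theorem theorem4p9 (R : realType) (n d : nat) (M : set 'rV[R]_n)
    (sigma : 'S_n) (xbar : 'rV[R]_n) :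
  loc_sym_C2_submanifold d M ->
  (exists y, M y /\ exists2 rho : R, 0 < rho &
     forall z, M z -> eball y rho z -> injective (fun i : 'I_n => z 0 i)) ->
  M xbar -> nonincr xbar -> Delta sigma xbar ->
  forall Xbar : 'M[R]_n, Ssigma sigma Xbar -> lambda_sigma sigma Xbar = xbar ->
    C2_submanifold_around (Ssigma sigma) (lambda_preimage sigma M) (n - d) Xbar.
Proof.
move=> [_ conM chart sym] [y0 [My0 [r0 r00 /(_ _ My0 (eball_center y0 r00)) inj]]].
move=> Mx _ Dx Xbar SX LX.
have x_blk i j := @Delta_orb R n sigma xbar i j Dx.
have [_ [U [F [oU Ux cF sF MF']]]] := chart _ Mx.
have MF y : U y -> (M y <-> F y = 0) by move=> Uy; exact: MF'.
have [N FN] := differential_right_inverse (C2_diff cF Ux) sF.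
have gradF i j : same_orbit sigma i j ->
    'D_(delta_mx 0 i : 'rV[R]_n) F xbar = 'D_(delta_mx 0 j : 'rV[R]_n) F xbar.
  move=> ij; apply: (tangent_swap conM sym chart _ oU Ux cF Mx MF (x_blk _ _ ij)).
  by exists y0.
have /nbhs_ballP[rho /= rho0 rU] : nbhs xbar U by exact: open_nbhs_nbhs.
have := averaged_equation oU cF rU rho0 MF Mx sym x_blk gradF FN.
move=> /nbhs_ballP[eps /= eps0 epsP].
(* [rho] guarantees that the averaged chart is C^2, [eps] that it cuts out M. *)
pose r := Num.min rho eps; have rgt0 : 0 < r by rewrite lt_min rho0.
pose A := averaged sigma F; pose V : set 'rV[R]_n := ball xbar r.
have oV : open V by exact: ball_open.
have cA : C2_on V A.
  apply: C2_onS (averaged_C2 oU cF rU x_blk).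
  by apply: le_ball; rewrite /r ge_min lexx.
have Ainv c : block_invariant (same_orbit sigma) (fun y => A y 0 c).
  exact: averaged_invariant.
have LXb : Lsym sigma Xbar = xbar by rewrite /Lsym symblock_id.
have VX : V (Lsym sigma Xbar) by rewrite LXb; exact: ballxx.
split; first by split=> //; rewrite LX.
exists (@Lsym R n sigma @^-1` V), (A \o @Lsym R n sigma); split.
- exact: Lsym_open.
- exact: VX.
- exact: Lsym_C2.
(* [z *m N] is a preimage of z under the derivative of the averaged chart, which is that of [F] at
   [xbar]; it is then lifted to S^n_sigma. *)
- move=> z; have [H [SH HE]] := Lsym_surjective oV cA Ainv (z *m N) VX.
  exists H; split; first exact: SH.
  rewrite -(deriveE _ (C2_diff (Lsym_C2 oV cA Ainv) VX)).
  apply: etrans HE _; rewrite LXb (derive_averaged oU cF rU rho0 x_blk gradF).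
  exact: FN.
- move=> Y VY SY; rewrite /= /Lsym (symblock_id SY).
  have /epsP E : ball xbar eps (lambda_sigma sigma Y).
    have := VY; rewrite /= /Lsym (symblock_id SY); apply: le_ball.
    by rewrite /r ge_min lexx orbT.
  by split=> [[_ /E]//|/E ?]; split.
Qed.
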